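(* Let $(X,d,\mu,\mathcal D)$ be a space of homogeneous type. Let $\eta\in[0,m)$, $\vec r=(r_i)_{i=1}^m\in[1,\infty)^m$ and $s'\in[1,\infty)$. Let $\mathcal G$ be a collection of $(m+1)$-tuples $(g,f_1,\dots,f_m)$ of nonnegative functions. Given $\vec p=(p_i)_{i=1}^m$ and $\frac1{\tilde p}:=\sum_{i=1}^m\frac1{p_i}-\eta>0$ with $(\vec r,s)\preceq(\vec p,\tilde p)$, assume that for all $\vec\omega=(\omega_i)_{i=1}^m\in A_{(\vec p,\tilde p),(\vec r,s)}$, $$\|g\|_{L^{\tilde p}(\omega^{\tilde p})}\le C\big([\vec\omega]_{A_{(\vec p,\tilde p),(\vec r,s)}}\big)\prod_{i=1}^m\|f_i\|_{L^{p_i}(\omega_i^{p_i})}\quad\text{for every }(g,f_1,\dots,f_m)\in\mathcal G,$$ where $\omega=\prod_{i=1}^m\omega_i$. Then for all $\vec q=(q_i)_{i=1}^m$ and $\frac1{\tilde q}:=\sum_{i=1}^m\frac1{q_i}-\eta>0$ with $(\vec r,s)\prec(\vec q,\tilde q)$, and for all $\vec v=(v_i)_{i=1}^m\in A_{(\vec q,\tilde q),(\vec r,s)}$, $$\|g\|_{L^{\tilde q}(v^{\tilde q})}\le C\big([\vec v]_{A_{(\vec q,\tilde q),(\vec r,s)}}\big)\prod_{i=1}^m\|f_i\|_{L^{q_i}(v_i^{q_i})}\quad\text{for every }(g,f_1,\dots,f_m)\in\mathcal G,$$ where $v=\prod_{i=1}^mv_i$. Moreover, for the same family of exponents and weights,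 and for all exponents $\vec t=(t_1,\dots,t_m)$ with $\frac1{\tilde t}:=\frac1{t_1}+\cdots+\frac1{t_m}-\eta>0$ and $(\vec r,s)\prec(\vec t,\tilde t)$, $$\Big\|\Big(\sum_j(g^j)^{\tilde t}\Big)^{1/\tilde t}\Big\|_{L^{\tilde q}(v^{\tilde q})}\le C\big([\vec v]_{A_{(\vec q,\tilde q),(\vec r,s)}}\big)\prod_{i=1}^m\Big\|\Big(\sum_j(f_i^j)^{t_i}\Big)^{1/t_i}\Big\|_{L^{q_i}(v_i^{q_i})}$$ for all $\{(g^j,f_1^j,\dots,f_m^j)\}_j\subseteq\mathcal G$.
   Context: $(X,d,\mu)$ is a space of homogeneous type: $d$ is a quasi-metric and $\mu$ a regular measure with $0<\mu(B(x,2r))\le C_\mu\mu(B(x,r))<\infty$ for all quasi-metric balls. $\mathcal D=\bigcup_{j=1}^N\mathcal D^j$, where $\mathcal D^1,\dots,\mathcal D^N$ are fixed dyadic lattices. A dyadic lattice with parameters $0<c_0\le C_0<\infty$, $0<\delta<1$ is $\bigcup_{k\in\mathbb Z}\mathcal D_k$, $\mathcal D_k=\{Q^k_j\}_{j\in J_k}$ measurable sets with centres $z_j^k$, such that (i) $X=\bigcup_jQ_j^k$ for each $k$; (ii) for $k\ge l$, $Q\in\mathcal D_k$, $Q'\in\mathcal D_l$, either $Q\cap Q'=\emptyset$ or $Q\subseteq Q'$; (iii) $B(z_j^k,c_0\delta^k)\subseteq Q_j^k\subseteq B(z_j^k,C_0\delta^k)$; (iv) if $l\ge k$ and $Q_{j'}^l\subseteq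 Q_j^k$ then $B(z_{j'}^l,C_0\delta^l)\subseteq B(z_j^k,C_0\delta^k)$. The lattices are chosen so that for some $\gamma\ge1$ every ball $B(x,r)$ is contained in some $Q\in\mathcal D$ with $\operatorname{diam}Q\le\gamma r$. A weight is a locally integrable function with $0<\omega<\infty$ a.e. $s$ is the conjugate exponent of $s'$. $\langle f\rangle_{r,B}=\big(\frac1{\mu(B)}\int_B|f|^rd\mu\big)^{1/r}$ (essential supremum on $B$ if $r=\infty$). $\|f\|_{L^p(\omega^p)}=\|f\omega\|_{L^p(\mu)}$. Order relations: $(\vec r,s)\preceq(\vec p,\tilde p)$ means $r_i\le p_i$ for all $i$ and $\tilde p\le s$; $(\vec r,s)\prec(\vec p,\tilde p)$ means $r_i<p_i$ for all $i$ and $\tilde p<s$. Weight class: for exponents $0<p_1,\dots,p_m\le\infty$, $\frac1{\tilde p}=\sum_i\frac1{p_i}-\eta$, $(\vec r,s)\preceq(\vec p,\tilde p)$, $\vec\omega=(\omega_1,\dots,\omega_m)\in A_{(\vec p,\tilde p),(\vec r,s)}$ iff $$[\vec\omega]_{A_{(\vec p,\tilde p),(\vec r,s)}}:=\sup_{B\in\mathcal D}\Big(\prod_{j=1}^m\langle\omega_j^{-1}\rangle_{\frac1{\frac1{r_j}-\frac1{p_j}},B}\Big)\langle\omega\rangle_{\frac1{\frac1{\tilde p}-\frac1s},B}<\infty,\qquad\omega:=\prod_i\omega_i.$$ $C(\cdot)$ denotes a finite constant depending only on the indicated weight constant (and on the fixed parameters), possibly different at each occurrence. *)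

(* Defs.v *)
From HB Require Import structures.
From mathcomp Require Import all_boot all_order all_algebra.
From mathcomp Require Import all_classical all_reals all_analysis.
From mathcomp Require Import ess_sup_inf measurable_realfun.

Set Implicit Arguments.
Unset Strict Implicit.
Unset Printing Implicit Defensive.
Import Order.TTheory GRing.Theory Num.Theory.

Local Open Scope classical_set_scope.
Local Open Scope ring_scope.

Section QuasiMetric.
Context {R : realType} {X : Type}.
Implicit Types d : X -> X -> R.

Record quasi_metric d : Prop := QuasiMetric {
  quasi_metric_ge0 : forall x y, 0 <= d x y ;
  quasi_metric_eq0 : forall x y, d x y = 0 <-> x = y ;
  quasi_metric_sym : forall x y, d x y = d y x ;
  quasi_metric_triangle : exists2 A : R, 1 <= A &
    forall x y z, d x y <= A * (d x z + d z y) }.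

Definition qball d (x : X) (r : R) : set X := [set y | d x y < r].

(* Balls of a quasi-metric need not be open in the topology it induces. *)
Definition qopen d (U : set X) : Prop :=
  forall x, U x -> exists2 r : R, 0 < r & qball d x r `<=` U.

Definition qclosed d (F : set X) : Prop := qopen d (~` F).

Definition qdiam d (A : set X) : \bar R :=
  ereal_sup [set (d x y)%:E | x in A & y in A].

End QuasiMetric.

Section HomogeneousType.
Context {disp : measure_display} {R : realType} {X : measurableType disp}.
Implicit Types (mu : {measure set X -> \bar R}) (d : X -> X -> R).

(* Approximation by closed sets from inside. It is implied by inner regularity
   with respect to compact sets, but X is not assumed to be complete. *)
Definition regular_measure d mu : Prop :=
  forall A, measurable A -> forall e : R, 0 < e ->
    exists F U, [/\ qclosed d F, qopen d U, F `<=` A, A `<=` U &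
                    (mu (U `\` F) <= e%:E)%E].

Definition doubling d mu : Prop :=
  exists C : R, forall (x : X) (r : R), 0 < r ->
    [/\ (0 < mu (qball d x (2 * r)))%E,
        (mu (qball d x (2 * r)) <= C%:E * mu (qball d x r))%E &
        (C%:E * mu (qball d x r) < +oo)%E].

Record homogeneous_type d mu : Prop := HomogeneousType {
  homogeneous_quasi_metric : quasi_metric d ;
  homogeneous_borel : forall U, qopen d U -> measurable U ;
  homogeneous_ball : forall x r, measurable (qball d x r) ;
  homogeneous_regular : regular_measure d mu ;
  homogeneous_doubling : doubling d mu }.

Record dyadic_lattice d := DyadicLattice {
  dl_c0 : R ;
  dl_C0 : R ;
  dl_delta : R ;
  dl_index : int -> Type ;
  dl_cube : forall k, dl_index k -> set X ;
  dl_center : forall k, dl_index k -> X ;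
  dl_param : 0 < dl_c0 <= dl_C0 ;
  dl_delta01 : 0 < dl_delta < 1 ;
  dl_measurable : forall k (j : dl_index k), measurable (dl_cube j) ;
  dl_cover : forall k, \bigcup_(j in [set: dl_index k]) dl_cube j = setT ;
  dl_nested : forall k l (i : dl_index k) (j : dl_index l), l <= k ->
    dl_cube i `&` dl_cube j = set0 \/ dl_cube i `<=` dl_cube j ;
  dl_ball : forall k (j : dl_index k),
    qball d (dl_center j) (dl_c0 * dl_delta ^ k) `<=` dl_cube j /\
    dl_cube j `<=` qball d (dl_center j) (dl_C0 * dl_delta ^ k) ;
  dl_ball_nested : forall k l (j : dl_index k) (j' : dl_index l), k <= l ->
    dl_cube j' `<=` dl_cube j ->
    qball d (dl_center j') (dl_C0 * dl_delta ^ l) `<=`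
      qball d (dl_center j) (dl_C0 * dl_delta ^ k) }.

Definition dyadic_cubes d N (L : 'I_N -> dyadic_lattice d) : set (set X) :=
  [set Q | exists i k (j : dl_index (L i) k), Q = dl_cube j].

Definition covers_balls d (D : set (set X)) : Prop :=
  exists2 gamma : R, 1 <= gamma &
    forall (x : X) (r : R), 0 < r ->
      exists Q, [/\ D Q, qball d x r `<=` Q & (qdiam d Q <= (gamma * r)%:E)%E].

End HomogeneousType.

Section WeightClass.
Context {disp : measure_display} {R : realType} {X : measurableType disp}.
Context (mu : {measure set X -> \bar R}) (d : X -> X -> R) (D : set (set X)).
Local Open Scope ereal_scope.

Definition weight (w : X -> \bar R) : Prop :=
  [/\ measurable_fun setT w,
      forall (x : X) (r : R), mu.-integrable (qball d x r) w &
      {ae mu, forall x, 0 < w x < +oo}].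

(* For an infinite exponent the restriction `|f| \_ B` (zero outside B) has the
   same essential supremum as |f| on B, provided that mu B > 0. *)
Definition average (t : \bar R) (B : set X) (f : X -> \bar R) : \bar R :=
  match t with
  | t'%:E => ((mu B)^-1 * \int[mu]_(x in B) (`|f x| `^ t')) `^ t'^-1
  | _ => ess_sup mu ((fun x => `|f x|) \_ B)
  end.

Definition weighted_Lnorm (p : \bar R) (f w : X -> \bar R) : \bar R :=
  'N[mu]_p[(fun x => f x * w x)].

Context {m : nat}.
Implicit Types (p : 'I_m -> \bar R) (w : 'I_m -> X -> \bar R).

(* Exponents are extended reals; in ereal_scope +oo^-1 = 0 and 0^-1 = +oo. *)
Definition inv_tilde (eta : R) p : \bar R := \sum_(i < m) (p i)^-1 - eta%:E.

Definition tilde (eta : R) p : \bar R := (inv_tilde eta p)^-1.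

Definition exp_le (r : 'I_m -> R) (s : \bar R) p (pt : \bar R) : Prop :=
  (forall i, (r i)%:E <= p i) /\ pt <= s.

Definition exp_lt (r : 'I_m -> R) (s : \bar R) p (pt : \bar R) : Prop :=
  (forall i, (r i)%:E < p i) /\ pt < s.

Definition prod_weight w (x : X) : \bar R := \prod_(i < m) w i x.

Definition A_const (r : 'I_m -> R) (s : \bar R) p (pt : \bar R) w : \bar R :=
  ereal_sup [set
    (\prod_(j < m) average ((r j)%:E^-1 - (p j)^-1)^-1 B (fun x => (w j x)^-1))
      * average (pt^-1 - s^-1)^-1 B (prod_weight w)
    | B in D].

Definition A_class (r : 'I_m -> R) (s : \bar R) p (pt : \bar R) w : Prop :=
  (forall i, weight (w i)) /\ A_const r s p pt w < +oo.

Definition tuple_fun : Type := ((X -> \bar R) * ('I_m -> X -> \bar R))%type.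

Definition nonneg_family (G : set tuple_fun) : Prop :=
  forall g f, G (g, f) ->
    [/\ measurable_fun setT g, forall x, 0 <= g x,
        forall i, measurable_fun setT (f i) & forall i x, 0 <= f i x].

Definition weighted_bound (eta : R) (r : 'I_m -> R) (s : \bar R) p
    (C : R -> R) (G : set tuple_fun) : Prop :=
  forall w, A_class r s p (tilde eta p) w ->
  forall g f, G (g, f) ->
    weighted_Lnorm (tilde eta p) g (prod_weight w) <=
    (C (fine (A_const r s p (tilde eta p) w)))%:E *
      \prod_(i < m) weighted_Lnorm (p i) (f i) (w i).

(* The l^t norm over the index set J (finite or countable) is the Lnorm for the
   counting measure on nat of the sequence extended by 0 outside J; for t = +oo
   it is the supremum. *)
Definition lt_norm (t : \bar R) (J : set nat) (h : nat -> X -> \bar R) (x : X)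
  : \bar R := 'N[counting]_t[(h ^~ x) \_ J].

Definition vector_weighted_bound (eta : R) (r : 'I_m -> R) (s : \bar R) p
    (t : 'I_m -> \bar R) (C : R -> R) (G : set tuple_fun) : Prop :=
  forall w, A_class r s p (tilde eta p) w ->
  forall (J : set nat) (g : nat -> X -> \bar R)
         (f : nat -> 'I_m -> X -> \bar R),
    (forall j, J j -> G (g j, f j)) ->
    weighted_Lnorm (tilde eta p) (lt_norm (tilde eta t) J g) (prod_weight w) <=
    (C (fine (A_const r s p (tilde eta p) w)))%:E *
      \prod_(i < m)
        weighted_Lnorm (p i) (lt_norm (t i) J (fun j => f j i)) (w i).

End WeightClass.

(* Main.v *)
(** Let [alpha_i = 1/r_i - 1/q_i] and [alpha_0 = 1/q~ - 1/s], put
    [sigma_i = v_i^(-1/alpha_i)] and [sigma_0 = (prod_i v_i)^(1/alpha_0)].  Then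
    [prod sigma^alpha = 1], and the weight constant bounds the products of the averages
    [<sigma>_Q^alpha].  For normalised functions let
    [h = h_0 + sum_i (f_i v_i)^(q_i) + (g v)^(q~)], which is integrable.  The maximal operators
    of power means taken with respect to the [sigma] are bounded on [L^1], and a Rubio de
    Francia iteration of their compositions produces a majorant [H] of [h], with
    [int H <= 2 int h], whose averages and essential infima against all the [sigma] are
    simultaneously comparable on every cube.  Hence the weights
    [w_i = v_i H^(1/p_i - 1/q_i)] satisfy the condition for the exponents [p] with a controlled
    constant, and since [(f_i v_i)^(q_i)] and [(g v)^(q~)] are dominated by [H], the bound
    assumed for [w] turns into the desired bound for [v].

    Two adjustments are needed.  To make [w_i] locally integrable, [H] is truncated at
    [n sigma_i] when its exponent is positive.  And since nothing is assumed about the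
    dependence of [C] on the weight constant, one of the [w_i] is multiplied by
    [exp (- t 1_E)], where [E] is a fixed set splitting a cube, with [t] chosen by the
    intermediate value theorem so that the constant takes a prescribed value; if no cube can
    be split, weights are constant on cubes and all the constants equal 1.

    For the vector-valued estimate, the scalar theorem gives the bound for the exponents
    [t]; by Hölder's inequality for series the family of [l^t] sums satisfies it as well, and
    it can be extrapolated from [t] to [q]. *)
Require Import Defs.
From HB Require Import structures.
From mathcomp Require Import all_boot all_order all_algebra.
From mathcomp Require Import all_classical all_reals all_analysis.
From mathcomp Require Import ess_sup_inf measurable_realfun.
From mathcomp Require Import ring lra.

Set Implicit Arguments.
Unset Strict Implicit.
Unset Printing Implicit Defensive.
Import Order.TTheory GRing.Theory Num.Theory.
Import numFieldNormedType.Exports.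

Local Open Scope classical_set_scope.
Local Open Scope ring_scope.

(** Only reciprocals of exponents occur, and by the definition of [1/p~] the numbers [1/r_i - 1/p_i]
    and [1/p~ - 1/s] add up to [sum 1/r_i - eta - 1/s] for every [p]. Passing from [q] to [p] thus
    shifts weight between the indices at constant total. Each average contributes a power of the
    mass of [H] on the cube, and these powers cancel; this is how the off-diagonal parameter [eta]
    drops out.

    One maximal operator bounds [H] from below only by multiples of its own [sigma_i]. The condition
    on [v] amounts to a reverse Hölder inequality between [sigma_i] and [sigma_j], and composing the
    operators of [i] and [j] uses it to reach [sigma_j]. Means of exponent below 1 are not
    subadditive, so the iteration is a monotone fixed-point scheme and not a series of iterates.

    The bound for [g] is read backwards: once [(g v)^(q~)] is normalised to integral 1, the norm of
    [g] for the new weight cannot be small. Normalising needs a finite norm of [g v], hence the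
    bounded truncations of [g]. *)

Section RealInequalities.
Context {R : realType}.
Implicit Types (x y t : R).

Lemma powR_prod (I : finType) (P : pred I) (F : I -> R) t :
  (forall i, 0 <= F i) ->
  (\prod_(i | P i) F i) `^ t = \prod_(i | P i) F i `^ t.
Proof.
move=> F0.
suff [] : (\prod_(i | P i) F i) `^ t = \prod_(i | P i) F i `^ t /\
  0 <= \prod_(i | P i) F i by [].
elim/big_rec2 : _ => [|i y z _ [<- z0]]; first by rewrite powR1.
by rewrite powRM// mulr_ge0.
Qed.

Lemma powR_sum (I : finType) (P : pred I) (a : I -> R) x :
  0 < x -> x `^ (\sum_(i | P i) a i) = \prod_(i | P i) x `^ a i.
Proof.
move=> x0; elim/big_rec2 : _ => [|i y z _ <-]; first by rewrite powRr0.
by rewrite powRD// (gt_eqF x0) implybT.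
Qed.

(** After division by the weighted mean [A], each factor satisfies [x_i / A <= exp (x_i / A - 1)],
    and the exponents [a_i * (x_i / A - 1)] sum to zero. If [A = 0], some [x_i] with [a_i != 0]
    vanishes, and with it the product. *)
Lemma weighted_AMGM (I : finType) (a x : I -> R) :
  (forall i, 0 <= a i) -> (forall i, 0 <= x i) -> \sum_i a i = 1 ->
  \prod_i x i `^ a i <= \sum_i a i * x i.
Proof.
move=> a0 x0 a1; set A := \sum_i a i * x i.
have A0 : 0 <= A by apply: sumr_ge0 => i _; rewrite mulr_ge0.
move: A0; rewrite le_eqVlt => /predU1P[A0|A0].
  have ax i : a i * x i = 0.
    have /eqP := esym A0.
    rewrite psumr_eq0 => [/allP|j _]; last by rewrite mulr_ge0.
    by move=> /(_ i); rewrite mem_index_enum => /(_ isT) /eqP.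
  have [i ai] : exists i, a i != 0.
    apply/existsP; apply: contraPT a1; rewrite negb_exists => /forallP h.
    rewrite big1 => [/esym/eqP|i _]; first by rewrite oner_eq0.
    exact/eqP/negPn/(h i).
  rewrite -A0 (bigD1 i)//=.
  have -> : x i = 0 by move/eqP: (ax i); rewrite mulf_eq0 (negbTE ai) => /eqP.
  by rewrite powR0// mul0r.
have e i : x i `^ a i = A `^ a i * (x i / A) `^ a i.
  by rewrite -powRM ?divr_ge0 ?(ltW A0)// mulrCA divff ?gt_eqF// mulr1.
under eq_bigr do rewrite e.
rewrite big_split/= -powR_sum// a1 powRr1 ?(ltW A0)// -[leRHS]mulr1.
rewrite ler_pM2l//.
apply: (@le_trans _ _ (\prod_i expR (a i * (x i / A - 1)))).
  apply: ler_prod => i _; rewrite powR_ge0/=.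
  have : x i / A <= expR (x i / A - 1).
    by apply: le_trans (expR_ge1Dx _); rewrite addrC subrK.
  move=> /(ge0_ler_powR (a0 i)); rewrite !nnegrE divr_ge0 ?(ltW A0)//.
  move=> /(_ isT (expR_ge0 _)) /le_trans; apply.
  by rewrite -expRM mulrC.
rewrite -expR_sum expR_le1; under eq_bigr do rewrite mulrBr mulr1.
rewrite sumrB a1 subr_le0.
under eq_bigr do rewrite mulrA.
by rewrite -mulr_suml -/A divff ?gt_eqF.
Qed.

(** Young's inequality without its weights, enough to see that mixed powers of integrable functions
    are integrable and to split a product when a constant is carried inside [x] or [y]. *)
Lemma powR_mul_le_add t x y : 0 <= t <= 1 -> 0 <= x -> 0 <= y ->
  x `^ t * y `^ (1 - t) <= x + y.
Proof.
move=> /andP[t0 t1] x0 y0.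
pose a (b : bool) := if b then t else 1 - t.
pose z (b : bool) := if b then x else y.
have := @weighted_AMGM _ a z; rewrite !big_bool/= => h.
apply: le_trans (h _ _ _) _.
- by case; rewrite /a ?subr_ge0.
- by case.
- by rewrite addrC subrK.
- by apply: lerD; rewrite ler_piMl// lerBlDr lerDl.
Qed.

End RealInequalities.

(** * Hölder's inequality for several functions, suprema under the integral sign *)

Section IntegralTools.
Context {disp : measure_display} {R : realType} {X : measurableType disp}.
Variable mu : {measure set X -> \bar R}.

Lemma measurable_powR_comp (f : X -> R) (t : R) :
  measurable_fun setT f -> measurable_fun setT (fun x => f x `^ t).
Proof. by move=> mf; apply: (@measurableT_comp _ _ _ _ _ _ (fun x => x `^ _)). Qed.

(** AM-GM is applied pointwise to the quotients [f_i / c_i]; after integration the sum of the [a_i]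
    is left. Exponents [a_i = 0] are allowed, which later lets an index drop out of the product. *)
Lemma integral_prod_powR_le (I : finType) (A : set X) (a : I -> R)
    (f : I -> X -> R) (c : I -> R) :
  measurable A -> (forall i, 0 <= a i) -> \sum_i a i = 1 ->
  (forall i x, 0 <= f i x) -> (forall i, measurable_fun setT (f i)) ->
  (forall i, 0 < c i) -> (forall i, \int[mu]_(x in A) (f i x)%:E <= (c i)%:E)%E ->
  (\int[mu]_(x in A) (\prod_i f i x `^ a i)%:E <= (\prod_i c i `^ a i)%:E)%E.
Proof.
move=> mA a0 a1 f0 mf c0 fc; set p := \prod_i c i `^ a i.
have p0 : 0 <= p by apply: prodr_ge0 => i _; exact: powR_ge0.
have mF i : measurable_fun A (EFin \o f i).
  by apply/measurable_EFinP; exact: measurable_funTS.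
have h x : \prod_i f i x `^ a i <= p * \sum_i a i / c i * f i x.
  have e i : f i x `^ a i = c i `^ a i * (f i x / c i) `^ a i.
    by rewrite -powRM ?divr_ge0 ?(ltW (c0 _))// mulrCA divff ?gt_eqF// mulr1.
  under eq_bigr do rewrite e.
  rewrite big_split/= ler_wpM2l//.
  apply: le_trans (weighted_AMGM _ _ _) _ => //.
    by move=> i; rewrite divr_ge0 ?(ltW (c0 _)).
  by rewrite le_eqVlt; apply/orP; left; apply/eqP/eq_bigr => i _; rewrite mulrA mulrAC.
apply: (@le_trans _ _ (\int[mu]_(x in A) (p%:E * \sum_i (a i / c i)%:E * (f i x)%:E))%E).
  apply: ge0_le_integral => //.
  - by move=> x _; rewrite lee_fin prodr_ge0// => i _; exact: powR_ge0.
  - apply/measurable_EFinP; apply: measurable_prod => i _.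
    apply: (@measurableT_comp _ _ _ _ _ _ (fun x => x `^ a i)) => //.
    exact: measurable_funTS.
  - apply: measurable_funeM; apply: emeasurable_sum => i.
    by apply: measurable_funeM; exact: mF.
  - by move=> x _; rewrite sumEFin lee_fin h.
rewrite ge0_integralZl//; last 2 first.
- by apply: emeasurable_sum => i; apply: measurable_funeM; exact: mF.
- by move=> x _; apply: sume_ge0 => i _; rewrite -EFinM lee_fin mulr_ge0 ?divr_ge0 ?(ltW (c0 _)).
rewrite -[leRHS]mule1 lee_wpmul2l// ge0_integral_sum//; last 2 first.
- by move=> i; apply: measurable_funeM; exact: mF.
- by move=> i x _; rewrite -EFinM lee_fin mulr_ge0 ?divr_ge0 ?(ltW (c0 _)).
apply: (@le_trans _ _ (\sum_i (a i)%:E)%E); last by rewrite sumEFin a1.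
apply: lee_sum => i _.
rewrite ge0_integralZl_EFin//; last 3 first.
- by move=> x _; rewrite lee_fin.
- exact: mF.
- by rewrite divr_ge0 ?(ltW (c0 _)).
apply: le_trans (lee_wpmul2l _ (fc i)) _; first by rewrite lee_fin divr_ge0 ?(ltW (c0 _)).
by rewrite -EFinM divfK ?gt_eqF.
Qed.

(** Running maxima replace a countable supremum by an increasing limit, so that a maximal operator
    has to be bounded for finitely many cubes only. *)
Fixpoint partial_max (u : nat -> \bar R) (n : nat) : \bar R :=
  if n is n'.+1 then maxe (partial_max u n') (u n') else 0%E.

Lemma partial_max_ge0 u n : (0 <= partial_max u n)%E.
Proof. by elim: n => [//|n ih] /=; rewrite le_max ih. Qed.

Lemma le_partial_max u : nondecreasing_seq (partial_max u).
Proof. by apply/nondecreasing_seqP => n /=; rewrite le_max lexx. Qed.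

Lemma ereal_sup_partial_max u : (forall n, 0 <= u n)%E ->
  ereal_sup (range u) = ereal_sup (range (partial_max u)).
Proof.
move=> u0; apply/eqP; rewrite eq_le; apply/andP; split.
  apply: ge_ereal_sup => _ [n _ <-]; apply: le_ereal_sup_tmp.
  by exists (partial_max u n.+1); [exists n.+1|rewrite /= le_max lexx orbT].
apply: ge_ereal_sup => _ [n _ <-]; elim: n => [|n ih] /=.
  by apply: le_ereal_sup_tmp; exists (u 0%N) => //; exists 0%N.
by rewrite ge_max ih/=; apply: ereal_sup_ubound; exists n.
Qed.

Lemma measurable_partial_max (f : nat -> X -> \bar R) n :
  (forall k, measurable_fun setT (f k)) ->
  measurable_fun setT (fun x => partial_max (f ^~ x) n).
Proof.
move=> mf; elim: n => [|n ih] /=; first exact: measurable_cst.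
exact: measurable_maxe.
Qed.

Lemma measurable_ereal_sup (f : nat -> X -> \bar R) :
  (forall n, measurable_fun setT (f n)) -> (forall n x, 0 <= f n x)%E ->
  measurable_fun setT (fun x => ereal_sup (range (f ^~ x))).
Proof.
move=> mf f0; apply: (emeasurable_fun_cvg (fun n x => partial_max (f ^~ x) n)).
  by move=> n; exact: measurable_partial_max.
move=> x _; rewrite ereal_sup_partial_max//.
exact/ereal_nondecreasing_cvgn/le_partial_max.
Qed.

Lemma integral_nd_sup_le (g : nat -> X -> \bar R) (B : \bar R) :
  (forall n, measurable_fun setT (g n)) -> (forall n x, 0 <= g n x)%E ->
  (forall x, nondecreasing_seq (g ^~ x)) ->
  (forall n, \int[mu]_x g n x <= B)%E ->
  (\int[mu]_x ereal_sup (range (g ^~ x)) <= B)%E.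
Proof.
move=> mg g0 ndg gB.
have -> : (fun x => ereal_sup (range (g ^~ x))) = (fun x => limn (g ^~ x)).
  apply/funext => x; apply/esym/cvg_lim => //.
  exact: ereal_nondecreasing_cvgn.
rewrite monotone_convergence//; apply: lime_le; last exact: nearW.
apply: ereal_nondecreasing_is_cvgn => a b ab.
by apply: ge0_le_integral => // x _; exact: ndg.
Qed.

Lemma integral_nd_sup (A : set X) (g : nat -> X -> \bar R) :
  measurable A ->
  (forall n, measurable_fun setT (g n)) -> (forall n x, 0 <= g n x)%E ->
  (forall x, nondecreasing_seq (g ^~ x)) ->
  (\int[mu]_(x in A) ereal_sup (range (g ^~ x)) =
   ereal_sup (range (fun n => \int[mu]_(x in A) g n x)))%E.
Proof.
move=> mA mg g0 ndg.
have -> : (fun x => ereal_sup (range (g ^~ x))) = (fun x => limn (g ^~ x)).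
  apply/funext => x; apply/esym/cvg_lim => //.
  exact: ereal_nondecreasing_cvgn.
have mgA n : measurable_fun A (g n) by exact: measurable_funTS.
rewrite monotone_convergence//.
apply/cvg_lim => //; apply: ereal_nondecreasing_cvgn => a b ab.
by apply: ge0_le_integral => // x _; exact: ndg.
Qed.

Lemma integral_ereal_sup_le (f : nat -> X -> \bar R) (B : \bar R) :
  (forall n, measurable_fun setT (f n)) -> (forall n x, 0 <= f n x)%E ->
  (forall n, \int[mu]_x (partial_max (f ^~ x) n) <= B)%E ->
  (\int[mu]_x ereal_sup (range (f ^~ x)) <= B)%E.
Proof.
move=> mf f0 fB.
under eq_integral do rewrite ereal_sup_partial_max//.
apply: (integral_nd_sup_le (g := fun n x => partial_max (f ^~ x) n)) => //.
- by move=> n; exact: measurable_partial_max.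
- by move=> n x; exact: partial_max_ge0.
- by move=> x; exact: le_partial_max.
Qed.

End IntegralTools.

(** * The bound on [L^1] for maximal operators of power means *)

Section MaximalInequality.
Context {disp : measure_display} {R : realType} {X : measurableType disp}.
Variable mu : {measure set X -> \bar R}.
Variables (Q : nat -> set X) (mQ : forall k, measurable (Q k)).

Definition list_union (s : seq nat) : set X := \big[setU/set0]_(k <- s) Q k.

Lemma measurable_list_union s : measurable (list_union s).
Proof. exact: bigsetU_measurable. Qed.

Lemma list_union_cons k s : list_union (k :: s) = Q k `|` list_union s.
Proof. by rewrite /list_union big_cons. Qed.

(* All that the maximal inequality uses about the cubes; a union of [N] nested families
   has this property. *)
Definition covering_bound (N : R) : Prop :=
  forall (s : seq nat) (f g : X -> \bar R),
    measurable_fun setT f -> measurable_fun setT g ->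
    (forall x, 0 <= f x)%E -> (forall x, 0 <= g x)%E ->
    (forall k, k \in s -> \int[mu]_(x in Q k) f x <= \int[mu]_(x in Q k) g x)%E ->
    (\int[mu]_(x in list_union s) f x <= N%:E * \int[mu]_(x in list_union s) g x)%E.

Lemma integral_indicM (E : set X) (f : X -> \bar R) : measurable E ->
  (\int[mu]_x ((\1_E x)%:E * f x) = \int[mu]_(x in E) f x)%E.
Proof.
move=> mE; rewrite [RHS]integral_mkcond; apply: eq_integral => x _.
by rewrite patchE indicE; case: (x \in E); rewrite ?mul1e ?mul0e.
Qed.

Lemma integral_setU_le (A B : set X) (f : X -> \bar R) :
  measurable A -> measurable B -> measurable_fun setT f ->
  (forall x, 0 <= f x)%E ->
  (\int[mu]_(x in A `|` B) f x <=
   \int[mu]_(x in A) f x + \int[mu]_(x in B) f x)%E.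
Proof.
move=> mA mB mf f0; have mBA : measurable (B `\` A) by exact: measurableD.
have -> : A `|` B = A `|` (B `\` A).
  apply/seteqP; split=> x [] //; [by left| |by left|by move=> [? _]; right].
  by move=> Bx; case: (pselect (A x)); [left|right].
rewrite ge0_integral_setU//.
- by rewrite leeD2l// ge0_subset_integral//; exact: measurable_funTS.
- exact: measurable_funTS.
- by rewrite disj_set2E setDIK.
Qed.

Section StoppedAverages.
Variable c : nat -> R.

(* The number [c k] is the average over [Q k].  If [s] lists cubes by increasing averages then
   [stopped a s x] is the largest average over a cube of [s] containing [x], and
   [stopped_sum] is the summation by parts of its power [t]. *)
Fixpoint increasing_from (a : R) (s : seq nat) : Prop :=
  if s is k :: s' then a <= c k /\ increasing_from (c k) s' else True.

Fixpoint stopped (a : R) (s : seq nat) (x : X) : R :=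
  if s is k :: s' then
    if x \in list_union s then stopped (c k) s' x else a
  else a.

Fixpoint stopped_sum (t a : R) (s : seq nat) (x : X) : R :=
  if s is k :: s' then
    (c k `^ t - a `^ t) * \1_(list_union s) x + stopped_sum t (c k) s' x
  else 0.

Lemma increasing_from_ge a s k : increasing_from a s -> k \in s -> a <= c k.
Proof.
elim: s a => [//|j s ih] a /= [aj hs]; rewrite inE => /predU1P[->//|ks].
exact: le_trans aj (ih _ hs ks).
Qed.

Lemma stopped_ge a s x : increasing_from a s -> a <= stopped a s x.
Proof.
elim: s a => [//|k s ih] a /= [ak hs]; case: ifPn => // _.
exact: le_trans ak (ih _ hs).
Qed.

Lemma stopped_ge_mem a s x k : increasing_from a s -> k \in s -> Q k x ->
  c k <= stopped a s x.
Proof.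
elim: s a => [//|j s ih] a /= [aj hs]; rewrite inE => ks Qkx.
have xU : x \in list_union (j :: s).
  rewrite inE; rewrite list_union_cons; move: ks => /predU1P[<-|ks]; first by left.
  by right; rewrite /list_union (big_rem k)//=; left.
rewrite xU; move: ks => /predU1P[->|ks]; first exact: stopped_ge.
exact: ih.
Qed.

Lemma stopped_sum_out t a s x : ~ list_union s x -> stopped_sum t a s x = 0.
Proof.
elim: s a => [//|k s ih] a xU /=; rewrite indicE memNset// mulr0 add0r ih//.
by move=> h; apply: xU; rewrite list_union_cons; right.
Qed.

(** The unions of the tails of the list decrease, so the indicators are 1 as far as the last cube
    containing [x] and 0 afterwards; the sum telescopes. *)
Lemma stopped_sumE t a s x : a `^ t + stopped_sum t a s x = stopped a s x `^ t.
Proof.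
elim: s a => [|k s ih] a /=; first by rewrite addr0.
case: ifPn => xU; rewrite indicE.
  by rewrite xU mulr1 addrA addrCA subrr addr0 ih.
rewrite (negbTE xU) mulr0 add0r stopped_sum_out ?addr0// => h.
by move/negP: xU; apply; rewrite inE list_union_cons; right.
Qed.

Lemma measurable_stopped_sum t a s : measurable_fun setT (stopped_sum t a s).
Proof.
elim: s a => [|k s ih] a /=; first exact: measurable_cst.
apply: measurable_funD => //; apply: measurable_funM => //.
by apply: measurable_indic; exact: measurable_list_union.
Qed.

Lemma stopped_sum_ge0 t a s x : 0 <= t -> 0 <= a -> increasing_from a s ->
  0 <= stopped_sum t a s x.
Proof.
move=> t0; elim: s a => [//|k s ih] a a0 /= [ak hs].
have k0 := le_trans a0 ak.
apply: addr_ge0; last exact: ih.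
by rewrite mulr_ge0// subr_ge0 ge0_ler_powR ?nnegrE.
Qed.

Lemma increasing_from_sort (s : seq nat) : (forall k, 0 <= c k) ->
  increasing_from 0 (sort (fun i j => c i <= c j) s).
Proof.
move=> c0; have : sorted (fun i j => c i <= c j) (sort (fun i j => c i <= c j) s).
  by apply: sort_sorted => i j; exact: le_total.
case: (sort _ s) => [//|k s'] /= ks'; split=> //.
elim: s' k ks' => [//|j s' ih] k /= /andP[kj js']; split=> //; exact: ih.
Qed.

(** The discrete form of [(1 - th) d(y^(1/th)) = y d(y^(1/th - 1))]. It replaces the layer-cake
    integration that leads from a weak-type to a strong-type bound. *)
Lemma powR_increment_le (th a b : R) : 0 < th < 1 -> 0 <= a -> a <= b ->
  (1 - th) * (b `^ th^-1 - a `^ th^-1) <= b * (b `^ (th^-1 - 1) - a `^ (th^-1 - 1)).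
Proof.
move=> /andP[th0 th1] a0 ab; have b0 := le_trans a0 ab.
have bb : b * b `^ (th^-1 - 1) = b `^ th^-1 by rewrite mulr_powRB1// invr_gt0.
pose w (i : bool) := if i then th else 1 - th.
pose z (i : bool) := if i then b `^ th^-1 else a `^ th^-1.
have := @weighted_AMGM _ _ w z; rewrite !big_bool/= => h.
have {}h : b * a `^ (th^-1 - 1) <= th * b `^ th^-1 + (1 - th) * a `^ th^-1.
  apply: le_trans (h _ _ _).
  - rewrite -!powRrM mulVf ?gt_eqF// powRr1//.
    by rewrite mulrBr mulr1 mulVf ?gt_eqF.
  - by case; rewrite /w ?subr_ge0 ltW.
  - by case; exact: powR_ge0.
  - by rewrite addrC subrK.
rewrite [leRHS]mulrBr bb; lra.
Qed.

Variables (sg : X -> R) (S : nat -> R) (psi : X -> \bar R) (N : R).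
Hypotheses (msg : measurable_fun setT sg) (sg0 : forall x, 0 < sg x).
Hypothesis Sint : forall k, (\int[mu]_(x in Q k) (sg x)%:E = (S k)%:E)%E.
Hypotheses (mpsi : measurable_fun setT psi) (psi0 : forall x, (0 <= psi x)%E).
Hypothesis cint : forall k, (\int[mu]_(x in Q k) psi x = (c k * S k)%:E)%E.
Hypotheses (N0 : 0 < N) (cov : covering_bound N).

Let msgE A : measurable A -> measurable_fun A (EFin \o sg).
Proof. by move=> mA; apply/measurable_EFinP; exact: measurable_funTS. Qed.

(** The weak-type bound for the measure [sg dmu]: on every listed cube the integral of [psi] is at
    least [a] times that of [sg], and [cov] passes from the cubes to their union. *)
Lemma weak_type_list (a : R) s : 0 <= a -> (forall k, k \in s -> a <= c k) ->
  (a%:E * \int[mu]_(x in list_union s) (sg x)%:E <=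
   N%:E * \int[mu]_(x in list_union s) psi x)%E.
Proof.
move=> a0 ac; have mE := measurable_list_union s.
rewrite -ge0_integralZl_EFin//; last 2 first.
- by move=> x _; rewrite lee_fin ltW.
- exact: msgE.
apply: cov => //.
- by apply: measurable_funeM; exact: msgE.
- by move=> x; rewrite -EFinM lee_fin mulr_ge0// ltW.
move=> k ks; rewrite ge0_integralZl_EFin//; last 2 first.
- by move=> x _; rewrite lee_fin ltW.
- exact: msgE.
rewrite Sint cint -EFinM lee_fin ler_wpM2r ?ac//.
by rewrite -lee_fin -Sint integral_ge0// => x _; rewrite lee_fin ltW.
Qed.

Lemma integral_list_union_lty s :
  (\int[mu]_(x in list_union s) (sg x)%:E < +oo)%E.
Proof.
elim: s => [|k s ih]; first by rewrite /list_union big_nil integral_set0.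
rewrite list_union_cons; apply: le_lt_trans (integral_setU_le _ _ _ _) _ => //.
- exact: measurable_list_union.
- exact: msgE.
- by move=> x; rewrite lee_fin ltW.
by rewrite lte_add_pinfty// Sint ltry.
Qed.

Lemma integral_stopped_sum_cons (f : X -> \bar R) t a k s :
  measurable_fun setT f -> (forall x, 0 <= f x)%E -> 0 <= t -> 0 <= a ->
  increasing_from a (k :: s) ->
  (\int[mu]_x ((stopped_sum t a (k :: s) x)%:E * f x) =
   (c k `^ t - a `^ t)%:E * \int[mu]_(x in list_union (k :: s)) f x +
   \int[mu]_x ((stopped_sum t (c k) s x)%:E * f x))%E.
Proof.
move=> mf f0 t0 a0 hs; have [ak hs'] := hs; have k0 := le_trans a0 ak.
have d0 : 0 <= c k `^ t - a `^ t by rewrite subr_ge0 ge0_ler_powR ?nnegrE.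
have mE := measurable_list_union (k :: s).
transitivity (\int[mu]_x ((c k `^ t - a `^ t)%:E * ((\1_(list_union (k :: s)) x)%:E * f x)
   + (stopped_sum t (c k) s x)%:E * f x))%E.
  apply: eq_integral => x _ /=; rewrite EFinD ge0_muleDl ?lee_fin//.
  - by rewrite EFinM muleA.
  - by rewrite mulr_ge0.
  - exact: stopped_sum_ge0.
have mi : measurable_fun setT (fun x => (\1_(list_union (k :: s)) x)%:E * f x)%E.
  apply: emeasurable_funM => //; apply/measurable_EFinP.
  exact: measurable_indic.
rewrite ge0_integralD//.
- rewrite ge0_integralZl_EFin ?integral_indicM// => x _.
  by rewrite mule_ge0 ?lee_fin.
- by move=> x _; rewrite mule_ge0 ?mule_ge0 ?lee_fin.
- exact: measurable_funeM.
- by move=> x _; rewrite mule_ge0 ?lee_fin ?stopped_sum_ge0.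
- apply: emeasurable_funM => //; apply/measurable_EFinP.
  exact: measurable_stopped_sum.
Qed.

(** The cubes in a tail of the list have averages at least that of its head, so the weak-type bound
    holds on the union of the tail at this level; these bounds are weighted by the increments and
    added. *)
Lemma stopped_sum_weak_type (th a : R) s : 0 < th < 1 -> 0 <= a ->
  increasing_from a s ->
  (((1 - th)%:E * \int[mu]_x ((stopped_sum th^-1 a s x)%:E * (sg x)%:E)) <=
   N%:E * \int[mu]_x ((stopped_sum (th^-1 - 1) a s x)%:E * psi x))%E.
Proof.
move=> /andP[th0 th1]; elim: s a => [|k s ih] a a0 hs.
  rewrite /=; under eq_integral do rewrite mul0e.
  by under [X in (_ <= _ * X)%E]eq_integral do rewrite mul0e; rewrite !integral0 !mule0.
have [ak hs'] := hs; have k0 := le_trans a0 ak.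
have t0 : 0 <= th^-1 by rewrite invr_ge0 ltW.
have t1 : 0 <= th^-1 - 1 by rewrite subr_ge0 ltW// invf_gt1.
rewrite !integral_stopped_sum_cons//; [|exact: msgE|by move=> x; rewrite lee_fin ltW].
have F0 t' : 0 <= t' -> (0 <= \int[mu]_x ((stopped_sum t' (c k) s x)%:E * psi x))%E.
  move=> t'0; apply: integral_ge0 => x _.
  by rewrite mule_ge0// lee_fin stopped_sum_ge0.
have F1 : (0 <= \int[mu]_x ((stopped_sum th^-1 (c k) s x)%:E * (sg x)%:E))%E.
  apply: integral_ge0 => x _.
  by rewrite mule_ge0// lee_fin ?stopped_sum_ge0// ltW.
have I0 (f : X -> \bar R) A : (forall x, 0 <= f x)%E -> (0 <= \int[mu]_(x in A) f x)%E.
  by move=> f0; apply: integral_ge0.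
have d0 t' : 0 <= t' -> 0 <= c k `^ t' - a `^ t'.
  by move=> t'0; rewrite subr_ge0 ge0_ler_powR ?nnegrE.
rewrite [X in (X <= _)%E]ge0_muleDr; last 2 first.
- by rewrite mule_ge0 ?I0// ?lee_fin ?d0// => x; rewrite lee_fin ltW.
- by [].
rewrite [X in (_ <= X)%E]ge0_muleDr; last 2 first.
- by rewrite mule_ge0 ?I0// lee_fin d0.
- exact: F0.
apply: leeD; last exact: ih.
rewrite muleA -EFinM.
apply: (@le_trans _ _ ((c k `^ (th^-1 - 1) - a `^ (th^-1 - 1))%:E * ((c k)%:E *
   \int[mu]_(x in list_union (k :: s)) (sg x)%:E))%E).
  rewrite muleA -EFinM lee_wpmul2r ?I0//; first by move=> x; rewrite lee_fin ltW.
  by rewrite lee_fin [leRHS]mulrC powR_increment_le// th0.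
rewrite [leRHS]muleCA lee_wpmul2l ?lee_fin ?d0//.
apply: weak_type_list => // j; rewrite inE => /predU1P[->//|js].
exact: increasing_from_ge hs' js.
Qed.

(** This finiteness permits the absorption of half of the left-hand side in [maximal_op_bound]. *)
Lemma integral_stopped_sum_lty t a s : 0 <= t -> 0 <= a -> increasing_from a s ->
  (\int[mu]_x ((stopped_sum t a s x)%:E * (sg x)%:E) < +oo)%E.
Proof.
move=> t0; elim: s a => [|k s ih] a a0 hs.
  by rewrite /=; under eq_integral do rewrite mul0e; rewrite integral0.
have [ak hs'] := hs; have k0 := le_trans a0 ak.
rewrite integral_stopped_sum_cons//; [|exact: msgE|by move=> x; rewrite lee_fin ltW].
rewrite lte_add_pinfty ?ih//.
have := integral_list_union_lty (k :: s).
have : (0 <= \int[mu]_(x in list_union (k :: s)) (sg x)%:E)%E.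
  by apply: integral_ge0 => x _; rewrite lee_fin ltW.
by move=> /ge0_fin_numE <- /fineK <-; rewrite -EFinM ltry.
Qed.

End StoppedAverages.

(* The exponents are those for which the powers of [e] cancel in Young's inequality. *)
Lemma young_stopped (th e m y : R) (g : \bar R) : 0 < th < 1 -> 0 < e ->
  0 <= m -> 0 <= y -> (0 <= g)%E ->
  ((m `^ (th^-1 - 1))%:E * (g `^ th * (y `^ (1 - th))%:E) <=
   e%:E * (m `^ th^-1 * y)%:E + (e `^ (- ((1 - th) / th)))%:E * g)%E.
Proof.
move=> /andP[th0 th1] e0 m0 y0; have C0 := powR_gt0 (- ((1 - th) / th)) e0.
case: g => [g|_|//]; last first.
  by rewrite gt0_muley ?lte_fin// addeC addye ?leey// -EFinM.
rewrite lee_fin => g0; rewrite poweR_EFin -!EFinM -EFinD lee_fin [leRHS]addrC.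
set C := e `^ _ in C0 *.
apply: le_trans (@powR_mul_le_add _ th _ _ _ _ _); last 3 first.
- by rewrite !ltW.
- by rewrite mulr_ge0// ltW.
- by rewrite !mulr_ge0 ?powR_ge0// ltW.
rewrite powRM ?(ltW C0)// !powRM ?mulr_ge0 ?powR_ge0 ?(ltW e0)//.
rewrite /C -!powRrM mulNr divfK ?gt_eqF// opprB.
rewrite mulrBr mulr1 mulVf ?gt_eqF//.
have ee : e `^ (th - 1) * e `^ (1 - th) = 1.
  rewrite -powRD ?(gt_eqF e0) ?implybT//.
  by rewrite (_ : th - 1 + (1 - th) = 0) ?powRr0//; ring.
rewrite le_eqVlt; apply/orP; left; apply/eqP.
transitivity (e `^ (th - 1) * e `^ (1 - th) * (m `^ (th^-1 - 1) * (g `^ th * y `^ (1 - th)))).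
  by rewrite ee mul1r.
ring.
Qed.

(* The mean of exponent [th] of [G / sg] with respect to [sg dmu], multiplied back by [sg]. *)
Definition maximal_op (th : R) (sg : X -> R) (S : nat -> R) (G : X -> \bar R)
    (x : X) : \bar R :=
  ereal_sup (range (fun k =>
    (((S k)^-1%:E * \int[mu]_(y in Q k) (G y `^ th * (sg y `^ (1 - th))%:E)) `^ th^-1
     * (\1_(Q k) x * sg x)%:E)%E)).

(** The constant of [young_stopped] at [e = (1 - th) / (2 * N)], for which [N * e] is half of
    [1 - th], times the factor left over by the absorption. *)
Definition maximal_const (N th : R) : R :=
  2 * N / (1 - th) * ((1 - th) / (2 * N)) `^ (- ((1 - th) / th)).

Lemma maximal_const_gt0 N th : 0 < N -> 0 < th < 1 -> 0 < maximal_const N th.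
Proof.
move=> N0 /andP[th0 th1].
by rewrite mulr_gt0 ?powR_gt0// divr_gt0 ?mulr_gt0 ?subr_gt0.
Qed.

Lemma measurable_poweR_EFin (A : set X) (G : X -> \bar R) (sg : X -> R) (th : R) :
  measurable_fun A G -> measurable_fun A sg ->
  measurable_fun A (fun y => (G y `^ th * (sg y `^ (1 - th))%:E)%E).
Proof.
move=> mG msg; apply: emeasurable_funM.
  by apply: (@measurableT_comp _ _ _ _ _ _ (fun y => y `^ th)%E) => //; exact: measurable_poweR.
apply/measurable_EFinP.
by apply: (@measurableT_comp _ _ _ _ _ _ (fun y => y `^ (1 - th))).
Qed.

Lemma measurable_maximal_op th (sg : X -> R) S (G : X -> \bar R) : measurable_fun setT sg ->
  measurable_fun setT G -> (forall x, 0 < sg x) ->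
  measurable_fun setT (maximal_op th sg S G).
Proof.
move=> msg mG sg0; apply: measurable_ereal_sup => [k|k x].
  apply: measurable_funeM; apply/measurable_EFinP; exact: measurable_funM.
by rewrite mule_ge0 ?poweR_ge0// lee_fin mulr_ge0// ltW.
Qed.

(** This is the bound on [L^(1/th)(sg dmu)] for the maximal function of averages against [sg],
    applied to [(G / sg)^th]. The weak-type sum bounds the maximal function by its own pairing with
    [psi]; Young's inequality splits the pairing into an absorbable multiple of the left-hand side
    and an integral of [G]. *)
Theorem maximal_op_bound (N th : R) (sg : X -> R) (S : nat -> R) (G : X -> \bar R) :
  0 < N -> covering_bound N -> 0 < th < 1 ->
  measurable_fun setT sg -> (forall x, 0 < sg x) ->
  (forall k, 0 < S k) -> (forall k, \int[mu]_(x in Q k) (sg x)%:E = (S k)%:E)%E ->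
  measurable_fun setT G -> (forall x, 0 <= G x)%E ->
  (\int[mu]_x maximal_op th sg S G x <= (maximal_const N th)%:E * \int[mu]_x G x)%E.
Proof.
move=> N0 cov th01 msg sg0 S0 Sint mG G0; have /andP[th0 th1] := th01.
have C0 := maximal_const_gt0 N0 th01.
have [Goo|Gfin] := eqVneq (\int[mu]_x G x)%E +oo%E.
  by rewrite Goo gt0_muley ?lte_fin// leey.
have Glt : (\int[mu]_x G x < +oo)%E by rewrite ltey.
pose psi y := (G y `^ th * (sg y `^ (1 - th))%:E)%E.
have mpsi : measurable_fun setT psi by exact: measurable_poweR_EFin.
have psi0 y : (0 <= psi y)%E by rewrite mule_ge0 ?poweR_ge0// lee_fin powR_ge0.
have psi_le y : (psi y <= G y + (sg y)%:E)%E.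
  rewrite /psi; case: (G y) (G0 y) => [g|_|//]; last by rewrite addye// leey.
  rewrite lee_fin => g0; rewrite poweR_EFin -EFinM -EFinD lee_fin.
  by apply: powR_mul_le_add; rewrite ?(ltW th0) ?(ltW th1) ?(ltW (sg0 _)).
have mE A : measurable A -> measurable_fun A (EFin \o sg).
  by move=> mA; apply/measurable_EFinP; exact: measurable_funTS.
have psi_lty k : (\int[mu]_(x in Q k) psi x < +oo)%E.
  apply: (@le_lt_trans _ _ (\int[mu]_(x in Q k) (G x + (sg x)%:E))%E).
    apply: ge0_le_integral => //; first exact: measurable_funTS.
    by apply: emeasurable_funD; [exact: measurable_funTS|exact: mE].
  rewrite ge0_integralD//; last 3 first.
  - exact: measurable_funTS.
  - by move=> x _; rewrite lee_fin ltW.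
  - exact: mE.
  rewrite Sint lte_add_pinfty ?ltry//; apply: le_lt_trans Glt.
  by apply: ge0_subset_integral => //; exact: mQ.
pose c k := fine (\int[mu]_(x in Q k) psi x)%E / S k.
have I0 k : (0 <= \int[mu]_(x in Q k) psi x)%E by apply: integral_ge0.
have c0 k : 0 <= c k by rewrite divr_ge0 ?fine_ge0// ltW.
have cint k : (\int[mu]_(x in Q k) psi x = (c k * S k)%:E)%E.
  by rewrite divfK ?gt_eqF// fineK// ge0_fin_numE.
have list_bound s : increasing_from c 0 s ->
    (\int[mu]_x ((stopped c 0 s x `^ th^-1)%:E * (sg x)%:E) <=
      (maximal_const N th)%:E * \int[mu]_x G x)%E.
  move=> hs; have t0 : 0 <= th^-1 by rewrite invr_ge0 ltW.
  have t1 : 0 < th^-1 - 1 by rewrite subr_gt0 invf_gt1.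
  have st0 x : 0 <= stopped c 0 s x by exact: stopped_ge.
  have e1 x : stopped_sum c th^-1 0 s x = stopped c 0 s x `^ th^-1.
    by rewrite -stopped_sumE powR0 ?add0r// invr_neq0// gt_eqF.
  have e2 x : stopped_sum c (th^-1 - 1) 0 s x = stopped c 0 s x `^ (th^-1 - 1).
    by rewrite -stopped_sumE powR0 ?add0r// gt_eqF.
  have := stopped_sum_weak_type msg sg0 Sint mpsi psi0 cint cov th01 (lexx 0) hs.
  have := integral_stopped_sum_lty msg sg0 Sint t0 (lexx 0) hs.
  under eq_integral do rewrite e1.
  set a := integral _ _ _ => aoo h.
  have a0 : (0 <= a)%E.
    by apply: integral_ge0 => x _; rewrite -EFinM lee_fin mulr_ge0 ?powR_ge0// ltW.
  pose e := (1 - th) / (2 * N).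
  have e0 : 0 < e by rewrite divr_gt0 ?subr_gt0 ?mulr_gt0.
  have mst : measurable_fun setT (fun x => stopped c 0 s x `^ th^-1).
    by under eq_fun do rewrite -e1; exact: measurable_stopped_sum.
  have mst' : measurable_fun setT (fun x => stopped c 0 s x `^ (th^-1 - 1)).
    by under eq_fun do rewrite -e2; exact: measurable_stopped_sum.
  have h2 : (\int[mu]_x ((stopped_sum c (th^-1 - 1) 0 s x)%:E * psi x) <=
      e%:E * a + (e `^ (- ((1 - th) / th)))%:E * \int[mu]_x G x)%E.
    have ma : measurable_fun setT (fun x => (stopped c 0 s x `^ th^-1)%:E * (sg x)%:E)%E.
      by apply: emeasurable_funM; [exact/measurable_EFinP|exact: mE].
    have -> : (e%:E * a = \int[mu]_x (e%:E * ((stopped c 0 s x `^ th^-1)%:E * (sg x)%:E)))%E.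
      rewrite ge0_integralZl_EFin ?(ltW e0)// => x _.
      by rewrite -EFinM lee_fin mulr_ge0 ?powR_ge0// ltW.
    rewrite -ge0_integralZl_EFin ?powR_ge0//.
    rewrite -ge0_integralD//; last 4 first.
    - move=> x _; rewrite mule_ge0 ?lee_fin ?(ltW e0)//.
      by rewrite mulr_ge0 ?powR_ge0// ltW.
    - exact: measurable_funeM.
    - by move=> x _; rewrite mule_ge0// lee_fin powR_ge0.
    - exact: measurable_funeM.
    under eq_integral do rewrite e2.
    apply: ge0_le_integral => //.
    - by move=> x _; rewrite mule_ge0// lee_fin powR_ge0.
    - by apply: emeasurable_funM => //; exact/measurable_EFinP.
    - by apply: emeasurable_funD; exact: measurable_funeM.
    - by move=> x _; apply: young_stopped => //; rewrite ltW.
  have {h h2} := le_trans h (lee_wpmul2l (ltW (N0 : (0 < N%:E)%E)) h2).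
  rewrite -(fineK (_ : a \is a fin_num)); last by rewrite ge0_fin_numE.
  have Gfn : (\int[mu]_x G x)%E \is a fin_num by rewrite ge0_fin_numE ?integral_ge0.
  rewrite -(fineK Gfn) /maximal_const -/e.
  move: (fine a) (fine (integral _ _ _)) => u w.
  set C := e `^ _; rewrite -(EFinM e) -(EFinM C) -EFinD -!EFinM !lee_fin.
  have ne : N * e = (1 - th) / 2 by rewrite /e; field; rewrite gt_eqF.
  rewrite mulrDr mulrA ne => h.
  have {}h : (1 - th) * u <= 2 * (N * (C * w)) by lra.
  rewrite -(ler_pM2l (_ : 0 < 1 - th)) ?subr_gt0//.
  apply: le_trans h _; rewrite le_eqVlt; apply/orP; left; apply/eqP.
  by field; rewrite subr_eq0 gt_eqF.
apply: integral_ereal_sup_le => [k|k x|n].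
- apply: measurable_funeM; apply/measurable_EFinP; exact: measurable_funM.
- by rewrite mule_ge0 ?poweR_ge0// lee_fin mulr_ge0// ltW.
pose s := sort (fun i j => c i <= c j) (iota 0 n).
have hs : increasing_from c 0 s by exact: increasing_from_sort.
have st0 x : 0 <= stopped c 0 s x by exact: stopped_ge.
have mst : measurable_fun setT (fun x => stopped c 0 s x `^ th^-1).
  rewrite (_ : (fun x => _) = stopped_sum c th^-1 0 s); first exact: measurable_stopped_sum.
  by apply/funext => x; rewrite -stopped_sumE powR0 ?add0r// invr_neq0// gt_eqF.
apply: le_trans (list_bound s hs); apply: ge0_le_integral => //.
- by move=> x _; exact: partial_max_ge0.
- apply: measurable_partial_max => k.
  apply: measurable_funeM; apply/measurable_EFinP; exact: measurable_funM.
- by apply: emeasurable_funM; [exact/measurable_EFinP|exact: mE].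
have sub : {subset iota 0 n <= s} by move=> k; rewrite mem_sort.
(* The list stays the one for the full [n]; only the prefix compared with it shrinks in the
   induction. *)
move=> x _; clearbody s; clear mst; elim: n sub => [|n ih] sub /=.
  by rewrite -EFinM lee_fin mulr_ge0 ?powR_ge0// ltW.
rewrite ge_max ih//=; last first.
  by move=> k; rewrite mem_iota add0n => /andP[_ kn]; apply: sub; rewrite mem_iota/= add0n ltnS (ltnW kn).
have ns : n \in s by apply: sub; rewrite mem_iota/=.
have -> : ((S n)^-1%:E * \int[mu]_(y in Q n) (G y `^ th * (sg y `^ (1 - th))%:E) = (c n)%:E)%E.
  by rewrite (cint n) -EFinM mulrCA mulVf ?gt_eqF// mulr1.
rewrite poweR_EFin -!EFinM lee_fin.
rewrite indicE; case: (pselect (Q n x)) => Qx; last first.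
  by rewrite memNset// mul0r mulr0 mulr_ge0 ?powR_ge0// ltW.
rewrite mem_set// mul1r ler_wpM2r ?(ltW (sg0 _))//.
by rewrite ge0_ler_powR ?nnegrE ?invr_ge0 ?(ltW th0)//; exact: stopped_ge_mem.
Qed.

End MaximalInequality.

(** * The covering property of finitely many nested families *)

Section Covering.
Context {disp : measure_display} {R : realType} {X : measurableType disp}.
Variable mu : {measure set X -> \bar R}.
Variables (Q : nat -> set X) (mQ : forall k, measurable (Q k)).

Lemma list_unionP s x : list_union Q s x <-> exists2 k, k \in s & Q k x.
Proof.
elim: s => [|k s ih]; first by rewrite /list_union big_nil; split=> // -[].
rewrite list_union_cons; split.
  move=> [Qx|/ih[j js Qx]]; first by exists k => //; rewrite mem_head.
  by exists j => //; rewrite inE js orbT.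
move=> [j]; rewrite inE => /predU1P[->|js] Qx; first by left.
by right; apply/ih; exists j.
Qed.

(** A cube contained in another listed one can be discarded. Otherwise the cubes that meet it lie
    inside it; once they are discarded too, it is disjoint from the remaining union and the
    integrals add up. *)
Lemma nested_covering (s : seq nat) (f g : X -> \bar R) :
  (forall i j, i \in s -> j \in s ->
    [\/ Q i `&` Q j = set0, Q i `<=` Q j | Q j `<=` Q i]) ->
  measurable_fun setT f -> measurable_fun setT g ->
  (forall x, 0 <= f x)%E -> (forall x, 0 <= g x)%E ->
  (forall k, k \in s -> \int[mu]_(x in Q k) f x <= \int[mu]_(x in Q k) g x)%E ->
  (\int[mu]_(x in list_union Q s) f x <= \int[mu]_(x in list_union Q s) g x)%E.
Proof.
move=> nest mf mg f0 g0; have [n] := ubnP (size s).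
elim: n s nest => // n ih [|k s] nest sn fg.
  by rewrite /list_union big_nil !integral_set0.
have [[j js kj]|nsub] := pselect (exists2 j, j \in s & Q k `<=` Q j).
  have -> : list_union Q (k :: s) = list_union Q s.
    rewrite list_union_cons; apply/seteqP; split=> x; last by right.
    by move=> [/kj Qx|//]; apply/list_unionP; exists j.
  apply: ih => //.
    by move=> i l il ll; apply: nest; rewrite inE ?il ?ll orbT.
  by move=> i il; apply: fg; rewrite inE il orbT.
pose s' := [seq j <- s | `[< Q k `&` Q j = set0 >]].
have s's j : j \in s' -> j \in s by rewrite mem_filter => /andP[].
have Ue : list_union Q (k :: s) = Q k `|` list_union Q s'.
  rewrite list_union_cons; apply/seteqP; split=> x.
    move=> [Qx|/list_unionP[j js Qx]]; first by left.
    have jks : j \in k :: s by rewrite inE js orbT.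
    have [kj0|kj|jk] := nest k j (mem_head k s) jks.
    - by right; apply/list_unionP; exists j => //; rewrite mem_filter js andbT; exact/asboolP.
    - by case: nsub; exists j.
    - by left; exact: jk.
  move=> [Qx|/list_unionP[j js Qx]]; first by left.
  by right; apply/list_unionP; exists j => //; exact: s's.
have dis : [disjoint Q k & list_union Q s'].
  rewrite disj_set2E; apply/eqP/seteqP; split=> x // [Qkx /list_unionP[j]].
  by rewrite mem_filter => /andP[/asboolP <- _] Qjx.
have mU := measurable_list_union mQ s'.
have mUf h : measurable_fun setT h -> measurable_fun (Q k `|` list_union Q s') (h : X -> \bar R).
  by move=> mh; exact: measurable_funTS.
rewrite Ue !ge0_integral_setU//; [|exact: mUf..].
apply: leeD; first by apply: fg; rewrite mem_head.
apply: ih.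
- by move=> i l /s's il /s's ll; apply: nest; rewrite inE ?il ?ll orbT.
- by move: sn; rewrite /= ltnS; apply: leq_ltn_trans; rewrite size_filter count_size.
- by move=> i /s's il; apply: fg; rewrite inE il orbT.
Qed.

(** The unions belonging to different lattices may overlap; each is estimated by the whole union,
    which costs the factor [N]. *)
Lemma nested_families_covering (N : nat) (lat : nat -> 'I_N) :
  (forall i j, lat i = lat j ->
    [\/ Q i `&` Q j = set0, Q i `<=` Q j | Q j `<=` Q i]) ->
  covering_bound mu Q N%:R.
Proof.
move=> nest s f g mf mg f0 g0 fg.
pose A i := list_union Q [seq k <- s | lat k == i].
have mA i : measurable (A i) by exact: measurable_list_union.
have AU i : A i `<=` list_union Q s.
  move=> x /list_unionP[k]; rewrite mem_filter => /andP[_ ks] Qx.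
  by apply/list_unionP; exists k.
have fgA i : (\int[mu]_(x in A i) f x <= \int[mu]_(x in list_union Q s) g x)%E.
  apply: (@le_trans _ _ (\int[mu]_(x in A i) g x)%E).
    apply: nested_covering => //.
      move=> k l; rewrite !mem_filter => /andP[/eqP ki _] /andP[/eqP li _].
      by apply: nest; rewrite ki li.
    by move=> k; rewrite mem_filter => /andP[_]; exact: fg.
  apply: ge0_subset_integral => //; first exact: measurable_list_union.
  exact: measurable_funTS.
have fA (l : seq 'I_N) :
    (\int[mu]_(x in \big[setU/set0]_(i <- l) A i) f x <=
     (size l)%:R%:E * \int[mu]_(x in list_union Q s) g x)%E.
  elim: l => [|i l ih]; first by rewrite big_nil integral_set0 mul0e.
  rewrite big_cons; apply: le_trans (integral_setU_le mu _ _ _ _) _ => //.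
    exact: bigsetU_measurable.
  rewrite /= -natr1 EFinD ge0_muleDl ?lee_fin// mul1e addeC.
  exact: leeD.
apply: le_trans (_ : (_ <= \int[mu]_(x in \big[setU/set0]_(i <- enum 'I_N) A i) f x)%E) _.
  apply: ge0_subset_integral => //.
  - exact: measurable_list_union.
  - exact: bigsetU_measurable.
  - exact: measurable_funTS.
  move=> x /list_unionP[k ks Qx]; rewrite (big_rem (lat k)) ?mem_enum//=; left.
  by apply/list_unionP; exists k => //; rewrite mem_filter eqxx.
by apply: le_trans (fA _) _; rewrite size_enum_ord.
Qed.

End Covering.

(** * A reverse Hölder inequality for pairs of dual weights *)

Section MixedAverages.
Context {disp : measure_display} {R : realType} {X : measurableType disp}.
Variable mu : {measure set X -> \bar R}.

Lemma integral_gt0 (A : set X) (f : X -> R) : measurable A -> (0 < mu A)%E ->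
  measurable_fun A f -> (forall x, A x -> 0 < f x) ->
  (0 < \int[mu]_(x in A) (f x)%:E)%E.
Proof.
move=> mA A0 mf f0.
rewrite lt0e integral_ge0 ?andbT; last by move=> x Ax; rewrite lee_fin ltW ?f0.
apply/eqP => i0.
have mfE : measurable_fun A (EFin \o f) by exact/measurable_EFinP.
have : (\int[mu]_(x in A) `|(f x)%:E| = 0)%E.
  rewrite -[RHS]i0; apply: eq_integral => x; rewrite inE => Ax.
  by rewrite gee0_abs// lee_fin ltW ?f0.
move=> /(ae_eq_integral_abs mu mA mfE)[Z [mZ Z0 AZ]].
suff : (mu A <= 0)%E by rewrite leNgt A0.
rewrite -Z0; apply: le_measure; rewrite ?inE// => x Ax; apply: AZ => /= h.
by have [/eqP] := h Ax; rewrite gt_eqF ?f0.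
Qed.

Lemma powR_mul2 (x y k l w : R) :
  (x `^ k * y `^ l) `^ w = x `^ (k * w) * y `^ (l * w).
Proof. by rewrite (powRM _ (powR_ge0 _ _) (powR_ge0 _ _)) -(powRrM x) -(powRrM y). Qed.

(** Let [B] be the sum of the [alpha]. The constant 1 is the product of the [sg o^(alpha o / B)];
    Hölder's inequality, with the factors [i] and [j] merged into the function integrated to [V],
    bounds [m^B] by [V^(alpha i + alpha j)] times the other [S o^(alpha o)]. The latter cancel
    against the weight condition [SK]. *)
Lemma mixed_average_ge (I : finType) (alpha : I -> R) (sg : I -> X -> R)
    (A : set X) (m K : R) (S : I -> R) (i j : I) (V : R) :
  measurable A -> mu A = m%:E -> 0 < m -> 1 <= K ->
  (forall o, 0 < alpha o) ->
  (forall o, measurable_fun setT (sg o)) -> (forall o x, 0 < sg o x) ->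
  (forall x, \prod_o sg o x `^ alpha o = 1) ->
  (forall o, \int[mu]_(x in A) (sg o x)%:E = (S o)%:E)%E ->
  \prod_o (S o / m) `^ alpha o <= K ->
  let k := alpha i / (alpha i + alpha j) in
  (\int[mu]_(x in A) (sg i x `^ k * sg j x `^ (1 - k))%:E = V%:E)%E ->
  S i `^ k * S j `^ (1 - k) <= K `^ (alpha i + alpha j)^-1 * V.
Proof.
move=> mA Am m0 K1 a0 msg sg0 sg1 AS SK k AV.
have S0 o : 0 < S o.
  rewrite -lte_fin -AS; apply: integral_gt0 => //; first by rewrite Am.
  exact: measurable_funTS.
have aij : 0 < alpha i + alpha j by rewrite addr_gt0.
have mV o t : measurable_fun setT (fun x => sg o x `^ t).
  by apply: (@measurableT_comp _ _ _ _ _ _ (fun x => x `^ t)).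
have V0 : 0 < V.
  rewrite -lte_fin -AV; apply: integral_gt0 => //; first by rewrite Am.
    by apply: measurable_funTS; exact: measurable_funM.
  by move=> x _; rewrite mulr_gt0 ?powR_gt0.
(* For [i = j] there are no two factors to merge, and the mixed function is [sg i] itself. *)
have [ij|ij] := eqVneq i j.
  have -> : V = S i.
    apply: EFin_inj; rewrite -AV -AS; apply: eq_integral => x _.
    by rewrite -ij -powRD ?(gt_eqF (sg0 _ _)) ?implybT// addrC subrK powRr1// ltW.
  rewrite -ij -powRD ?(gt_eqF (S0 _)) ?implybT// addrC subrK powRr1 ?(ltW (S0 _))//.
  rewrite ler_peMl ?(ltW (S0 _))//.
  by rewrite -[leLHS](powRr0 K) ler_powR// invr_ge0 ltW// addr_gt0.
pose B := \sum_o alpha o.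
have BE : B = \sum_o alpha o by [].
clearbody B.
have kE : k = alpha i / (alpha i + alpha j) by [].
clearbody k.
have B0 : 0 < B.
  by rewrite BE (bigD1 i)//= ltr_pwDl// sumr_ge0// => o _; rewrite ltW.
(* Index [i] carries the merged function and [j] gets the exponent 0, so that the index type stays
   the same. *)
pose a o := if o == i then (alpha i + alpha j) / B else
            if o == j then 0 else alpha o / B.
pose f o x := if o == i then sg i x `^ k * sg j x `^ (1 - k) else sg o x.
pose c o := if o == i then V else S o.
have ji : j != i by rewrite eq_sym.
have prodE (F : I -> R) : \prod_o F o = F i * F j * \prod_(o | (o != i) && (o != j)) F o.
  by rewrite (bigD1 i)//= (bigD1 j)//= mulrA.
have a1 : \sum_o a o = 1.
  rewrite (bigD1 i)//= (bigD1 j)//= /a eqxx (negbTE ji) eqxx add0r.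
  rewrite (eq_bigr (fun o => alpha o / B)); last by move=> o /andP[/negbTE -> /negbTE ->].
  rewrite -mulr_suml -mulrDl.
  have -> : alpha i + alpha j + \sum_(o | (o != i) && (o != j)) alpha o = B.
    by rewrite BE [RHS](bigD1 i)//= [X in _ = _ + X](bigD1 j)//= addrA.
  by rewrite divff// gt_eqF.
have ek1 : k * ((alpha i + alpha j) / B) = alpha i / B.
  by rewrite kE; field; rewrite !gt_eqF.
have ek2 : (1 - k) * ((alpha i + alpha j) / B) = alpha j / B.
  by rewrite kE; field; rewrite !gt_eqF.
have := @integral_prod_powR_le _ _ _ mu _ A a f c mA _ a1 _ _ _ _.
have fprod x : \prod_o f o x `^ a o = 1.
  rewrite prodE /f /a eqxx (negbTE ji) eqxx powRr0 mulr1.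
  rewrite (eq_bigr (fun o => (sg o x `^ alpha o) `^ B^-1)); last first.
    by move=> o /andP[/negbTE -> /negbTE ->]; rewrite powRrM.
  have -> : (sg i x `^ k * sg j x `^ (1 - k)) `^ ((alpha i + alpha j) / B) =
     (sg i x `^ alpha i) `^ B^-1 * (sg j x `^ alpha j) `^ B^-1.
    by rewrite powR_mul2 ek1 ek2 (powRrM _ (alpha i)) (powRrM _ (alpha j)).
  rewrite -(prodE (fun o => (sg o x `^ alpha o) `^ B^-1)) -powR_prod ?sg1 ?powR1//.
  by move=> o; exact: powR_ge0.
under eq_integral do rewrite fprod.
rewrite integral_cst// Am mul1e => h.
have {}h : m <= \prod_o c o `^ a o.
  rewrite -lee_fin; apply: h.
  - by move=> o; rewrite /a; case: ifP => _; [|case: ifP => _//]; rewrite divr_ge0 ?addr_ge0// ltW.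
  - by move=> o x; rewrite /f; case: ifP => _; rewrite ?mulr_ge0 ?powR_ge0// ltW.
  - by move=> o; rewrite /f; case: (o == i) => //; exact: measurable_funM.
  - by move=> o; rewrite /c; case: ifP.
  - by move=> o; rewrite /c /f; case: ifP => _; rewrite ?AV ?AS.
have hB : m `^ B <= V `^ (alpha i + alpha j) *
    \prod_(o | (o != i) && (o != j)) S o `^ alpha o.
  have := ge0_ler_powR (ltW B0) _ _ h; rewrite !nnegrE (ltW m0).
  rewrite prodr_ge0 => [/(_ isT isT)|o _]; last exact: powR_ge0.
  move=> /le_trans; apply; rewrite prodE /c /a eqxx (negbTE ji) eqxx powRr0 mulr1.
  rewrite powRM ?powR_ge0 ?prodr_ge0//; last by move=> o _; exact: powR_ge0.
  rewrite -(powRrM V) divfK ?gt_eqF// powR_prod; last by move=> o; exact: powR_ge0.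
  rewrite ler_wpM2l ?powR_ge0// ler_prod// => o /andP[/negbTE -> /negbTE ->].
  by rewrite powR_ge0/= -(powRrM (S o)) divfK ?gt_eqF.
have SK' : S i `^ alpha i * S j `^ alpha j *
    \prod_(o | (o != i) && (o != j)) S o `^ alpha o <= K * m `^ B.
  rewrite -(prodE (fun o => S o `^ alpha o)).
  rewrite -ler_pdivrMr ?powR_gt0//; apply: le_trans SK.
  rewrite BE powR_sum// -prodf_div; apply: ler_prod => o _.
  rewrite mulr_ge0 ?powR_ge0 ?invr_ge0 ?powR_ge0//=.
  by rewrite powRM ?invr_ge0 ?(ltW m0) ?(ltW (S0 _))// -powRN -powR_inv1 ?(ltW m0)// -(powRrM m) mulN1r.
set T := \prod_(o | (o != i) && (o != j)) S o `^ alpha o in hB SK'.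
have T0 : 0 < T by apply: prodr_gt0 => o _; exact: powR_gt0.
have h2 : S i `^ alpha i * S j `^ alpha j <= K * V `^ (alpha i + alpha j).
  rewrite -(ler_pM2r T0); apply: le_trans SK' _.
  by rewrite -mulrA ler_wpM2l// (le_trans _ K1).
have := ge0_ler_powR (ltW (_ : 0 < (alpha i + alpha j)^-1)) _ _ h2.
rewrite invr_gt0 aij !nnegrE !mulr_ge0 ?powR_ge0 ?(le_trans _ K1)// => /(_ isT isT isT).
rewrite (powRM _ (powR_ge0 _ _) (powR_ge0 _ _)).
rewrite (powRM _ (le_trans ler01 K1) (powR_ge0 _ _)).
rewrite -(powRrM _ (alpha i)) -(powRrM _ (alpha j)) -(powRrM _ (alpha i + alpha j)).
rewrite divff ?gt_eqF// powRr1 ?(ltW V0)// -kE.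
by rewrite (_ : alpha j / (alpha i + alpha j) = 1 - k)// kE; field; rewrite gt_eqF.
Qed.

End MixedAverages.

(** * The Rubio de Francia iteration *)

Section RubioDeFrancia.
Context {disp : measure_display} {R : realType} {X : measurableType disp}.
Variable mu : {measure set X -> \bar R}.
Variables (Q : nat -> set X) (mQ : forall k, measurable (Q k)).
Variables (m : nat -> R) (Qm : forall k, mu (Q k) = (m k)%:E) (m0 : forall k, 0 < m k).
Variables (N : R) (N0 : 0 < N) (cov : covering_bound mu Q N).

Lemma maximal_op_ge (th : R) (sg : X -> R) (S : nat -> R) (G : X -> \bar R) k x :
  Q k x ->
  ((((S k)^-1%:E * \int[mu]_(y in Q k) (G y `^ th * (sg y `^ (1 - th))%:E)) `^ th^-1
     * (sg x)%:E) <= maximal_op mu Q th sg S G x)%E.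
Proof.
move=> Qx; apply: le_ereal_sup_tmp; eexists; first by exists k.
by rewrite /= indicE mem_set// mul1r.
Qed.

Lemma maximal_op_ge0 th sg S G x : (forall x, 0 < sg x) ->
  (0 <= maximal_op mu Q th sg S G x)%E.
Proof.
move=> sg0; apply: le_ereal_sup_tmp; eexists; first by exists 0%N.
by rewrite /= mule_ge0 ?poweR_ge0// lee_fin mulr_ge0// ltW.
Qed.

Lemma le_poweR (t : R) (x y : \bar R) : 0 <= t -> (0 <= x)%E -> (x <= y)%E ->
  (x `^ t <= y `^ t)%E.
Proof.
move=> t0 x0 xy; apply: gt0_ler_poweR => //; rewrite in_itv/= leey ?andbT//.
exact: le_trans xy.
Qed.

Lemma le_maximal_op (th : R) (sg : X -> R) (S : nat -> R) (G G' : X -> \bar R) x :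
  0 < th -> (forall k, 0 < S k) -> (forall x, 0 < sg x) -> measurable_fun setT sg ->
  measurable_fun setT G -> measurable_fun setT G' -> (forall y, 0 <= G y)%E ->
  (forall y, G y <= G' y)%E ->
  (maximal_op mu Q th sg S G x <= maximal_op mu Q th sg S G' x)%E.
Proof.
move=> th0 S0 sg0 msg mG mG' G0 GG'.
apply: ge_ereal_sup => _ [k _ <-]; apply: le_ereal_sup_tmp.
eexists; first by exists k.
rewrite lee_wpmul2r ?lee_fin ?mulr_ge0 ?(ltW (sg0 _))//.
have I0 : (0 <= \int[mu]_(y in Q k) (G y `^ th * (sg y `^ (1 - th))%:E))%E.
  by apply: integral_ge0 => y _; rewrite mule_ge0 ?poweR_ge0// lee_fin powR_ge0.
apply: le_poweR; first by rewrite invr_ge0 ltW.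
  by rewrite mule_ge0// lee_fin invr_ge0 ltW.
rewrite lee_wpmul2l ?lee_fin ?invr_ge0 ?(ltW (S0 _))//.
apply: ge0_le_integral => //.
- by move=> y _; rewrite mule_ge0 ?poweR_ge0// lee_fin powR_ge0.
- by apply: measurable_poweR_EFin; exact: measurable_funTS.
- by apply: measurable_poweR_EFin; exact: measurable_funTS.
- move=> y _; rewrite lee_wpmul2r ?lee_fin ?powR_ge0//.
  by apply: le_poweR => //; rewrite ltW.
Qed.

Section Pair.
Variables (I : finType) (alpha : I -> R) (K : R).
Hypotheses (a0 : forall o, 0 < alpha o) (K1 : 1 <= K).
Variables (sg : I -> X -> R) (S : I -> nat -> R).
Hypotheses (msg : forall o, measurable_fun setT (sg o)) (sg0 : forall o x, 0 < sg o x).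
Hypothesis sg1 : forall x, \prod_o sg o x `^ alpha o = 1.
Hypothesis Sint : forall o k, (\int[mu]_(x in Q k) (sg o x)%:E = (S o k)%:E)%E.
Hypothesis SK : forall k, \prod_o (S o k / m k) `^ alpha o <= K.

Lemma weight_mass_gt0 o k : 0 < S o k.
Proof.
rewrite -lte_fin -Sint; apply: integral_gt0 => //; first by rewrite Qm lte_fin.
exact: measurable_funTS.
Qed.

Definition pair_exp (i j : I) : R := alpha i / (alpha i + alpha j).

Lemma pair_exp01 i j : 0 < pair_exp i j < 1.
Proof.
by rewrite /pair_exp divr_gt0 ?addr_gt0//= ltr_pdivrMr ?addr_gt0// mul1r ltrDl.
Qed.

Definition pair_const (i j : I) : R :=
  (K `^ (alpha i + alpha j)^-1) `^ (pair_exp i j)^-1.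

(* Composing two maximal operators transfers an average taken against [sg i] into a bound
   against [sg j]: this is where the weight condition enters. *)
Lemma comp_maximal_op_ge (th : R) (G : X -> \bar R) i j k x :
  0 < th -> measurable_fun setT G -> Q k x ->
  ((((S i k)^-1%:E * \int[mu]_(y in Q k) (G y `^ th * (sg i y `^ (1 - th))%:E)) `^ th^-1
     * (S i k * sg j x)%:E) <=
   (pair_const i j * S j k)%:E *
   maximal_op mu Q (pair_exp i j) (sg j) (S j) (maximal_op mu Q th (sg i) (S i) G) x)%E.
Proof.
move=> th0 mG Qx; set T := (_ `^ th^-1)%E; have /andP[p0 p1] := pair_exp01 i j.
have T0 : (0 <= T)%E by exact: poweR_ge0.
set p := pair_exp i j in p0 p1 *.
pose V := fine (\int[mu]_(y in Q k) (sg i y `^ p * sg j y `^ (1 - p))%:E)%E.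
have mV : measurable_fun setT (fun y => sg i y `^ p * sg j y `^ (1 - p)).
  by apply: measurable_funM; apply: measurable_powR_comp.
have mE A (f : X -> R) : measurable_fun setT f -> measurable_fun A (EFin \o f).
  by move=> mf; apply/measurable_EFinP; exact: measurable_funTS.
have V0 y : 0 <= sg i y `^ p * sg j y `^ (1 - p) by rewrite mulr_ge0 ?powR_ge0.
have VE : (\int[mu]_(y in Q k) (sg i y `^ p * sg j y `^ (1 - p))%:E = V%:E)%E.
  rewrite fineK// ge0_fin_numE; last by apply: integral_ge0 => y _; rewrite lee_fin.
  apply: (@le_lt_trans _ _ (\int[mu]_(y in Q k) ((sg i y)%:E + (sg j y)%:E))%E).
    apply: ge0_le_integral => //.
    - by move=> y _; rewrite lee_fin.
    - exact: mE.
    - by apply: emeasurable_funD; exact: mE.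
    - move=> y _; rewrite -EFinD lee_fin powR_mul_le_add ?(ltW (sg0 _ _))//.
      by rewrite !ltW.
  rewrite ge0_integralD//; try exact: mE; try by move=> y _; rewrite lee_fin ltW.
  by rewrite !Sint -EFinD ltry.
have := mixed_average_ge (mQ k) (Qm k) (m0 k) K1 a0 msg sg0 sg1 (Sint^~ k) (SK k) VE.
rewrite -/(pair_exp i j) -/p => hV.
have Sj0 := weight_mass_gt0 j k; have Si0 := weight_mass_gt0 i k.
have V0' : 0 <= V by rewrite fine_ge0// integral_ge0// => y _; rewrite lee_fin.
set K' := K `^ _ in hV; have K'0 : 0 <= K' by exact: powR_ge0.
(* Divided by [S j k] and raised to the power [1 / p], the reverse Hölder inequality compares the
   two masses through the mixed one. *)
have hS : S i k <= pair_const i j * S j k * (V / S j k) `^ p^-1.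
  have : (S i k / S j k) `^ p <= K' * (V / S j k).
    rewrite powRM ?invr_ge0 ?(ltW Si0) ?(ltW Sj0)//.
    rewrite -(ler_pM2r Sj0) -!mulrA mulVf ?gt_eqF// mulr1.
    have -> : (S j k)^-1 `^ p * S j k = S j k `^ (1 - p); last by [].
    rewrite -(powR_inv1 (ltW Sj0)) -(powRrM (S j k)) mulN1r powRN.
    by rewrite powRB ?(gt_eqF Sj0) ?implybT// powRr1 ?(ltW Sj0)// mulrC.
  move=> /(ge0_ler_powR (_ : 0 <= p^-1)); rewrite invr_ge0 (ltW p0) => /(_ isT).
  rewrite !nnegrE powR_ge0 mulr_ge0 ?divr_ge0 ?(ltW Sj0)// => /(_ isT isT).
  rewrite -powRrM divff ?gt_eqF// powRr1 ?divr_ge0 ?(ltW Sj0) ?(ltW Si0)//.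
  rewrite powRM// ?divr_ge0 ?(ltW Sj0)// -/(pair_const i j) ler_pdivrMr// => h.
  by rewrite mulrAC.
set G1 := maximal_op mu Q th (sg i) (S i) G.
have mG1 : measurable_fun setT G1 by exact: measurable_maximal_op.
(* On the cube the inner operator is at least [T * sg i], so the outer average is at least the one
   of this multiple. *)
have h1 : ((T `^ p * V%:E) <=
    \int[mu]_(y in Q k) (G1 y `^ p * (sg j y `^ (1 - p))%:E))%E.
  rewrite -VE -ge0_integralZl//; last 3 first.
  - exact: mE.
  - by move=> y _; rewrite lee_fin.
  - exact: poweR_ge0.
  apply: ge0_le_integral => //.
  - by move=> y _; rewrite mule_ge0 ?poweR_ge0 ?lee_fin.
  - by apply: measurable_funeM; exact: mE.
  - by apply: measurable_poweR_EFin; exact: measurable_funTS.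
  - move=> y Qy; rewrite EFinM muleA lee_wpmul2r ?lee_fin ?powR_ge0//.
    rewrite -poweR_EFin -poweRM// ?lee_fin ?(ltW (sg0 _ _))//.
    apply: le_poweR; rewrite ?(ltW p0) ?mule_ge0 ?lee_fin ?(ltW (sg0 _ _))//.
    exact: maximal_op_ge.
apply: le_trans (_ : _ <= (pair_const i j * S j k)%:E *
   (T * ((V / S j k) `^ p^-1)%:E * (sg j x)%:E))%E _; last first.
  rewrite lee_wpmul2l ?lee_fin ?mulr_ge0 ?powR_ge0 ?(ltW Sj0)//.
  apply: le_trans (maximal_op_ge p (sg j) (S j) G1 Qx).
  rewrite lee_wpmul2r ?lee_fin ?(ltW (sg0 _ _))//.
  have -> : (T * ((V / S j k) `^ p^-1)%:E = ((S j k)^-1%:E * (T `^ p * V%:E)) `^ p^-1)%E.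
    rewrite muleCA -EFinM poweRM ?poweR_ge0 ?lee_fin ?mulr_ge0 ?invr_ge0 ?(ltW Sj0)//.
    by rewrite -poweRrM divff ?gt_eqF// poweRe1// poweR_EFin [_^-1 * _]mulrC.
  apply: le_poweR; rewrite ?invr_ge0 ?(ltW p0) ?mule_ge0 ?lee_fin ?invr_ge0 ?(ltW Sj0) ?poweR_ge0//.
  by rewrite lee_wpmul2l ?lee_fin ?invr_ge0 ?(ltW Sj0).
rewrite -muleA [leRHS]muleCA lee_wpmul2l// -!EFinM lee_fin mulrA ler_wpM2r ?(ltW (sg0 _ _))//.
Qed.

Section Iteration.
Variables (th : I -> R) (th01 : forall o, 0 < th o < 1).

Definition iter_op (G : X -> \bar R) (x : X) : \bar R :=
  (\sum_(ij : I * I) maximal_op mu Q (pair_exp ij.1 ij.2) (sg ij.2) (S ij.2)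
     (maximal_op mu Q (th ij.1) (sg ij.1) (S ij.1) G) x)%E.

(** The summand 1 keeps the constant positive; the factor 2 makes [iter_op] divided by it reduce
    integrals to at most one half. *)
Definition iter_const : R :=
  2 * (1 + \sum_(ij : I * I)
    maximal_const N (pair_exp ij.1 ij.2) * maximal_const N (th ij.1)).

Lemma iter_const_gt0 : 0 < iter_const.
Proof.
rewrite mulr_gt0// ltr_pwDl// sumr_ge0// => ij _.
by rewrite mulr_ge0// ltW// maximal_const_gt0// pair_exp01.
Qed.

Lemma measurable_iter_op G : measurable_fun setT G -> measurable_fun setT (iter_op G).
Proof.
move=> mG; apply: emeasurable_sum => ij; apply: measurable_maximal_op => //.
exact: measurable_maximal_op.
Qed.

Lemma iter_op_ge0 G x : (0 <= iter_op G x)%E.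
Proof. by apply: sume_ge0 => ij _; exact: maximal_op_ge0. Qed.

Lemma le_iter_op G G' x : measurable_fun setT G -> measurable_fun setT G' ->
  (forall y, 0 <= G y)%E -> (forall y, G y <= G' y)%E -> (iter_op G x <= iter_op G' x)%E.
Proof.
move=> mG mG' G0 GG'; apply: lee_sum => -[i j] _ /=.
have /andP[p0 _] := pair_exp01 i j; have /andP[t0 _] := th01 i.
apply: le_maximal_op => //; try exact: weight_mass_gt0; try exact: measurable_maximal_op.
- by move=> y; exact: maximal_op_ge0.
- by move=> y; apply: le_maximal_op => //; exact: weight_mass_gt0.
Qed.

Lemma iter_op_bound G : measurable_fun setT G -> (forall y, 0 <= G y)%E ->
  ((2 / iter_const)%:E * \int[mu]_x iter_op G x <= \int[mu]_x G x)%E.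
Proof.
move=> mG G0; set g := integral _ _ G.
have g0 : (0 <= g)%E by exact: integral_ge0.
have c0 := iter_const_gt0.
rewrite ge0_integral_sum//; last 2 first.
- by move=> ij; apply: measurable_maximal_op => //; exact: measurable_maximal_op.
- by move=> ij x _; exact: maximal_op_ge0.
have h : (\sum_(ij : I * I) \int[mu]_x maximal_op mu Q (pair_exp ij.1 ij.2) (sg ij.2) (S ij.2)
     (maximal_op mu Q (th ij.1) (sg ij.1) (S ij.1) G) x <= (iter_const / 2)%:E * g)%E.
  apply: (@le_trans _ _ (\sum_(ij : I * I) ((maximal_const N (pair_exp ij.1 ij.2) * maximal_const N (th ij.1))%:E * g))%E).
    apply: lee_sum => -[i j] _ /=.
    apply: le_trans (maximal_op_bound mQ N0 cov (pair_exp01 i j) _ _ _ _ _ _) _ => //.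
    - exact: weight_mass_gt0.
    - exact: measurable_maximal_op.
    - by move=> x; exact: maximal_op_ge0.
    rewrite [X in (_ <= X * _)%E]EFinM -[leRHS]muleA.
    apply: lee_wpmul2l; first by rewrite lee_fin ltW// maximal_const_gt0// pair_exp01.
    apply: maximal_op_bound => //; exact: weight_mass_gt0.
  rewrite -ge0_sume_distrl; last first.
    by move=> ij _; rewrite lee_fin mulr_ge0// ltW// maximal_const_gt0// pair_exp01.
  rewrite lee_wpmul2r// sumEFin lee_fin /iter_const.
  by rewrite mulrAC divff ?mul1r// lerDr.
apply: le_trans (lee_wpmul2l _ h) _; first by rewrite lee_fin divr_ge0// ltW.
by rewrite muleA -EFinM mulf_div [2 * _]mulrC divff ?mul1e// mulf_neq0 ?gt_eqF.
Qed.

Variables (h : X -> R) (mh : measurable_fun setT h) (h0 : forall x, 0 < h x).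

(** Increasing approximations to a solution of [H = h + iter_op H / iter_const]. Their integrals
    stay below twice that of [h], since the previous iterate contributes at most half of its own. *)
Fixpoint iterate (n : nat) (x : X) : \bar R :=
  if n is n'.+1 then ((h x)%:E + iter_const^-1%:E * iter_op (iterate n') x)%E else 0%E.

Lemma iterateS n x :
  iterate n.+1 x = ((h x)%:E + iter_const^-1%:E * iter_op (iterate n) x)%E.
Proof. by []. Qed.

Lemma iterate_ge0 n x : (0 <= iterate n x)%E.
Proof.
case: n => [//|n] /=; rewrite adde_ge0 ?lee_fin ?(ltW (h0 _))//.
by rewrite mule_ge0 ?iter_op_ge0// lee_fin invr_ge0 ltW// iter_const_gt0.
Qed.

Lemma measurable_iterate n : measurable_fun setT (iterate n).
Proof.
elim: n => [|n ih] /=; first exact: measurable_cst.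
apply: emeasurable_funD; first exact/measurable_EFinP.
by apply: measurable_funeM; exact: measurable_iter_op.
Qed.

Lemma iterate_nd x : nondecreasing_seq (iterate ^~ x).
Proof.
apply/nondecreasing_seqP => n; elim: n x => [|n ih] x; first exact: iterate_ge0.
rewrite (iterateS n.+1) (iterateS n); apply: leeD2l; apply: lee_wpmul2l.
  by rewrite lee_fin invr_ge0 ltW// iter_const_gt0.
by apply: le_iter_op; [exact: measurable_iterate|exact: (measurable_iterate n.+1)|exact: iterate_ge0|exact: ih].
Qed.

Lemma integral_iterate_le n : (\int[mu]_x iterate n x <= 2%:E * \int[mu]_x (h x)%:E)%E.
Proof.
have ih0 : (0 <= \int[mu]_x (h x)%:E)%E.
  by apply: integral_ge0 => x _; rewrite lee_fin ltW.
elim: n => [|n ih] /=; first by rewrite integral0 mule_ge0.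
have c0 := iter_const_gt0.
have mi := measurable_iter_op (measurable_iterate n).
have i0 := iter_op_ge0 (iterate n).
rewrite ge0_integralD//; last 4 first.
- by move=> x _; rewrite lee_fin ltW.
- exact/measurable_EFinP.
- by move=> x _; rewrite mule_ge0// lee_fin invr_ge0 ltW.
- exact: measurable_funeM.
rewrite ge0_integralZl_EFin ?invr_ge0 ?(ltW c0)//.
have -> : (2%:E * \int[mu]_x (h x)%:E = \int[mu]_x (h x)%:E + \int[mu]_x (h x)%:E)%E.
  by rewrite -[2]/(1 + 1)%R EFinD ge0_muleDl ?lee_fin// !mul1e.
apply: leeD2l; rewrite -(@lee_pmul2l _ 2%:E)//.
rewrite muleA -EFinM; apply: le_trans ih.
by apply: iter_op_bound; [exact: measurable_iterate|exact: iterate_ge0].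
Qed.

Definition majorant (x : X) : \bar R := ereal_sup (range (iterate ^~ x)).

Lemma iterate_le_majorant n x : (iterate n x <= majorant x)%E.
Proof. by apply: ereal_sup_ubound; exists n. Qed.

Lemma le_majorant x : ((h x)%:E <= majorant x)%E.
Proof.
apply: le_trans (iterate_le_majorant 1 x); rewrite iterateS leeDl//.
by rewrite mule_ge0 ?iter_op_ge0// lee_fin invr_ge0 ltW// iter_const_gt0.
Qed.

Lemma majorant_ge0 x : (0 <= majorant x)%E.
Proof. by apply: le_trans (le_majorant x); rewrite lee_fin ltW. Qed.

Lemma measurable_majorant : measurable_fun setT majorant.
Proof. by apply: measurable_ereal_sup => [n|n x]; [exact: measurable_iterate|exact: iterate_ge0]. Qed.

Lemma integral_majorant_le : (\int[mu]_x majorant x <= 2%:E * \int[mu]_x (h x)%:E)%E.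
Proof.
apply: integral_nd_sup_le => [n|n x|x|n].
- exact: measurable_iterate.
- exact: iterate_ge0.
- exact: iterate_nd.
- exact: integral_iterate_le.
Qed.

Lemma iter_op_le_majorant n x : (iter_op (iterate n) x <= iter_const%:E * majorant x)%E.
Proof.
have c0 := iter_const_gt0.
apply: (@le_trans _ _ (iter_const%:E * iterate n.+1 x)%E); last first.
  by apply: lee_wpmul2l; [rewrite lee_fin ltW|exact: iterate_le_majorant].
rewrite iterateS ge0_muleDr ?lee_fin ?(ltW (h0 _))//; last first.
  by rewrite mule_ge0 ?iter_op_ge0// lee_fin invr_ge0 ltW.
rewrite [X in (_ + X)%E]muleA -[X in (_ + X * _)%E]EFinM divff ?gt_eqF// mul1e.
rewrite leeDr// -EFinM lee_fin.
by rewrite mulr_ge0// ltW.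
Qed.

Definition majorant_avg i k : \bar R :=
  (((S i k)^-1%:E * \int[mu]_(y in Q k) (majorant y `^ th i * (sg i y `^ (1 - th i))%:E)) `^ (th i)^-1)%E.

(** The mean is not linear in its argument, so the limit is taken in the integrals of the powers and
    the root is extracted afterwards. *)
Lemma majorant_avg_le i k (B : \bar R) :
  (forall n, (((S i k)^-1%:E * \int[mu]_(y in Q k) (iterate n y `^ th i *
      (sg i y `^ (1 - th i))%:E)) `^ (th i)^-1) <= B)%E -> (majorant_avg i k <= B)%E.
Proof.
move=> TB; have /andP[t0 t1] := th01 i; have S0 := weight_mass_gt0 i k.
have B0 : (0 <= B)%E by apply: le_trans (TB 0%N); exact: poweR_ge0.
pose psi n y := (iterate n y `^ th i * (sg i y `^ (1 - th i))%:E)%E.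
have psi0 n y : (0 <= psi n y)%E by rewrite mule_ge0 ?poweR_ge0// lee_fin powR_ge0.
have mpsi n : measurable_fun setT (psi n).
  by apply: measurable_poweR_EFin => //; exact: measurable_iterate.
have ndpsi y : nondecreasing_seq (psi ^~ y).
  move=> a b ab; rewrite lee_wpmul2r ?lee_fin ?powR_ge0//.
  apply: le_poweR; [exact: ltW|exact: iterate_ge0|exact: iterate_nd].
have psiB n : (\int[mu]_(y in Q k) psi n y <= (S i k)%:E * B `^ th i)%E.
  have := le_poweR (ltW t0) (poweR_ge0 _ _) (TB n).
  rewrite -poweRrM mulVf ?gt_eqF// poweRe1; last first.
    rewrite mule_ge0 ?lee_fin ?invr_ge0 ?(ltW S0)//.
    by apply: integral_ge0 => y _; exact: psi0.
  move=> /(lee_wpmul2l (_ : (0 <= (S i k)%:E)%E)); rewrite lee_fin (ltW S0) => /(_ isT).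
  by rewrite muleA -EFinM divff ?gt_eqF// mul1e.
have supB : (\int[mu]_(y in Q k) ereal_sup (range (psi ^~ y)) <= (S i k)%:E * B `^ th i)%E.
  rewrite (integral_nd_sup _ (mQ k))//.
  by apply: ge_ereal_sup => _ [n _ <-].
have majB : (\int[mu]_(y in Q k) (majorant y `^ th i * (sg i y `^ (1 - th i))%:E)
     <= (S i k)%:E * B `^ th i)%E.
  apply: le_trans supB; apply: ge0_le_integral => //.
  - by move=> y _; rewrite mule_ge0 ?poweR_ge0// lee_fin powR_ge0.
  - by apply: measurable_poweR_EFin; apply: measurable_funTS => //; exact: measurable_majorant.
  - by apply: measurable_funTS; exact: measurable_ereal_sup.
  move=> y _; have sgp : 0 < sg i y `^ (1 - th i) by exact: powR_gt0.
  rewrite -lee_pdivlMr//.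
  set b := (X in (_ <= X)%E).
  have b0 : (0 <= b)%E.
    rewrite /b mule_ge0 ?lee_fin ?invr_ge0 ?(ltW sgp)//.
    by apply: le_ereal_sup_tmp; exists (psi 0%N y) => //; exists 0%N.
  suff : (majorant y <= b `^ (th i)^-1)%E.
    move=> /(le_poweR (ltW t0) (majorant_ge0 y)).
    by rewrite -poweRrM mulVf ?gt_eqF// poweRe1.
  apply: ge_ereal_sup => _ [n _ <-].
  have : (iterate n y `^ th i <= b)%E.
    by rewrite /b lee_pdivlMr//; apply: ereal_sup_ubound; exists n.
  move=> /(le_poweR (_ : 0 <= (th i)^-1) (poweR_ge0 _ _)).
  rewrite invr_ge0 (ltW t0) => /(_ isT).
  by rewrite -poweRrM divff ?gt_eqF// poweRe1// iterate_ge0.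
have -> : B = (((S i k)^-1%:E * ((S i k)%:E * B `^ th i)) `^ (th i)^-1)%E.
  rewrite muleA -EFinM mulVf ?gt_eqF// mul1e -poweRrM divff ?gt_eqF//.
  by rewrite poweRe1.
apply: le_poweR; first by rewrite invr_ge0 ltW.
  rewrite mule_ge0 ?lee_fin ?invr_ge0 ?(ltW S0)// integral_ge0// => y _.
  by rewrite mule_ge0 ?poweR_ge0// lee_fin powR_ge0.
by rewrite lee_wpmul2l ?lee_fin ?invr_ge0 ?(ltW S0).
Qed.

(** The composition for [(i, j)] is one term of [iter_op], and [iter_op] of any iterate is at most
    [iter_const] times the majorant. *)
Lemma majorant_pair i j k x : Q k x ->
  (majorant_avg i k * (S i k * sg j x)%:E <=
   (pair_const i j * S j k * iter_const)%:E * majorant x)%E.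
Proof.
move=> Qx; have /andP[t0 t1] := th01 i.
have Si0 := weight_mass_gt0 i k; have Sj0 := weight_mass_gt0 j k.
have a_gt0 : 0 < S i k * sg j x by rewrite mulr_gt0.
rewrite -lee_pdivlMr//; apply: majorant_avg_le => n; rewrite lee_pdivlMr//.
apply: le_trans (comp_maximal_op_ge i j t0 (measurable_iterate n) Qx) _.
rewrite [X in (_ <= X * _)%E]EFinM -[leRHS]muleA; apply: lee_wpmul2l.
  by rewrite lee_fin mulr_ge0 ?powR_ge0 ?(ltW Sj0).
apply: le_trans (iter_op_le_majorant n x).
rewrite /iter_op (bigD1 (i, j))//= leeDl// sume_ge0// => ij _.
exact: maximal_op_ge0.
Qed.

Definition rdf_const : R :=
  1 + \sum_(ij : I * I) pair_const ij.1 ij.2 * iter_const.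

Lemma rdf_const_ge1 : 1 <= rdf_const.
Proof.
rewrite lerDl sumr_ge0// => ij _; rewrite mulr_ge0 ?powR_ge0//.
by rewrite ltW// iter_const_gt0.
Qed.

(** The number [rho] acts as the mass of [H] on the cube for all the [sg] at once: the mean of
    exponent [th i] of [H / sg i] is at most [rho / S i k], while [H / sg j] is almost everywhere at
    least [rho / (rdf_const * S j k)]. *)
Theorem rdf_density (i0 : I) : (\int[mu]_x (h x)%:E < +oo)%E ->
  exists H : X -> R, [/\ measurable_fun setT H, forall x, h x <= H x,
    (\int[mu]_x (H x)%:E <= 2%:E * \int[mu]_x (h x)%:E)%E &
    forall k, exists2 rho, 0 < rho &
      (forall i, \int[mu]_(x in Q k) (H x `^ th i * sg i x `^ (1 - th i))%:E <=
         (S i k `^ (1 - th i) * rho `^ th i)%:E)%E /\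
      (forall j, {ae mu, forall x, Q k x -> rho * sg j x <= rdf_const * S j k * H x})].
Proof.
move=> hoo.
have majoo : (\int[mu]_x majorant x < +oo)%E.
  apply: le_lt_trans integral_majorant_le _.
  have : (0 <= \int[mu]_x (h x)%:E)%E.
    by apply: integral_ge0 => x _; rewrite lee_fin ltW.
  by move: hoo; case: integral => // r _ _; rewrite -EFinM ltry.
have mmaj := measurable_majorant.
have aemaj : {ae mu, forall x, majorant x \is a fin_num}.
  have : mu.-integrable setT majorant.
    apply/integrableP; split => //.
    by under eq_integral do rewrite gee0_abs ?majorant_ge0//.
  by move=> /(integrable_ae measurableT); apply: filterS => x; exact.
(* The majorant is finite almost everywhere; the value [h x] elsewhere keeps [H] real and above [h]
   everywhere. *)
pose H x := if majorant x == +oo%E then h x else fine (majorant x).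
have HE x : majorant x \is a fin_num -> (H x)%:E = majorant x.
  by move=> f; rewrite /H; case: eqP => [e|_]; [rewrite e in f|rewrite fineK].
have hH x : h x <= H x.
  rewrite /H; case: eqP => // /eqP e.
  by rewrite -lee_fin fineK ?le_majorant// ge0_fin_numE ?majorant_ge0// ltey.
have H0 x : 0 < H x by exact: lt_le_trans (h0 x) (hH x).
have mH : measurable_fun setT H.
  apply: measurable_fun_ifT => //.
    apply: (measurable_fun_bool true).
    rewrite setTI (_ : _ @^-1` _ = majorant @^-1` [set +oo%E]).
      by rewrite -[X in measurable X]setTI; exact: mmaj.
    by apply/seteqP; split=> x /= /eqP.
  exact: measurableT_comp.
have aeH : {ae mu, forall x, (H x)%:E = majorant x}.
  by apply: filterS aemaj => x; exact: HE.
have HpE i k : (\int[mu]_(x in Q k) (H x `^ th i * sg i x `^ (1 - th i))%:E =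
    \int[mu]_(x in Q k) (majorant x `^ th i * (sg i x `^ (1 - th i))%:E))%E.
  apply: ge0_ae_eq_integral => //.
  - apply/measurable_EFinP/measurable_funTS/measurable_funM;
    by apply: measurable_powR_comp.
  - by apply: measurable_poweR_EFin; exact: measurable_funTS.
  - by move=> x _; rewrite lee_fin mulr_ge0 ?powR_ge0.
  - by move=> x _; rewrite mule_ge0 ?poweR_ge0// lee_fin powR_ge0.
  by apply: filterS aeH => x e _; rewrite -e.
exists H; split => //.
  rewrite (ge0_ae_eq_integral (g := majorant))//.
  - exact: integral_majorant_le.
  - exact/measurable_EFinP.
  - by move=> x _; rewrite lee_fin ltW.
  - by move=> x _; exact: majorant_ge0.
  - by apply: filterS aeH => x e _.
move=> k.
have avgE i : exists t : R, [/\ 0 < t, majorant_avg i k = t%:E &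
    (\int[mu]_(x in Q k) (H x `^ th i * sg i x `^ (1 - th i))%:E =
      (S i k * t `^ th i)%:E)%E].
  have /andP[t0 t1] := th01 i; have S0 := weight_mass_gt0 i k.
  have p0 : (0 < \int[mu]_(x in Q k) (H x `^ th i * sg i x `^ (1 - th i))%:E)%E.
    apply: integral_gt0 => //; first by rewrite Qm lte_fin.
      by apply/measurable_funTS/measurable_funM;
        apply: measurable_powR_comp.
    by move=> x _; rewrite mulr_gt0 ?powR_gt0.
  have poo : (\int[mu]_(x in Q k) (H x `^ th i * sg i x `^ (1 - th i))%:E < +oo)%E.
    apply: (@le_lt_trans _ _ (\int[mu]_(x in Q k) ((H x)%:E + (sg i x)%:E))%E).
      apply: ge0_le_integral => //.
      - by move=> x _; rewrite lee_fin mulr_ge0 ?powR_ge0.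
      - apply/measurable_EFinP/measurable_funTS/measurable_funM;
        by apply: measurable_powR_comp.
      - apply: emeasurable_funD; apply/measurable_EFinP; exact: measurable_funTS.
      - move=> x _; rewrite -EFinD lee_fin powR_mul_le_add ?(ltW (H0 _)) ?(ltW (sg0 _ _))//.
        by rewrite !ltW.
    rewrite ge0_integralD//.
    - rewrite Sint lte_add_pinfty ?ltry//.
      apply: (@le_lt_trans _ _ (\int[mu]_x majorant x)%E) => //.
      apply: le_trans (_ : (_ <= \int[mu]_(x in Q k) majorant x)%E) _.
        rewrite (ge0_ae_eq_integral (g := majorant))//.
        - by apply/measurable_EFinP; exact: measurable_funTS.
        - exact: measurable_funTS.
        - by move=> x _; rewrite lee_fin ltW.
        - by move=> x _; exact: majorant_ge0.
        - by apply: filterS aeH => x e _.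
      by apply: ge0_subset_integral => // x _; exact: majorant_ge0.
    - by move=> x _; rewrite lee_fin ltW.
    - by apply/measurable_EFinP; exact: measurable_funTS.
    - by move=> x _; rewrite lee_fin ltW.
    - by apply/measurable_EFinP; exact: measurable_funTS.
  have : majorant_avg i k = (((S i k)^-1%:E * \int[mu]_(x in Q k)
     (H x `^ th i * sg i x `^ (1 - th i))%:E) `^ (th i)^-1)%E by rewrite HpE.
  move: p0 poo; case: integral => // r; rewrite lte_fin => r0 _ e.
  exists (((S i k)^-1 * r) `^ (th i)^-1); split.
  - by apply: powR_gt0; rewrite mulr_gt0 ?invr_gt0.
  - by rewrite e.
  rewrite -powRrM mulVf ?gt_eqF// powRr1 ?mulr_ge0 ?invr_ge0 ?(ltW S0) ?(ltW r0)//.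
  by rewrite mulrA divff ?gt_eqF// mul1r.
have [t tE] := choice avgE.
have S0 i : 0 < S i k by exact: weight_mass_gt0.
have t0 i : 0 < t i by have [] := tE i.
have rho_ge i : t i * S i k <= \sum_i t i * S i k.
  rewrite (bigD1 i)//= lerDl sumr_ge0// => o _.
  by rewrite mulr_ge0 ?(ltW (t0 _)) ?(ltW (S0 _)).
(* Each [t i * S i k] is a candidate for the mass of [H]. Their sum dominates them all, and the
   lower bounds add up over [i] at the price of the sum in [rdf_const]. *)
exists (\sum_i t i * S i k).
  by apply: lt_le_trans (rho_ge i0); rewrite mulr_gt0.
split=> [i|j].
  have [_ _ ->] := tE i; have /andP[th0 th1] := th01 i.
  rewrite lee_fin; apply: (@le_trans _ _ (S i k `^ (1 - th i) * (t i * S i k) `^ th i)).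
    rewrite powRM ?(ltW (t0 _)) ?(ltW (S0 _))// mulrCA -powRD ?(gt_eqF (S0 _)) ?implybT//.
    by rewrite subrK powRr1 ?(ltW (S0 _))// mulrC.
  rewrite ler_wpM2l ?powR_ge0// ge0_ler_powR ?(ltW th0)// ?nnegrE.
    by rewrite mulr_ge0 ?(ltW (t0 _)) ?(ltW (S0 _)).
  by rewrite sumr_ge0// => o _; rewrite mulr_ge0 ?(ltW (t0 _)) ?(ltW (S0 _)).
apply: filterS aeH => x e Qx; rewrite mulr_suml.
apply: (@le_trans _ _ (\sum_i (pair_const i j * iter_const) * (S j k * H x))).
  apply: ler_sum => i _; have [_ ti _] := tE i.
  have := majorant_pair i j Qx; rewrite ti -e -!EFinM lee_fin => h1.
  apply: le_trans (_ : _ <= t i * (S i k * sg j x)) _; first by rewrite mulrA.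
  by rewrite (_ : _ * (S j k * H x) = pair_const i j * S j k * iter_const * H x)//; ring.
rewrite -mulr_suml mulrA ler_wpM2r ?(ltW (H0 _))// ler_wpM2r ?(ltW (S0 _))//.
rewrite /rdf_const -(pair_bigA _ (fun i j => pair_const i j * iter_const))/=.
apply: (@le_trans _ _ (\sum_i \sum_j pair_const i j * iter_const)); last by rewrite lerDr.
apply: ler_sum => i _; rewrite (bigD1 j)//= lerDl sumr_ge0// => o _.
by rewrite mulr_ge0 ?powR_ge0// ltW// iter_const_gt0.
Qed.

End Iteration.
End Pair.
End RubioDeFrancia.

Lemma big_option (T : Type) (idx : T) (op : Monoid.com_law idx) (J : finType)
    (F : option J -> T) :
  \big[op/idx]_o F o = op (F None) (\big[op/idx]_j F (Some j)).
Proof.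
rewrite (bigD1 None)//=; congr (op _ _).
rewrite (reindex_omap Some id) => [|[]//].
by apply: eq_bigl => j; rewrite eqxx.
Qed.

(** * Algebra of the bounds for the new weights *)

Section PowerIdentities.
Context {R : realType}.
Implicit Types x a b g c r t : R.

Lemma powRD_gt0 x a b : 0 < x -> x `^ (a + b) = x `^ a * x `^ b.
Proof. by move=> x0; rewrite powRD// (gt_eqF x0) implybT. Qed.

Lemma powRV x a : 0 <= x -> x^-1 `^ a = (x `^ a)^-1.
Proof. by move=> x0; rewrite -(powR_inv1 x0) -(powRrM x) mulN1r powRN. Qed.

Lemma ler_powR_N g x y : 0 <= g -> 0 < x -> x <= y -> y `^ (- g) <= x `^ (- g).
Proof.
move=> g0 x0 xy; have y0 := lt_le_trans x0 xy.
rewrite !powRN lef_pV2 ?posrE ?powR_gt0//.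
by apply: ge0_ler_powR => //; rewrite nnegrE ltW.
Qed.

(** Here [x] is a normalised mass of some [sg], [r] that of [H], and [t] a truncation level. The
    level cancels between the bound for a single weight and the correction of the product weight,
    leaving the power of [x] that occurs in the condition for [v]. *)
Lemma powR_balance (x t c r b g : R) : 0 < x -> 0 < t -> 0 < c -> 0 < r ->
  x `^ b * t `^ (- g) * (t * (c * x) / r) `^ g =
  x `^ (b + g) * r `^ (- g) * c `^ g.
Proof.
move=> x0 t0 c0 r0.
rewrite (powRM g (mulr_ge0 (ltW t0) (mulr_ge0 (ltW c0) (ltW x0)))) ?invr_ge0 ?(ltW r0)//.
rewrite (powRM g (ltW t0) (mulr_ge0 (ltW c0) (ltW x0))) (powRM g (ltW c0) (ltW x0)).
rewrite (powRV g (ltW r0)) powRD_gt0// !powRN.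
by field; rewrite !gt_eqF ?powR_gt0.
Qed.

Lemma powR_balance2 (x c r b g : R) : 0 < x -> 0 < c -> 0 < r ->
  x `^ b * (r / (c * x)) `^ (- g) = x `^ (b + g) * r `^ (- g) * c `^ g.
Proof.
move=> x0 c0 r0; have t0 : 0 < r / (c * x) by rewrite divr_gt0// mulr_gt0.
rewrite -(powR_balance b g x0 t0 c0 r0) divfK ?gt_eqF ?mulr_gt0// divff ?gt_eqF//.
by rewrite powR1 mulr1.
Qed.

End PowerIdentities.

(** * Averages and the weight condition through real bounds *)

Section ClassEstimates.
Context {disp : measure_display} {R : realType} {X : measurableType disp}.
Variable mu : {measure set X -> \bar R}.

(* [mean_le b A u B] says that the [1/b]-average of [u] over [A] is at most [B];
   it is an essential supremum for [b = 0]. *)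
Definition mean_le (b : R) (A : set X) (u : X -> R) (B : R) : Prop :=
  if b == 0 then {ae mu, forall x, A x -> u x <= B}
  else (\int[mu]_(x in A) (u x `^ b^-1)%:E <= (B `^ b^-1)%:E * mu A)%E.

(* The index [None] stands for the product weight. *)
Definition dual_tuple (J : finType) (W : J -> X -> R) (o : option J) (x : X) : R :=
  if o is Some j then (W j x)^-1 else \prod_j W j x.

Lemma dual_tuple_prod (J : finType) (W : J -> X -> R) x :
  (forall j x, 0 < W j x) -> \prod_o dual_tuple W o x = 1.
Proof.
move=> W0; rewrite big_option/= prodfV divff// gt_eqF//.
exact: prodr_gt0.
Qed.

(** Witnesses [B] in place of the averages keep the products real; [class_leP] relates this to the
    supremum. *)
Definition class_le (J : finType) (Q : nat -> set X) (beta : option J -> R)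
    (W : J -> X -> R) (K : R) : Prop :=
  forall k, exists B : option J -> R,
    [/\ forall o, 0 < B o, \prod_o B o <= K &
        forall o, mean_le (beta o) (Q k) (dual_tuple W o) (B o)].

Lemma mean_le_ae_powR (b : R) (A : set X) (u sg : X -> R) (m S t : R) :
  measurable A -> mu A = m%:E -> 0 < m -> 0 <= b -> 0 <= t ->
  measurable_fun setT u -> (forall x, 0 < u x) ->
  measurable_fun setT sg -> (forall x, 0 < sg x) ->
  (\int[mu]_(x in A) (sg x)%:E = S%:E)%E -> 0 < S ->
  {ae mu, forall x, A x -> u x <= sg x `^ b * t} ->
  mean_le b A u ((S / m) `^ b * t).
Proof.
move=> mA Am m0 b0 t0 mu_ u0 msg sg0 AS S0 ule; rewrite /mean_le.
case: eqVneq => [b00|b00].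
  by apply: filterS ule => x h /h; rewrite b00 !powRr0.
have bp : 0 < b by rewrite lt_neqAle eq_sym b00.
have bV : 0 <= b^-1 by rewrite invr_ge0.
have -> : ((((S / m) `^ b * t) `^ b^-1)%:E * mu A =
    (t `^ b^-1)%:E * \int[mu]_(x in A) (sg x)%:E)%E.
  rewrite Am AS -!EFinM; congr EFin.
  rewrite powRM ?powR_ge0// -powRrM divff// powRr1 ?divr_ge0 ?(ltW S0) ?(ltW m0)//.
  by field; rewrite gt_eqF.
rewrite -ge0_integralZl_EFin ?powR_ge0//; last 2 first.
- by move=> x _; rewrite lee_fin ltW.
- by apply/measurable_EFinP; exact: measurable_funTS.
apply: ae_ge0_le_integral => //.
- by move=> x _; rewrite lee_fin powR_ge0.
- apply/measurable_EFinP/measurable_funTS.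
  by apply: measurable_powR_comp.
- by move=> x _; rewrite -EFinM lee_fin mulr_ge0 ?powR_ge0// ltW.
- by apply: measurable_funeM; apply/measurable_EFinP; exact: measurable_funTS.
apply: filterS ule => x h /h {}h; rewrite -EFinM lee_fin.
have := ge0_ler_powR bV _ _ h; rewrite !nnegrE (ltW (u0 _)) mulr_ge0 ?powR_ge0//.
move=> /(_ isT isT) /le_trans; apply.
by rewrite powRM ?powR_ge0// -powRrM divff// powRr1 ?(ltW (sg0 _))// mulrC.
Qed.

(** Since [a / b] and [(b - a) / b] add up to 1, the power [u^(1/b)] is dominated by a mixed power
    of [sg] and [H], whose integral the iteration controls. *)
Lemma mean_le_ae_mixed (a b : R) (A : set X) (u sg H : X -> R) (m S rho t : R) :
  measurable A -> mu A = m%:E -> 0 < m -> 0 < a -> a < b -> 0 <= t ->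
  measurable_fun setT u -> (forall x, 0 < u x) ->
  measurable_fun setT sg -> (forall x, 0 < sg x) ->
  measurable_fun setT H -> (forall x, 0 < H x) ->
  0 < S -> 0 < rho ->
  (\int[mu]_(x in A) (H x `^ (- (a - b) / b) * sg x `^ (1 - (- (a - b) / b)))%:E <=
    (S `^ (1 - (- (a - b) / b)) * rho `^ (- (a - b) / b))%:E)%E ->
  {ae mu, forall x, A x -> u x <= sg x `^ a * H x `^ (- (a - b)) * t} ->
  mean_le b A u ((S / m) `^ a * (rho / m) `^ (- (a - b)) * t).
Proof.
move=> mA Am m0 a0 ab t0 mu_ u0 msg sg0 mH H0 S0 rho0 AS ule; rewrite /mean_le.
have bp : 0 < b by exact: lt_trans ab.
have bV : 0 <= b^-1 by rewrite invr_ge0 ltW.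
have mV : 0 <= m^-1 by rewrite invr_ge0 ltW.
rewrite gt_eqF//.
set th := - (a - b) / b in AS.
have e1 : a / b = 1 - th by rewrite /th; field; rewrite gt_eqF.
have -> : ((((S / m) `^ a * (rho / m) `^ (- (a - b)) * t) `^ b^-1)%:E * mu A =
    (t `^ b^-1)%:E * (S `^ (1 - th) * rho `^ th)%:E)%E.
  rewrite Am -!EFinM; congr EFin.
  rewrite (powRM _ (mulr_ge0 (powR_ge0 _ _) (powR_ge0 _ _)) t0) powR_mul2 -/th e1.
  rewrite !powRM ?(ltW S0) ?(ltW rho0)//.
  have mm : m^-1 `^ (1 - th) * m^-1 `^ th * m = 1.
    by rewrite -powRD ?subrK ?powRr1 ?mulVf ?gt_eqF ?invr_gt0 ?implybT.
  rewrite -[RHS]mulr1 -[X in _ = _ * X]mm; ring.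
apply: le_trans (lee_wpmul2l _ AS); last by rewrite lee_fin powR_ge0.
rewrite -ge0_integralZl_EFin ?powR_ge0//; last 2 first.
- by move=> x _; rewrite lee_fin mulr_ge0 ?powR_ge0.
- apply/measurable_EFinP/measurable_funTS/measurable_funM;
  by apply: measurable_powR_comp.
apply: ae_ge0_le_integral => //.
- by move=> x _; rewrite lee_fin powR_ge0.
- apply/measurable_EFinP/measurable_funTS.
  by apply: measurable_powR_comp.
- by move=> x _; rewrite -EFinM lee_fin !mulr_ge0 ?powR_ge0.
- apply: measurable_funeM.
  apply/measurable_EFinP/measurable_funTS/measurable_funM;
  by apply: measurable_powR_comp.
apply: filterS ule => x h /h {}h; rewrite -EFinM lee_fin.
have := ge0_ler_powR bV _ _ h; rewrite !nnegrE (ltW (u0 _)) !mulr_ge0 ?powR_ge0//.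
move=> /(_ isT isT) /le_trans; apply.
rewrite (powRM _ (mulr_ge0 (powR_ge0 _ _) (powR_ge0 _ _)) t0) powR_mul2 -/th e1.
by rewrite mulrC [X in _ * X]mulrC.
Qed.

End ClassEstimates.

(** * Weights for the exponents [p] built from the majorant *)

Section TruncatedWeights.
Context {disp : measure_display} {R : realType} {X : measurableType disp}.
Variable mu : {measure set X -> \bar R}.
Variables (Q : nat -> set X) (mQ : forall k, measurable (Q k)).
Variables (m : nat -> R) (Qm : forall k, mu (Q k) = (m k)%:E) (m0 : forall k, 0 < m k).
Variables (J : finType) (alpha beta : option J -> R).
Hypotheses (a0 : forall o, 0 < alpha o) (b0 : forall o, 0 <= beta o).
Hypothesis ab : \sum_o alpha o = \sum_o beta o.

Definition gap (o : option J) : R := alpha o - beta o.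

(** For a negative gap this is the power to which [H] enters the integrand of order [1 / beta o].
    Otherwise only the pointwise lower bound on [H] is used, and [2^-1] is an arbitrary value
    between 0 and 1. *)
Definition gap_exp (o : option J) : R := if gap o < 0 then - gap o / beta o else 2^-1.

Lemma gap_exp01 o : 0 < gap_exp o < 1.
Proof.
rewrite /gap_exp; case: ifPn => [g0|_]; last by rewrite invr_gt0 ltr0n/= invf_lt1// ltr1n.
have b0' : 0 < beta o by move: g0; rewrite /gap subr_lt0; exact: lt_trans.
by rewrite divr_gt0 ?oppr_gt0//= ltr_pdivrMr// mul1r /gap opprB ltrBlDr ltrDl.
Qed.

Lemma sum_gap : \sum_o gap o = 0.
Proof. by rewrite sumrB ab subrr. Qed.

Variables (sg : option J -> X -> R) (S : option J -> nat -> R) (K : R).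
Hypotheses (msg : forall o, measurable_fun setT (sg o)) (sg0 : forall o x, 0 < sg o x).
Hypothesis sg1 : forall x, \prod_o sg o x `^ alpha o = 1.
Hypothesis Sint : forall o k, (\int[mu]_(x in Q k) (sg o x)%:E = (S o k)%:E)%E.
Hypothesis S0 : forall o k, 0 < S o k.
Hypothesis SK : forall k, \prod_o (S o k / m k) `^ alpha o <= K.
Variables (H : X -> R) (C : R) (mH : measurable_fun setT H) (H0 : forall x, 0 < H x).
Hypothesis C1 : 1 <= C.
Hypothesis rdf : forall k, exists2 rho, 0 < rho &
  (forall o, \int[mu]_(x in Q k) (H x `^ gap_exp o * sg o x `^ (1 - gap_exp o))%:E <=
     (S o k `^ (1 - gap_exp o) * rho `^ gap_exp o)%:E)%E /\
  (forall o, {ae mu, forall x, Q k x -> rho * sg o x <= C * S o k * H x}).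

(* The bound [n * sg] makes [truncated_weight n] at most [n^gap (1 + v)] where
   [v = sg^(-alpha)], hence locally integrable. *)
Definition truncated (n : R) (j : J) (x : X) : R :=
  if 0 < gap (Some j) then Num.min (H x) (n * sg (Some j) x) else H x.

Definition truncated_weight (n : R) (j : J) (x : X) : R :=
  sg (Some j) x `^ (- alpha (Some j)) * truncated n j x `^ gap (Some j).

Lemma truncated_gt0 n j x : 0 < n -> 0 < truncated n j x.
Proof.
by move=> n0; rewrite /truncated; case: ifPn => // _; rewrite lt_min H0/= mulr_gt0.
Qed.

Lemma truncated_weight_gt0 n j x : 0 < n -> 0 < truncated_weight n j x.
Proof. by move=> n0; rewrite mulr_gt0 ?powR_gt0// truncated_gt0. Qed.

Lemma measurable_truncated_weight n j : measurable_fun setT (truncated_weight n j).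
Proof.
apply: measurable_funM; apply: measurable_powR_comp => //.
rewrite /truncated; case: (0 < gap _) => //.
by apply: measurable_minr => //; exact: measurable_funM.
Qed.

(** As the gaps sum to zero, the untruncated powers of [H] multiply to [H^(- gap None)]. The last
    product is the correction for the truncation and is at most 1. *)
Lemma prod_truncated_weight n x : 0 < n ->
  \prod_j truncated_weight n j x = sg None x `^ alpha None * H x `^ (- gap None) *
    \prod_j (truncated n j x / H x) `^ gap (Some j).
Proof.
move=> n0; rewrite big_split/=.
have -> : \prod_j sg (Some j) x `^ (- alpha (Some j)) = sg None x `^ alpha None.
  have := sg1 x; rewrite big_option/=.
  under [in X in _ -> X]eq_bigr do rewrite powRN.
  rewrite prodfV => /(congr1 (fun y => y / \prod_j sg (Some j) x `^ alpha (Some j))).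
  rewrite mul1r mulfK// gt_eqF//.
  by apply: prodr_gt0 => j _; exact: powR_gt0.
rewrite -mulrA; congr (_ * _).
have -> : - gap None = \sum_j gap (Some j).
  by have := sum_gap; rewrite big_option/= => /eqP; rewrite addrC addr_eq0 => /eqP ->.
rewrite powR_sum// -big_split/=; apply: eq_bigr => j _.
rewrite -powRM ?divr_ge0 ?(ltW (H0 _)) ?(ltW (truncated_gt0 _ _ _))//.
by rewrite mulrCA divff ?mulr1// gt_eqF.
Qed.

(** For a negative gap the mixed integrals are used, for a nonnegative one [H] is replaced by its
    lower bound. Apart from the truncation each bound is [s^alpha * r^(- gap)] times a power of [C];
    the powers of [r] cancel, and the powers of [s] form the condition for [v]. *)
Theorem truncated_weight_class n : 0 < n ->
  class_le mu Q beta (truncated_weight n) (K * C `^ (\sum_o `|gap o|)).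
Proof.
move=> n0 k; have [rho rho0 [hmix hae]] := rdf k.
have S0' o : 0 < S o k := S0 o k; have mk := m0 k.
pose s o := S o k / m k; pose r := rho / m k.
have s0 o : 0 < s o by rewrite divr_gt0.
have r0 : 0 < r by rewrite divr_gt0.
have C0 : 0 < C by exact: lt_le_trans C1.
have {}hae o : {ae mu, forall x, Q k x -> r / (C * s o) * sg o x <= H x}.
  apply: filterS (hae o) => x h /h {}h.
  have -> : r / (C * s o) = rho / (C * S o k).
    by rewrite /r /s; field; rewrite !gt_eqF.
  by rewrite mulrAC ler_pdivrMr ?mulr_gt0// [leRHS]mulrC.
(* The truncated function is still at least [tau j * sg (Some j)] almost everywhere on the cube. *)
pose tau j := Num.min (r / (C * s (Some j))) n.
have tau0 j : 0 < tau j by rewrite lt_min n0 divr_gt0// mulr_gt0.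
have taur j : tau j <= r / (C * s (Some j)) by rewrite ge_min lexx.
have taun j : tau j <= n by rewrite ge_min lexx orbT.
have tauE j : tau j = r / (C * s (Some j)) \/ tau j = n.
  by rewrite /tau /Num.min; case: ifP; [left|right].
have sE o : s o = S o k / m k by [].
have rE : r = rho / m k by [].
clearbody tau s r.
(* A lower [tau j] raises the bound for the weight [j]; the factor [P], which bounds the shrinking
   of the product weight on the cube, makes up for it exactly. *)
pose P := \prod_(j | 0 < gap (Some j)) (tau j * (C * s (Some j)) / r) `^ gap (Some j).
have P0 : 0 < P.
  by apply: prodr_gt0 => j _; apply: powR_gt0; rewrite divr_gt0// !mulr_gt0.
pose B o := if gap o < 0 then s o `^ alpha o * r `^ (- gap o) * (if o is Some _ then 1 else P)
  else if o is Some j then s o `^ beta o * tau j `^ (- gap o)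
       else s o `^ beta o * ((r / (C * s o)) `^ (- gap o) * P).
exists B; split.
- move=> o; rewrite /B; case: ifP => _; case: o => [j|];
  by rewrite !mulr_gt0 ?powR_gt0// divr_gt0// mulr_gt0.
- have BE : \prod_o B o = \prod_o ((s o `^ alpha o * r `^ (- gap o)) *
      (if 0 < gap o then C `^ gap o else 1)).
    rewrite !big_option/=.
    have gE o : alpha o = beta o + gap o by rewrite /gap addrC subrK.
    have e j : B (Some j) * (if 0 < gap (Some j) then
        (tau j * (C * s (Some j)) / r) `^ gap (Some j) else 1) =
      s (Some j) `^ alpha (Some j) * r `^ (- gap (Some j)) *
        (if 0 < gap (Some j) then C `^ gap (Some j) else 1).
      rewrite /B; case: ltrgt0P => g0; rewrite ?mulr1//.
        by rewrite powR_balance// -gE.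
      by rewrite gE g0 addr0 oppr0 !powRr0 mulr1.
    have -> : B None * \prod_j B (Some j) = (s None `^ alpha None * r `^ (- gap None) *
       (if 0 < gap None then C `^ gap None else 1)) * (P * \prod_j B (Some j)).
      rewrite mulrA; congr (_ * _); rewrite /B; case: ltrgt0P => g0; rewrite ?mulr1//.
        by rewrite mulrA powR_balance2// -gE.
      by rewrite gE g0 addr0 oppr0 !powRr0 mulr1 mul1r.
    congr (_ * _); rewrite /P big_mkcond -big_split/=.
    by apply: eq_bigr => j _; rewrite mulrC e.
  rewrite BE big_split/= big_split/= -powR_sum// sumrN sum_gap oppr0 powRr0 mulr1.
  apply: ler_pM.
  + by apply: prodr_ge0 => o _; exact: powR_ge0.
  + by apply: prodr_ge0 => o _; case: ifP => // _; exact: powR_ge0.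
  + by under eq_bigr do rewrite sE; exact: SK.
  rewrite powR_sum//; apply: ler_prod => o _.
  case: ifPn => [g0|_]; first by rewrite powR_ge0 gtr0_norm/=.
  by rewrite ler01/= -[leLHS](powRr0 C) ler_powR.

have trunc_ge j : {ae mu, forall x, Q k x -> tau j * sg (Some j) x <= truncated n j x}.
  apply: filterS (hae (Some j)) => x h /h {}h.
  have h1 : tau j * sg (Some j) x <= H x by apply: le_trans h; rewrite ler_wpM2r// ltW.
  by rewrite /truncated; case: ifP => // _; rewrite le_min h1/= ler_wpM2r// ltW.
have mprod : measurable_fun setT (fun x => \prod_j truncated_weight n j x).
  by apply: measurable_prod => j _; exact: measurable_truncated_weight.
have mu_ o : measurable_fun setT (dual_tuple (truncated_weight n) o).
  case: o => [j|]; last exact: mprod.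
  rewrite (_ : dual_tuple _ _ = fun x => truncated_weight n j x `^ (-1)).
    apply: measurable_powR_comp => //.
    exact: measurable_truncated_weight.
  by apply/funext => x; rewrite powR_inv1// ltW// truncated_weight_gt0.
have u0 o x : 0 < dual_tuple (truncated_weight n) o x.
  case: o => [j|] /=; first by rewrite invr_gt0 truncated_weight_gt0.
  by apply: prodr_gt0 => j _; exact: truncated_weight_gt0.
have ratio_ge0 j x : 0 <= truncated n j x / H x.
  by rewrite divr_ge0 ?(ltW (H0 _))// ltW// truncated_gt0.
have prodP : {ae mu, forall x, Q k x ->
    \prod_j (truncated n j x / H x) `^ gap (Some j) <= P}.
  have : {ae mu, forall x, forall j, Q k x -> r / (C * s (Some j)) * sg (Some j) x <= H x}.
    by apply: filter_forall => j; exact: hae.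
  apply: filterS => x hx Qx.
  rewrite /P [leRHS]big_mkcond; apply: ler_prod => j _; rewrite powR_ge0/=.
  case: ifPn => g0; last first.
    by rewrite /truncated (negbTE g0) divff ?powR1// gt_eqF.
  apply: ge0_ler_powR; rewrite ?(ltW g0)// ?nnegrE//.
    by rewrite divr_ge0 ?(ltW r0)// !mulr_ge0 ?(ltW (tau0 _)) ?(ltW C0) ?(ltW (s0 _)).
  have := hx j Qx => {}hx; rewrite /truncated g0 ler_pdivrMr//.
  case: (tauE j) => ->.
    rewrite divfK ?gt_eqF ?mulr_gt0// divff ?gt_eqF// mul1r.
    by rewrite ge_min lexx.
  rewrite ge_min; apply/orP; right; rewrite -!mulrA ler_pM2l//.
  rewrite mulrA -(ler_pM2l (_ : 0 < r / (C * s (Some j)))) ?divr_gt0 ?mulr_gt0//.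
  apply: le_trans hx _; rewrite le_eqVlt; apply/orP; left; apply/eqP.
  by field; rewrite !gt_eqF.
have uNone : {ae mu, forall x, Q k x -> dual_tuple (truncated_weight n) None x <=
    sg None x `^ alpha None * H x `^ (- gap None) * P}.
  apply: filterS prodP => x h /h {}h; rewrite /= prod_truncated_weight//.
  by rewrite ler_wpM2l// mulr_ge0 ?powR_ge0.
have abg o : alpha o = beta o + gap o by rewrite /gap addrC subrK.
have gap_lt o : gap o < 0 -> alpha o < beta o by rewrite /gap subr_lt0.
case=> [j|].
- rewrite /B; case: ifPn => g0.
    rewrite sE rE; apply: mean_le_ae_mixed (mQ k) (Qm k) mk (a0 _) (gap_lt _ g0) _
      (mu_ (Some j)) (u0 (Some j)) (msg (Some j)) (sg0 _) mH H0 (S0' _) rho0 _ _ => //.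
      by have := hmix (Some j); rewrite /gap_exp g0.
    apply: nearW => x _ /=; rewrite mulr1 /truncated_weight /truncated ltNge (ltW g0)/=.
    by rewrite invfM -!powRN opprK.
  rewrite sE; apply: mean_le_ae_powR (mQ k) (Qm k) mk (b0 _) (powR_ge0 _ _)
    (mu_ (Some j)) (u0 (Some j)) (msg (Some j)) (sg0 _) (Sint _ _) (S0' _) _.
  rewrite -leNgt in g0; apply: filterS (trunc_ge j) => x h /h {}h /=.
  rewrite /truncated_weight invfM -!powRN opprK.
  apply: (@le_trans _ _ (sg (Some j) x `^ alpha (Some j) * (tau j * sg (Some j) x) `^ (- gap (Some j)))).
    by rewrite ler_wpM2l ?powR_ge0// ler_powR_N// mulr_gt0.
  rewrite abg powRD_gt0// powRM ?(ltW (tau0 _)) ?(ltW (sg0 _ _))// !powRN.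
  by rewrite le_eqVlt; apply/orP; left; apply/eqP; field; rewrite !gt_eqF ?powR_gt0.
- rewrite /B; case: ifPn => g0.
    rewrite sE rE; apply: mean_le_ae_mixed (mQ k) (Qm k) mk (a0 _) (gap_lt _ g0) (ltW P0)
      (mu_ None) (u0 None) (msg None) (sg0 _) mH H0 (S0' _) rho0 _ uNone.
    by have := hmix None; rewrite /gap_exp g0.
  rewrite sE; apply: mean_le_ae_powR (mQ k) (Qm k) mk (b0 _) _
    (mu_ None) (u0 None) (msg None) (sg0 _) (Sint _ _) (S0' _) _.
    by rewrite mulr_ge0 ?powR_ge0// ltW.
  rewrite -leNgt in g0; apply: filterS2 uNone (hae None) => x h1 h2 Qx.
  apply: le_trans (h1 Qx) _; rewrite mulrA ler_wpM2r ?(ltW P0)//.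
  rewrite -sE; set y := r / _ in h2 *; have y0 : 0 < y by rewrite divr_gt0// mulr_gt0.
  apply: (@le_trans _ _ (sg None x `^ alpha None * (y * sg None x) `^ (- gap None))).
    apply: ler_wpM2l; first exact: powR_ge0.
    by apply: ler_powR_N g0 _ (h2 Qx); exact: mulr_gt0.
  rewrite abg powRD_gt0// powRM ?(ltW y0) ?(ltW (sg0 _ _))// !powRN.
  by rewrite le_eqVlt; apply/orP; left; apply/eqP; field; rewrite !gt_eqF ?powR_gt0.
Qed.

End TruncatedWeights.

(** * Balls and cubes in a space of homogeneous type *)

Section HomogeneousGeometry.
Context {disp : measure_display} {R : realType} {X : measurableType disp}.
Variables (mu : {measure set X -> \bar R}) (d : X -> X -> R).

(** Only finitely many disjoint sets of measure at least [1 / (l + 1)] fit into a set of finite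
    measure, and the family is the union of such parts over [n] and [l]. *)
Lemma disjoint_family_countable (F : set (set X)) (B : nat -> set X) :
  (forall n, measurable (B n)) -> (forall n, (mu (B n) < +oo)%E) ->
  (forall A, F A -> [/\ measurable A, (0 < mu A)%E & exists n, A `<=` B n]) ->
  (forall A A', F A -> F A' -> A = A' \/ A `&` A' = set0) ->
  countable F.
Proof.
move=> mB Boo FA Fdis.
pose G n l := [set A | [/\ F A, A `<=` B n & (l.+1%:R^-1%:E <= mu A)%E]].
have : F `<=` \bigcup_n \bigcup_l G n l.
  move=> A FAA; have [mA A0 [n AB]] := FA A FAA; exists n => //.
  have Afin : mu A \is a fin_num.
    rewrite ge0_fin_numE//; apply: le_lt_trans (Boo n).
    by apply: le_measure; rewrite ?inE.
  move: A0; rewrite -(fineK Afin) lte_fin => A0.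
  exists (Num.truncn (fine (mu A))^-1) => //; split=> //.
  rewrite -(fineK Afin) lee_fin -[leRHS]invrK lef_pV2 ?posrE ?invr_gt0//.
  exact/ltW/truncnS_gt.
move=> /subset_card_le /sub_countable; apply.
apply: bigcup_countable => // n _; apply: bigcup_countable => // l _.
apply: finite_set_countable; apply: contrapT => /infiniteP /pcard_leP[f].
have fG i : G n l (f i) by exact: funS.
have fdis : trivIset setT f.
  apply/trivIsetP => i j _ _ ij; have [fi _ _] := fG i; have [fj _ _] := fG j.
  have [e|//] := Fdis _ _ fi fj.
  by move: ij; rewrite (inj (in_setT i) (in_setT j) e) eqxx.
have mf i : measurable (f i) by have [/FA[]] := fG i.
have Bfin : mu (B n) \is a fin_num by rewrite ge0_fin_numE.
(* One set more than the measure of [B n] can hold. *)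
pose M := (Num.truncn (fine (mu (B n)) * l.+1%:R)).+1.
have : ((M%:R / l.+1%:R)%:E <= mu (B n))%E.
  apply: (@le_trans _ _ (mu (\big[setU/set0]_(i < M) f i))).
    rewrite measure_bigsetU//.
    apply: (@le_trans _ _ (\sum_(i < M) l.+1%:R^-1%:E)%E); last first.
      by apply: lee_sum => i _; have [] := fG i.
    by rewrite sumEFin lee_fin sumr_const card_ord mulr_natl.
  apply: le_measure; rewrite ?inE//; first exact: bigsetU_measurable.
  move=> x; rewrite -bigcup_mkord => -[i _ fx]; have [_ fB _] := fG i; exact: fB.
rewrite -(fineK Bfin) lee_fin ler_pdivrMr// leNgt => /negP; apply.
exact: truncnS_gt.
Qed.

Hypothesis hX : homogeneous_type d mu.

Lemma qball_measure_lty x r : 0 < r -> (mu (qball d x r) < +oo)%E.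
Proof.
move=> r0; have [C /(_ x (r / 2))] := homogeneous_doubling hX.
rewrite divr_gt0// => /(_ isT)[_ h1 h2].
by rewrite -[r](@divfK _ 2)// mulrC; exact: le_lt_trans h1 h2.
Qed.

Lemma qball_measure_gt0 x r : 0 < r -> (0 < mu (qball d x r))%E.
Proof.
move=> r0; have [C /(_ x (r / 2))] := homogeneous_doubling hX.
rewrite divr_gt0// => /(_ isT)[h _ _].
by rewrite -[r](@divfK _ 2)// mulrC.
Qed.

Definition base_ball (n : nat) : set X := qball d point n.+1%:R.

Lemma measurable_base_ball n : measurable (base_ball n).
Proof. exact: (homogeneous_ball hX). Qed.

Lemma qball_sub_base_ball x r : exists n, qball d x r `<=` base_ball n.
Proof.
have [A A1 tri] := quasi_metric_triangle (homogeneous_quasi_metric hX).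
exists (Num.truncn (A * (d point x + r))) => y; rewrite /qball/= => xy.
apply: lt_trans (truncnS_gt _); apply: le_lt_trans (tri _ _ x) _.
by rewrite ltr_pM2l ?(lt_le_trans _ A1)// ltrD2l.
Qed.

Variables (N : nat) (L : 'I_N -> dyadic_lattice d).

Lemma dyadic_cube_facts (A : set X) : dyadic_cubes L A ->
  [/\ measurable A, (0 < mu A)%E, (mu A < +oo)%E & exists n, A `<=` base_ball n].
Proof.
move=> [i [k [j ->]]]; have [bc cb] := dl_ball j.
have mA : measurable (dl_cube j) by exact: dl_measurable.
have /andP[c0 cC] := dl_param (L i); have /andP[dl0 _] := dl_delta01 (L i).
have dk : 0 < dl_delta (L i) ^ k by exact: exprz_gt0.
split => //.
- apply: lt_le_trans (qball_measure_gt0 (dl_center j) (mulr_gt0 c0 dk)) _.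
  apply: le_measure; rewrite ?inE//; exact: (homogeneous_ball hX).
- apply: le_lt_trans (qball_measure_lty (dl_center j) (mulr_gt0 (lt_le_trans c0 cC) dk)).
  apply: le_measure; rewrite ?inE//; exact: (homogeneous_ball hX).
- have [n bn] := qball_sub_base_ball (dl_center j) (dl_C0 (L i) * dl_delta (L i) ^ k).
  by exists n; exact: subset_trans bn.
Qed.

Lemma dyadic_nested i k l (j : dl_index (L i) k) (j' : dl_index (L i) l) :
  [\/ dl_cube j `&` dl_cube j' = set0, dl_cube j `<=` dl_cube j' |
     dl_cube j' `<=` dl_cube j].
Proof.
have [kl|lk] := leP k l.
  have [|h] := dl_nested j' j kl; first by rewrite setIC; constructor 1.
  by constructor 3.
by have [h|h] := dl_nested j j' (ltW lk); [constructor 1|constructor 2].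
Qed.

Lemma dyadic_cubes_countable : countable (dyadic_cubes L).
Proof.
pose F (ik : 'I_N * int) := range (@dl_cube _ _ _ _ (L ik.1) ik.2).
have : dyadic_cubes L `<=` \bigcup_ik F ik.
  by move=> A [i [k [j ->]]]; exists (i, k) => //; exists j.
move=> /subset_card_le /sub_countable; apply.
apply: bigcup_countable => // -[i k] _.
apply: (@disjoint_family_countable _ base_ball).
- exact: measurable_base_ball.
- by move=> n; exact: qball_measure_lty.
- move=> A [j _ <-] /=; have D : dyadic_cubes L (dl_cube j) by exists i, k, j.
  by have [] := dyadic_cube_facts D.
- move=> _ _ [j _ <-] [j' _ <-] /=.
  have [h|h] := dl_nested j j' (lexx k); first by right.
  have [h'|h'] := dl_nested j' j (lexx k); first by right; rewrite setIC.
  by left; apply/seteqP.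
Qed.

Hypothesis hL : covers_balls d (dyadic_cubes L).

Lemma dyadic_enumeration : exists (Q : nat -> set X) (m : nat -> R),
  [/\ dyadic_cubes L = range Q, forall k, measurable (Q k),
      forall k, mu (Q k) = (m k)%:E, forall k, 0 < m k &
      0 < N%:R :> R /\ covering_bound mu Q N%:R].
Proof.
have [gam gam1 cov] := hL.
(* The cube covering a unit ball excludes the empty family; what remains is a surjection from [nat],
   which may repeat cubes. *)
have [A0 [DA0 _ _]] := cov point 1 ltr01.
have [/eqP|[Q]] := pfcard_geP dyadic_cubes_countable.
  by move=> /eqP e; rewrite e in DA0.
have QD : dyadic_cubes L = range Q by apply/seteqP; split; [exact: 'surj_Q|move=> A [k _ <-]; exact: funS].
have DQ k : dyadic_cubes L (Q k) by exact: funS.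
have fQ k := dyadic_cube_facts (DQ k).
exists Q, (fun k => fine (mu (Q k))); split => //.
- by move=> k; have [] := fQ k.
- by move=> k; have [_ _ h _] := fQ k; rewrite fineK// ge0_fin_numE.
- by move=> k; have [_ h h' _] := fQ k; rewrite fine_gt0// h.
have [lat hlat] := choice DQ.
split; first by rewrite ltr0n; case: (lat 0%N) => // n nN; exact: leq_ltn_trans nN.
apply: (@nested_families_covering _ _ _ _ _ _ N lat).
  by move=> k; have [] := fQ k.
move=> a b e; have [k [j ->]] := hlat a; have := hlat b; rewrite -e => -[l [j' ->]].
exact: dyadic_nested.
Qed.

(** This function is added to the data before the iteration. Its positive lower bounds on balls
    bound the negative powers of the majorant there, which makes the new weights locally
    integrable. *)
Lemma positive_integrable_fun : exists h : X -> R,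
  [/\ measurable_fun setT h, forall x, 0 < h x, (\int[mu]_x (h x)%:E <= 1)%E &
      forall x r, exists2 e, 0 < e & forall y, qball d x r y -> e <= h y].
Proof.
pose b n := fine (mu (base_ball n)).
have bE n : mu (base_ball n) = (b n)%:E.
  by rewrite fineK// ge0_fin_numE// qball_measure_lty.
have b0 n : 0 <= b n by rewrite fine_ge0.
(* The factor [2^-(n+1)] makes the series converge pointwise; the division by [1 + b n] does the
   same for its integral. *)
pose c n : R := (2 ^ n.+1)%:R^-1 / (1 + b n).
have c0 n : 0 < c n.
  by rewrite divr_gt0 ?invr_gt0 ?ltr0n ?expn_gt0// ltr_pwDl.
have c1 n : c n <= (2 ^ n.+1)%:R^-1.
  by rewrite ler_pdivrMr ?ltr_pwDl// ler_peMr ?invr_ge0 ?ler0n// lerDl.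
pose u n x : \bar R := (c n * \1_(base_ball n) x)%:E.
have mu_ n : measurable_fun setT (u n).
  apply/measurable_EFinP; apply: measurable_funM => //.
  by apply: measurable_indic; exact: measurable_base_ball.
have u0 n x : (0 <= u n x)%E by rewrite lee_fin mulr_ge0// ltW.
pose g x := (\sum_(n <oo) u n x)%E.
have g0 x : (0 <= g x)%E by apply: nneseries_ge0 => n _ _.
have geo : (\sum_(n <oo) (2 ^ n.+1)%:R^-1%:E <= 1%:E :> \bar R)%E.
  have := @epsilon_trick0 R 1 xpredT ler01.
  by under eq_eseriesr do rewrite div1r.
have g1 x : (g x <= 1)%E.
  apply: le_trans geo; apply: lee_nneseries => n _ //.
  rewrite lee_fin; apply: le_trans (c1 n).
  by rewrite ler_piMr ?(ltW (c0 n))// indicE; case: (_ \in _).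
have gfin x : g x \is a fin_num by rewrite ge0_fin_numE// (le_lt_trans (g1 x)) ?ltry.
have mg : measurable_fun setT g by apply: ge0_emeasurable_sum => // n x _ _.
have gE x : (fine (g x))%:E = g x by rewrite fineK.
have gge n x : base_ball n x -> c n <= fine (g x).
  move=> Bx; rewrite -lee_fin gE; apply: le_trans (_ : (u n x <= _)%E).
    by rewrite /u indicE mem_set// mulr1.
  rewrite /g; apply: le_trans (nneseries_lim_ge n.+1 _); last by move=> *; exact: u0.
  by rewrite big_nat_recr//= leeDr// sume_ge0.
exists (fine \o g); split.
- exact: measurableT_comp.
- move=> x; have [n /(_ x)] := qball_sub_base_ball x 1.
  have xx : qball d x 1 x.
    by rewrite /qball/=; have /(_ x x)[_ ->] := quasi_metric_eq0 (homogeneous_quasi_metric hX).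
  by move=> /(_ xx) /gge; apply: lt_le_trans.
- under eq_integral do rewrite /= gE.
  rewrite /g integral_nneseries//; apply: le_trans geo.
  apply: lee_nneseries => n _; first by move=> *; apply: integral_ge0.
  rewrite /u; under eq_integral do rewrite EFinM.
  rewrite ge0_integralZl_EFin ?(ltW (c0 n))//; last first.
    by apply/measurable_EFinP; apply: measurable_indic; exact: measurable_base_ball.
  rewrite integral_indic ?setIT//; last exact: measurable_base_ball.
  rewrite bE -EFinM lee_fin /c mulrAC ler_pdivrMr ?ltr_pwDl//.
  by rewrite ler_wpM2l ?invr_ge0 ?ler0n// lerDr.
- move=> x r; have [n Bn] := qball_sub_base_ball x r.
  by exists (c n) => // y /Bn /gge.
Qed.

End HomogeneousGeometry.

(** * Extended-real averages, and their behaviour under scaling and restriction *)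

Section Averages.
Context {disp : measure_display} {R : realType} {X : measurableType disp}.
Variable mu : {measure set X -> \bar R}.

Lemma average_EFin (b : R) (A : set X) (u : X -> R) (m : R) :
  0 < b -> mu A = m%:E -> 0 < m -> (forall x, 0 < u x) ->
  average mu (b%:E^-1)%E A (EFin \o u) =
  ((m^-1%:E * \int[mu]_(x in A) (u x `^ b^-1)%:E) `^ b)%E.
Proof.
move=> b0 Am m0 u0.
have -> : (b%:E^-1 = (b^-1)%:E)%E by rewrite inver (gt_eqF b0).
have -> : (m^-1%:E = (mu A)^-1)%E by rewrite Am inver (gt_eqF m0).
rewrite /average invrK.
by under eq_integral => x _ do rewrite gee0_abs ?lee_fin ?(ltW (u0 _))// poweR_EFin.
Qed.

Lemma average_ess_sup (A : set X) (u : X -> R) :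
  average mu (0%:E^-1)%E A (EFin \o u) = ess_sup mu ((fun x => `|(u x)%:E|%E) \_ A).
Proof. by rewrite inve0. Qed.

Lemma average_leP (b : R) (A : set X) (u : X -> R) (m B : R) :
  0 <= b -> mu A = m%:E -> 0 < m -> (forall x, 0 < u x) -> 0 <= B ->
  mean_le mu b A u B <-> (average mu (b%:E^-1) A (EFin \o u) <= B%:E)%E.
Proof.
move=> b0 Am m0 u0 B0; rewrite /mean_le; case: eqVneq => [->|bn].
  rewrite average_ess_sup; split=> [h|/ess_supP].
    apply/ess_supP; apply: filterS h => x h; rewrite patchE.
    by case: ifPn => [|_]; rewrite ?inE ?lee_fin// => /h; rewrite ger0_norm// ltW.
  apply: filterS => x + Ax; rewrite patchE mem_set//= lee_fin.
  exact: le_trans (ler_norm _).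
have bp : 0 < b by rewrite lt_neqAle eq_sym bn.
have I0 : (0 <= \int[mu]_(x in A) (u x `^ b^-1)%:E)%E.
  by apply: integral_ge0 => x _; rewrite lee_fin powR_ge0.
rewrite (average_EFin bp Am m0 u0) Am.
have -> : (\int[mu]_(x in A) (u x `^ b^-1)%:E <= (B `^ b^-1)%:E * m%:E)%E =
    (m^-1%:E * \int[mu]_(x in A) (u x `^ b^-1)%:E <= (B `^ b^-1)%:E)%E.
  by rewrite -lee_pdivrMr// muleC.
split=> h.
  have := le_poweR (ltW bp) _ h; rewrite poweR_EFin -powRrM mulVf ?gt_eqF// powRr1//.
  by apply; rewrite mule_ge0// lee_fin invr_ge0 ltW.
have := le_poweR (_ : 0 <= b^-1) (poweR_ge0 _ _) h; rewrite invr_ge0 ltW// => /(_ isT).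
rewrite -poweRrM mulfV ?gt_eqF// poweRe1//.
by rewrite mule_ge0// lee_fin invr_ge0 ltW.
Qed.

Lemma average_gt0 (b : R) (A : set X) (u : X -> R) (m : R) :
  0 <= b -> measurable A -> mu A = m%:E -> 0 < m -> measurable_fun setT u ->
  (forall x, 0 < u x) -> (0 < average mu (b%:E^-1) A (EFin \o u))%E.
Proof.
move=> b0 mA Am m0 mu_ u0.
move: b0; rewrite le_eqVlt => /predU1P[<-|b0].
  rewrite average_ess_sup ltNge; apply/negP => /ess_supP h.
  have : (mu A <= 0)%E; last by rewrite Am lee_fin leNgt m0.
  have [Z [mZ Z0 AZ]] := h; rewrite -Z0; apply: le_measure; rewrite ?inE// => x Ax.
  by apply: AZ => /=; rewrite patchE mem_set//= lee_fin ger0_norm ?(ltW (u0 _))// leNgt u0.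
rewrite (average_EFin b0 Am m0 u0); apply: poweR_gt0.
rewrite mule_gt0 ?lte_fin ?invr_gt0//; apply: integral_gt0 => //; first by rewrite Am.
  by apply: measurable_funTS; apply: measurable_powR_comp.
by move=> x _; exact: powR_gt0.
Qed.

Lemma mean_le_scale (b : R) (A : set X) (u u' : X -> R) (c B : R) :
  0 <= b -> measurable A -> 0 < c -> 0 <= B -> measurable_fun setT u ->
  measurable_fun setT u' -> (forall x, 0 < u x) -> (forall x, 0 < u' x) ->
  (forall x, A x -> u' x <= c * u x) -> mean_le mu b A u B -> mean_le mu b A u' (c * B).
Proof.
move=> b0 mA c0 B0 mu_ mu' u0 u0' ule; rewrite /mean_le; case: eqVneq => [_|bn].
  by apply: filterS => x h Ax; apply: le_trans (ule _ Ax) _; rewrite ler_pM2l// h.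
have mp (f : X -> R) : measurable_fun setT f ->
    measurable_fun A (fun x => (f x `^ b^-1)%:E).
  move=> mf; apply/measurable_EFinP/measurable_funTS.
  by apply: measurable_powR_comp.
move=> h; rewrite powRM ?(ltW c0)// EFinM -muleA.
apply: le_trans (lee_wpmul2l _ h); last by rewrite lee_fin powR_ge0.
rewrite -ge0_integralZl_EFin ?powR_ge0//; last 2 first.
- by move=> x _; rewrite lee_fin powR_ge0.
- exact: mp.
apply: ge0_le_integral => //.
- by move=> x _; rewrite lee_fin powR_ge0.
- exact: mp.
- by apply: measurable_funeM; exact: mp.
move=> x Ax; rewrite -EFinM lee_fin -powRM ?(ltW c0) ?(ltW (u0 _))//.
have bV : 0 <= b^-1 by rewrite invr_ge0.
by apply: ge0_ler_powR => //; rewrite ?nnegrE ?mulr_ge0 ?(ltW c0) ?(ltW (u0 _)) ?(ltW (u0' _))// ule.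
Qed.

Lemma mean_le_subset (b : R) (A E : set X) (u : X -> R) (m e B : R) :
  0 <= b -> measurable A -> measurable E -> E `<=` A -> mu A = m%:E -> mu E = e%:E ->
  0 < m -> 0 < e -> 0 <= B -> measurable_fun setT u ->
  mean_le mu b A u B -> mean_le mu b E u (B * (m / e) `^ b).
Proof.
move=> b0 mA mE EA Am Ee m0 e0 B0 mu_; rewrite /mean_le; case: eqVneq => [->|bn].
  by rewrite powRr0 mulr1; apply: filterS => x h /EA; exact: h.
move=> h; apply: le_trans (_ : (_ <= \int[mu]_(x in A) (u x `^ b^-1)%:E)%E) _.
  apply: ge0_subset_integral => //.
  - apply/measurable_EFinP/measurable_funTS.
    by apply: measurable_powR_comp.
  - by move=> x _; rewrite lee_fin powR_ge0.
apply: le_trans h _; rewrite Am Ee -!EFinM lee_fin powRM ?powR_ge0//.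
rewrite -powRrM mulfV// powRr1 ?divr_ge0 ?(ltW m0) ?(ltW e0)//.
by rewrite mulrA divfK ?gt_eqF.
Qed.

(** Hölder's inequality for [1 = \prod_o u o]. The indices with [beta o = 0] are taken out first:
    their product is at most [P0] almost everywhere, so that the product of the others is at least
    [1 / P0]. *)
Lemma mean_le_prod_ge1 (I : finType) (beta : I -> R) (E : set X) (e : R)
    (u : I -> X -> R) (B : I -> R) :
  (forall o, 0 <= beta o) -> 0 < \sum_o beta o -> measurable E -> mu E = e%:E -> 0 < e ->
  (forall o, measurable_fun setT (u o)) -> (forall o x, 0 < u o x) ->
  (forall x, \prod_o u o x = 1) -> (forall o, 0 < B o) ->
  (forall o, mean_le mu (beta o) E (u o) (B o)) -> 1 <= \prod_o B o.
Proof.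
move=> b0 s0 mE Ee e0 mu_ u0 u1 B0 uB; set s := \sum_o beta o in s0.
have sV : 0 < s^-1 by rewrite invr_gt0.
pose a o := beta o / s.
pose f o x := if beta o == 0 then 1 else u o x `^ (beta o)^-1.
pose c o := if beta o == 0 then e else B o `^ (beta o)^-1 * e.
have mf o : measurable_fun setT (f o).
  rewrite /f; case: (beta o == 0); first exact: measurable_cst.
  by apply: measurable_powR_comp.
have c0 o : 0 < c o by rewrite /c; case: ifP => // _; rewrite mulr_gt0 ?powR_gt0.
have a1 : \sum_o a o = 1 by rewrite -mulr_suml divff// gt_eqF.
have := @integral_prod_powR_le _ _ _ mu _ E a f c mE _ a1 _ mf c0 _.
pose P0 := \prod_(o | beta o == 0) B o; pose P1 := \prod_(o | beta o != 0) B o.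
have P00 : 0 < P0 by exact: prodr_gt0.
have P10 : 0 < P1 by exact: prodr_gt0.
have BP : \prod_o B o = P0 * P1 by rewrite (bigID (fun o => beta o == 0)).
have fE x : \prod_o f o x `^ a o = (\prod_(o | beta o != 0) u o x) `^ s^-1.
  rewrite powR_prod; last by move=> o; rewrite ltW.
  rewrite [RHS]big_mkcond; apply: eq_bigr => o _; rewrite /f /a.
  case: eqVneq => [_|bn] /=; first by rewrite powR1.
  by rewrite -powRrM mulrA mulVf// mul1r.
have cE : \prod_o c o `^ a o = P1 `^ s^-1 * e.
  rewrite powR_prod; last by move=> o; rewrite ltW.
  have eE : e = \prod_o e `^ a o by rewrite -powR_sum// a1 powRr1// ltW.
  rewrite [X in _ = _ * X]eE [X in _ = X * _]big_mkcond -big_split/=.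
  apply: eq_bigr => o _; rewrite /c /a; case: eqVneq => [->|bn] /=.
    by rewrite mul1r.
  by rewrite powRM ?powR_ge0 ?(ltW e0)// -(powRrM (B o)) mulrA mulVf// mul1r.
rewrite cE => h.
have {}h : (\int[mu]_(x in E) ((\prod_(o | beta o != 0) u o x) `^ s^-1)%:E <=
    (P1 `^ s^-1 * e)%:E)%E.
  under eq_integral do rewrite -fE.
  apply: h => o.
  - by rewrite divr_ge0// ltW.
  - by move=> x; rewrite /f; case: ifP => // _; exact: powR_ge0.
  - rewrite /f /c; have := uB o; rewrite /mean_le; case: eqVneq => _.
      by move=> _; rewrite integral_cst// mul1e Ee.
    by rewrite Ee.
have : ((P0 `^ (- s^-1) * e)%:E <= (P1 `^ s^-1 * e)%:E)%E.
  apply: le_trans h; rewrite EFinM -Ee -integral_cst//.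
  apply: ae_ge0_le_integral => //.
  - by move=> x _; rewrite lee_fin powR_ge0.
  - by move=> x _; rewrite lee_fin powR_ge0.
  - apply/measurable_EFinP/measurable_funTS.
    apply: measurable_powR_comp => //.
    rewrite (_ : (fun x => _) = fun x => \prod_o if beta o != 0 then u o x else 1).
      by apply: measurable_prod => o _; case: (beta o != 0).
    by apply/funext => x; rewrite big_mkcond.
  have : {ae mu, forall x, forall o, E x -> beta o == 0 -> u o x <= B o}.
    apply: filter_forall => o; have := uB o; rewrite /mean_le; case: eqVneq => [_|_ _].
      by apply: filterS => x hx Ex _; exact: hx.
    by apply: nearW => x.
  apply: filterS => x hx Ex; rewrite lee_fin.
  have Up0 : 0 < \prod_(o | beta o != 0) u o x by exact: prodr_gt0.
  have U1 : (\prod_(o | beta o == 0) u o x) * \prod_(o | beta o != 0) u o x = 1.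
    by have := u1 x; rewrite (bigID (fun o => beta o == 0)).
  have U0 : \prod_(o | beta o == 0) u o x <= P0.
    by apply: ler_prod => o b; rewrite ltW//= hx.
  rewrite powRN -powRV ?(ltW P00)//; apply: ge0_ler_powR; rewrite ?(ltW sV)// ?nnegrE.
  - by rewrite invr_ge0 ltW.
  - exact: ltW.
  - by rewrite -[leLHS]mulr1 ler_pdivrMl// -{1}U1 ler_wpM2r// ltW.
rewrite lee_fin ler_pM2r// => h1.
have := ge0_ler_powR (ltW s0) _ _ h1; rewrite !nnegrE !powR_ge0 => /(_ isT isT).
rewrite -!powRrM mulNr mulVf ?gt_eqF// powRr1 ?(ltW P10)// powR_inv1 ?(ltW P00)//.
by rewrite BP -[X in X <= _ -> _]mulr1 ler_pdivrMl.
Qed.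

End Averages.

(** * The weight constant and its tuning to a prescribed value *)

Section ClassConstant.
Context {disp : measure_display} {R : realType} {X : measurableType disp}.
Variable mu : {measure set X -> \bar R}.

Lemma lee_prod_ge0 (I : finType) (a b : I -> \bar R) :
  (forall i, 0 <= a i)%E -> (forall i, a i <= b i)%E ->
  (\prod_i a i <= \prod_i b i)%E.
Proof.
move=> a0 ab; suff: (0 <= \prod_i a i <= \prod_i b i)%E by case/andP.
elim/big_rec2: _ => [|i y x _ /andP[x0 xy]]; first by rewrite lee01 lexx.
by rewrite mule_ge0//= lee_pmul.
Qed.

Lemma prode_gt0_fin (I : finType) (a : I -> \bar R) :
  (forall i, 0 < a i)%E -> (\prod_i a i < +oo)%E -> forall i, a i \is a fin_num.
Proof.
move=> a0 h i; rewrite ge0_fin_numE ?ltW//; move: h; rewrite (bigD1 i)//=.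
have p0 : (0 < \prod_(j | j != i) a j)%E.
  by elim/big_rec: _ => [|j x _ x0]; [rewrite lte01|rewrite mule_gt0].
have := a0 i; case: (a i) => [x _ _| _|//]; first exact: ltry.
by rewrite gt0_mulye.
Qed.

Lemma ae_positive_measure_ex (A : set X) (P : X -> Prop) :
  measurable A -> (0 < mu A)%E -> {ae mu, forall x, A x -> P x} -> exists2 x, A x & P x.
Proof.
move=> mA A0 [Z [mZ Z0 AZ]]; apply: contrapT => nP.
suff : (mu A <= 0)%E by rewrite leNgt A0.
rewrite -Z0; apply: le_measure; rewrite ?inE// => x Ax; apply: AZ => /= h.
by apply: nP; exists x => //; exact: h.
Qed.

(** On an atom every set where [u < t] is null or of full measure. The levels of the first kind form
    a down-set [T], and [u] equals its supremum almost everywhere. *)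
Lemma atom_ae_const (A : set X) (u : X -> R) :
  measurable A -> (0 < mu A)%E -> measurable_fun setT u -> (forall x, 0 < u x) ->
  (forall E, measurable E -> E `<=` A -> mu E = 0%E \/ mu (A `\` E) = 0%E) ->
  exists2 c, 0 < c & {ae mu, forall x, A x -> u x = c}.
Proof.
move=> mA A0 mu_ u0 atom.
pose lower t := A `&` (u @^-1` `]-oo, t[).
have mlower t : measurable (lower t).
  by apply: measurableI => //; rewrite -[X in measurable X]setTI; exact: mu_.
have null_ae E P : measurable E -> mu E = 0%E -> (forall x, A x -> ~ E x -> P x) ->
    {ae mu, forall x, A x -> P x}.
  move=> mE E0 h; exists E; split => // x /= /not_implyP[Ax nP].
  by apply: contrapT => nE; apply: nP; exact: h.
pose T := [set t | mu (lower t) = 0%E].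
have T_ae t : T t -> {ae mu, forall x, A x -> t <= u x}.
  move=> Tt; apply: null_ae (mlower t) Tt _ => x Ax nl.
  by rewrite leNgt; apply/negP => h; apply: nl; split => //=; rewrite in_itv.
have nT_ae t : ~ T t -> {ae mu, forall x, A x -> u x < t}.
  move=> nT; have [//|h] := atom _ (mlower t) (@subIsetl _ _ _).
  apply: null_ae h _ => [|x Ax nl]; first exact: measurableD.
  apply: contrapT => h'; apply: nl; split => // -[_ /=]; rewrite in_itv/= => k.
  exact: h'.
have T0 : T 0.
  rewrite /T/= (_ : lower 0 = set0) ?measure0//.
  by rewrite -subset0 => x [_ /=]; rewrite in_itv/= ltNge ltW.
(* Otherwise [u] would be above every natural number at some point of [A]. *)
have Tub : exists n : nat, ~ T n%:R.
  apply: contrapT => /forallNP h.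
  have : {ae mu, forall x, forall n : nat, A x -> n%:R <= u x}.
    apply: ae_foralln => n; apply: T_ae; apply: contrapT; exact: h.
  move=> hh; have [|x Ax] := ae_positive_measure_ex mA A0 (P := fun x => forall n : nat, n%:R <= u x).
    by apply: filterS hh => x hx Ax n; exact: hx.
  move=> /(_ (Num.truncn (u x)).+1); rewrite leNgt => /negP; apply.
  by rewrite truncnS_gt.
have [n0 nT0] := Tub.
have Tdown t t' : t <= t' -> T t' -> T t.
  move=> tt Tt'; apply/eqP; rewrite eq_le measure_ge0 andbT -Tt'.
  apply: le_measure; rewrite ?inE// => x [Ax /=]; rewrite in_itv/= => h.
  by split => //=; rewrite in_itv/= (lt_le_trans h).
have hs : has_sup T.
  split; first by exists 0.
  exists n0%:R => t Tt; rewrite leNgt; apply/negP => h; apply: nT0.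
  exact: Tdown (ltW h) Tt.
pose c := sup T.
have ae1 : {ae mu, forall x, forall n : nat, A x -> c - n.+1%:R^-1 <= u x}.
  apply: ae_foralln => n; apply: T_ae.
  have [|t Tt ht] := @sup_adherent _ T n.+1%:R^-1 _ hs; first by rewrite invr_gt0.
  exact: Tdown (ltW ht) Tt.
have ae2 : {ae mu, forall x, forall n : nat, A x -> u x < c + n.+1%:R^-1}.
  apply: ae_foralln => n; apply: nT_ae => Tt.
  have := ub_le_sup hs.2 Tt; rewrite -/c leNgt ltrDl invr_gt0 ltr0n//.
have aec : {ae mu, forall x, A x -> u x = c}.
  apply: filterS2 ae1 ae2 => x h1 h2 Ax; apply/eqP; rewrite eq_le; apply/andP; split.
    apply/ler_addgt0Pr => e e0; have [n ne] := ltr_add_invr e0.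
    apply: le_trans (ltW (h2 n Ax)) _; rewrite lerD2l.
    by move: ne; rewrite add0r => /ltW.
  apply/ler_addgt0Pr => e e0; have [n ne] := ltr_add_invr e0.
  rewrite -lerBlDr; apply: le_trans (h1 n Ax); rewrite lerB//.
  by move: ne; rewrite add0r => /ltW.
exists c => //.
have [x Ax <-] := ae_positive_measure_ex mA A0 aec; exact: u0.
Qed.

Variables (Q : nat -> set X) (mQ : forall k, measurable (Q k)).
Variables (m : nat -> R) (Qm : forall k, mu (Q k) = (m k)%:E) (m0 : forall k, 0 < m k).
Variables (J : finType) (beta : option J -> R).
Hypotheses (b0 : forall o, 0 <= beta o) (bs : 0 < \sum_o beta o).

Definition class_const (W : J -> X -> R) : \bar R :=
  ereal_sup (range (fun k =>
    (\prod_o average mu ((beta o)%:E^-1) (Q k) (EFin \o dual_tuple W o))%E)).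

Section OneWeight.
Variable W : J -> X -> R.
Hypotheses (mW : forall j, measurable_fun setT (W j)) (W0 : forall j x, 0 < W j x).

Lemma measurable_dual_tuple o : measurable_fun setT (dual_tuple W o).
Proof.
case: o => [j|]; last by apply: measurable_prod => j _; exact: mW.
rewrite (_ : dual_tuple _ _ = fun x => W j x `^ (-1)).
  by apply: measurable_powR_comp.
by apply/funext => x; rewrite powR_inv1// ltW.
Qed.

Lemma dual_tuple_gt0 o x : 0 < dual_tuple W o x.
Proof. by case: o => [j|] /=; [rewrite invr_gt0|apply: prodr_gt0]. Qed.

Lemma class_leP K : class_le mu Q beta W K <-> (class_const W <= K%:E)%E.
Proof.
have mD := measurable_dual_tuple; have D0 := dual_tuple_gt0.
split=> [h|h k].
  apply: ge_ereal_sup => _ [k _ <-]; have [B [B0 BK hB]] := h k.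
  apply: le_trans (_ : (_ <= \prod_o (B o)%:E)%E) _.
    apply: lee_prod_ge0 => o.
      by apply/ltW/(average_gt0 (b0 o) (mQ k) (Qm k) (m0 k) (mD o)).
    by apply/(average_leP (b0 o) (Qm k) (m0 k)) => //; exact: ltW.
  by rewrite prodEFin lee_fin.
have a0 o : (0 < average mu ((beta o)%:E^-1) (Q k) (EFin \o dual_tuple W o))%E.
  exact: (average_gt0 (b0 o) (mQ k) (Qm k) (m0 k) (mD o)).
have aK : (\prod_o average mu ((beta o)%:E^-1) (Q k) (EFin \o dual_tuple W o) <= K%:E)%E.
  by apply: le_trans h; apply: ereal_sup_ubound; exists k.
have af := prode_gt0_fin a0 (le_lt_trans aK (ltry K)).
exists (fun o => fine (average mu ((beta o)%:E^-1) (Q k) (EFin \o dual_tuple W o))).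
split.
- by move=> o; rewrite fine_gt0// a0 -ge0_fin_numE ?ltW//=.
- rewrite -lee_fin -prodEFin; under eq_bigr do rewrite fineK//.
  exact: aK.
- move=> o; apply/(average_leP (b0 o) (Qm k) (m0 k)) => //; last by rewrite fineK.
  by rewrite fine_ge0// ltW.
Qed.

Lemma class_const_ge1 : (1 <= class_const W)%E.
Proof.
rewrite leNgt; apply/negP => h.
have := @class_leP 1; case=> _ /(_ (ltW h)) cl.
have [K K1 hK] : exists2 K, K < 1 & (class_const W <= K%:E)%E.
  move: h; case: class_const => [c|//|].
    by rewrite lte_fin => c1; exists c.
  by move=> _; exists 0; [exact: ltr01|exact: leNye].
have [B [B0 BK hB]] := (@class_leP K).2 hK 0%N.
have D1 x : \prod_o dual_tuple W o x = 1 by exact: dual_tuple_prod.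
have := mean_le_prod_ge1 b0 bs (mQ 0) (Qm 0) (m0 0) measurable_dual_tuple dual_tuple_gt0 D1 B0 hB.
by rewrite leNgt (le_lt_trans BK).
Qed.

Lemma class_const_atoms :
  (forall k E, measurable E -> E `<=` Q k -> mu E = 0%E \/ mu (Q k `\` E) = 0%E) ->
  class_const W = 1%E.
Proof.
move=> atom; apply/eqP; rewrite eq_le class_const_ge1 andbT.
apply/class_leP => k.
have Q0 : (0 < mu (Q k))%E by rewrite Qm lte_fin.
have /choice[B hB] : forall o, exists c, 0 < c /\ {ae mu, forall x, Q k x -> dual_tuple W o x = c}.
  move=> o; have [|c c0 hc] := atom_ae_const (mQ k) Q0 (measurable_dual_tuple o) (dual_tuple_gt0 o).
    exact: atom.
  by exists c.
exists B; split.
- by move=> o; have [] := hB o.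
- have : {ae mu, forall x, forall o, Q k x -> dual_tuple W o x = B o}.
    by apply: filter_forall => o; have [] := hB o.
  move=> hh; have [|x Qx hx] := ae_positive_measure_ex (mQ k) Q0
      (P := fun x => forall o, dual_tuple W o x = B o).
    by apply: filterS hh => x hx Qx o; exact: hx.
  rewrite -(eq_bigr _ (fun o _ => hx o)) dual_tuple_prod// => j; exact: W0.
- move=> o; have [Bo hBo] := hB o; rewrite /mean_le; case: eqVneq => _.
    by apply: filterS hBo => x h /h ->.
  rewrite (ae_eq_integral (cst (B o `^ (beta o)^-1)%:E))//.
  + by rewrite integral_cst.
  + apply/measurable_EFinP/measurable_funTS.
    apply: measurable_powR_comp => //.
    exact: measurable_dual_tuple.
  + by apply: filterS hBo => x h /h ->.
Qed.

End OneWeight.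

(** One factor [c] for each entry of the dual tuple, the product weight included. Along the tilt
    this yields a Lipschitz bound for the logarithm of the constant. *)
Lemma class_const_scale (W W' : J -> X -> R) (c : R) :
  (forall j, measurable_fun setT (W j)) -> (forall j x, 0 < W j x) ->
  (forall j, measurable_fun setT (W' j)) -> (forall j x, 0 < W' j x) ->
  0 < c -> (forall o x, dual_tuple W' o x <= c * dual_tuple W o x) ->
  forall K, (class_const W <= K%:E)%E -> (class_const W' <= (c ^+ #|{: option J}| * K)%:E)%E.
Proof.
move=> mW W0 mW' W0' c0 h K /class_leP cl; apply/class_leP => // k.
have [B [B0 BK hB]] := cl mW W0 k; exists (fun o => c * B o); split.
- by move=> o; rewrite mulr_gt0.
- by rewrite big_split/= prodr_const ler_pM2l// exprn_gt0.
- move=> o; apply: (mean_le_scale (b0 o) (mQ k) c0 (ltW (B0 o)) (measurable_dual_tuple mW W0 o)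
    (measurable_dual_tuple mW' W0' o) (dual_tuple_gt0 W0 o) (dual_tuple_gt0 W0' o) _ (hB o)).
  by move=> x _; exact: h.
Qed.

(* The constant of the tilted weights varies continuously, and it becomes large because [E] and
   its complement in the cube both have positive measure. *)
Section Tilt.
Variables (E : set X) (k0 : nat) (e e' : R) (j0 : J).
Hypotheses (mE : measurable E) (EQ : E `<=` Q k0).
Hypotheses (Ee : mu E = e%:E) (e0 : 0 < e) (Fe : mu (Q k0 `\` E) = e'%:E) (e'0 : 0 < e').
Variables (W : J -> X -> R) (K : R).
Hypotheses (mW : forall j, measurable_fun setT (W j)) (W0 : forall j x, 0 < W j x).
Hypothesis WK : (class_const W <= K%:E)%E.

(** The sign is such that for [0 <= s] the tilted weight stays below [W], so that upper bounds and
    local integrability persist. *)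
Definition tilt (s : R) (j : J) (x : X) : R :=
  if j == j0 then W j x * expR (- s * \1_E x) else W j x.

Lemma measurable_tilt s j : measurable_fun setT (tilt s j).
Proof.
rewrite /tilt; case: (j == j0) => //; apply: measurable_funM => //.
apply: (@measurableT_comp _ _ _ _ _ _ expR) => //.
by apply: measurable_funM => //; exact: measurable_indic.
Qed.

Lemma tilt_gt0 s j x : 0 < tilt s j x.
Proof. by rewrite /tilt; case: ifP => _; rewrite ?mulr_gt0 ?expR_gt0. Qed.

Lemma tilt0 : tilt 0 = W.
Proof.
apply/funext => j; apply/funext => x; rewrite /tilt; case: ifP => // _.
by rewrite oppr0 mul0r expR0 mulr1.
Qed.

Lemma prod_tilt s x : \prod_j tilt s j x = expR (- s * \1_E x) * \prod_j W j x.
Proof.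
rewrite (bigD1 j0)//= [in RHS](bigD1 j0)//= mulrA /tilt eqxx [expR _ * _]mulrC.
by congr (_ * _); apply: eq_bigr => j /negbTE ->.
Qed.

Lemma dual_tilt s o x : dual_tuple (tilt s) o x =
  dual_tuple W o x * (if o is Some j then if j == j0 then expR (s * \1_E x) else 1
                      else expR (- s * \1_E x)).
Proof.
case: o => [j|] /=; last by rewrite prod_tilt mulrC.
rewrite /tilt; case: ifP => _; rewrite ?mulr1// invfM; congr (_ * _).
by rewrite -expRN mulNr opprK.
Qed.

Lemma dual_tilt_le s t o x :
  dual_tuple (tilt t) o x <= expR `|s - t| * dual_tuple (tilt s) o x.
Proof.
rewrite !dual_tilt mulrCA; apply: ler_wpM2l; first exact: ltW (dual_tuple_gt0 W0 _ _).
have h a b : a - b <= `|s - t| -> expR a <= expR `|s - t| * expR b.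
  by move=> ab; rewrite -expRD ler_expR -lerBlDr.
have i01 : 0 <= (\1_E x : R) <= 1 by rewrite indicE; case: (_ \in _); rewrite /= ?lexx ?ler01.
have [i0 i1] := andP i01.
case: o => [j|]; [case: ifP => _|].
- apply: h; rewrite -mulrBl; apply: le_trans (_ : `|s - t| * \1_E x <= _).
    by rewrite ler_wpM2r// distrC ler_norm.
  by rewrite ler_piMr.
- by rewrite mulr1 -[leLHS]expR0 ler_expR.
- apply: h; rewrite -mulrBl opprK addrC; apply: le_trans (_ : `|s - t| * \1_E x <= _).
    by rewrite ler_wpM2r// ler_norm.
  by rewrite ler_piMr.
Qed.

Let f s := fine (class_const (tilt s)).

Lemma class_const_tilt s : class_const (tilt s) = (f s)%:E.
Proof.
rewrite fineK//.
have := class_const_ge1 (measurable_tilt s) (tilt_gt0 s).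
have := class_const_scale (measurable_tilt 0) (tilt_gt0 0) (measurable_tilt s) (tilt_gt0 s)
  (expR_gt0 `|0 - s|) (dual_tilt_le 0 s); rewrite {1}tilt0 => /(_ K WK).
by case: class_const.
Qed.

Lemma tilt_ge1 s : 1 <= f s.
Proof.
by rewrite -lee_fin -class_const_tilt (class_const_ge1 (measurable_tilt s) (tilt_gt0 s)).
Qed.

Lemma continuous_ln_tilt : continuous (fun s => ln (f s)).
Proof.
pose n := #|{: option J}|.
have half s t : ln (f t) <= `|s - t| * n%:R + ln (f s).
  have := class_const_scale (measurable_tilt s) (tilt_gt0 s) (measurable_tilt t) (tilt_gt0 t)
    (expR_gt0 `|s - t|) (dual_tilt_le s t).
  rewrite !class_const_tilt => /(_ (f s) (lexx _)); rewrite lee_fin => h.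
  have fp u : 0 < f u by exact: lt_le_trans (tilt_ge1 u).
  rewrite -ler_expR lnK ?posrE// expRD (lnK (_ : f s \in Num.pos)) ?posrE//.
  by rewrite -expRM_natr in h *.
move=> s; apply/cvgrPdist_le => eps eps0.
near=> t.
have nt : `|s - t| * n%:R <= eps.
  have : `|s - t| <= eps / (n%:R + 1).
    by near: t; apply: (@cvgr_dist_le _ _ _ _ _ id s) => //; rewrite divr_gt0.
  rewrite ler_pdivlMr// mulrDr mulr1 => h; apply: le_trans h.
  by rewrite lerDl.
rewrite /= ler_distl; apply/andP; split.
  by have := half s t; rewrite lerBlDr => h; apply: le_trans h _; rewrite addrC lerD2l.
by have := half t s; rewrite distrC => h; apply: le_trans h _; rewrite addrC lerD2l.
Unshelve. all: by end_near.
Qed.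

(** The exponential of this number is [K ^+ 2 * rho], where [rho] is the loss in passing from
    averages over the cube to averages over [E] and over its complement. *)
Definition tilt_range : R := let b := \sum_o beta o in
  ln (K ^+ 2 * ((m k0 / e) `^ b * (m k0 / e') `^ b)).

(** On [E] the bounds of the tilted single weights are combined with that of the untilted product
    weight, on the complement the other way round. Each combination has product at least 1 by
    Hölder's inequality, and together they give [1 <= rho * expR (- s) * K * f s]. *)
Lemma tilt_large : 0 <= tilt_range /\ K <= f tilt_range.
Proof.
have D0 := dual_tuple_gt0 W0; have mD := measurable_dual_tuple mW W0.
have D1 x : \prod_o dual_tuple W o x = 1 by exact: dual_tuple_prod.
have K1 : 1 <= K by rewrite -lee_fin (le_trans (class_const_ge1 mW W0)).
have mF : measurable (Q k0 `\` E) by exact: measurableD.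
pose b := \sum_o beta o.
pose rho := (m k0 / e) `^ b * (m k0 / e') `^ b.
have rho0 : 0 < rho by rewrite mulr_gt0// powR_gt0 ?divr_gt0.
have rho1 : 1 <= rho.
  have Qe (A : set X) a : measurable A -> A `<=` Q k0 -> mu A = a%:E -> 0 < a -> 1 <= (m k0 / a) `^ b.
    move=> mA AQ Aa a0; have b1 : 1 `^ b = 1 :> R by rewrite powR1.
    rewrite -[leLHS]b1; apply: ge0_ler_powR; rewrite ?nnegrE ?(ltW bs)//.
      by rewrite divr_ge0 ?ltW.
    by rewrite ler_pdivlMr// mul1r -lee_fin -Aa -Qm le_measure ?inE.
  rewrite -[leLHS]mulr1; apply: ler_pM; rewrite ?ler01//; [exact: (Qe E)|].
  by apply: (Qe (Q k0 `\` E)) => //; exact: subDsetl.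
have KK : 1 <= K ^+ 2 * rho.
  by rewrite -[leLHS]mulr1; apply: ler_pM; rewrite ?ler01// exprn_ege1.
have sE : tilt_range = ln (K ^+ 2 * rho) by [].
have es : expR tilt_range = K ^+ 2 * rho by rewrite sE lnK// posrE (lt_le_trans _ KK).
split; first by rewrite sE ln_ge0.
set s := tilt_range in es *; clearbody s.
have [B [B0 BK hB]] := (class_leP mW W0 K).2 WK k0.
have [b' [b'0 b'K hb]] : exists B : option J -> R, [/\ forall o, 0 < B o, \prod_o B o <= f s &
   forall o, mean_le mu (beta o) (Q k0) (dual_tuple (tilt s) o) (B o)].
  by have := (class_leP (measurable_tilt s) (tilt_gt0 s) (f s)).2; rewrite class_const_tilt; apply.
have mT := measurable_dual_tuple (measurable_tilt s) (tilt_gt0 s).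
have T0 := dual_tuple_gt0 (tilt_gt0 s).
have hBs A a o : measurable A -> A `<=` Q k0 -> mu A = a%:E -> 0 < a ->
    mean_le mu (beta o) A (dual_tuple W o) (B o * (m k0 / a) `^ beta o).
  move=> mA AQ Aa a0.
  exact: (mean_le_subset (b0 o) (mQ k0) mA AQ (Qm k0) Aa (m0 k0) a0 (ltW (B0 o)) (mD o) (hB o)).
have hbs A a o : measurable A -> A `<=` Q k0 -> mu A = a%:E -> 0 < a ->
    mean_le mu (beta o) A (dual_tuple (tilt s) o) (b' o * (m k0 / a) `^ beta o).
  move=> mA AQ Aa a0.
  exact: (mean_le_subset (b0 o) (mQ k0) mA AQ (Qm k0) Aa (m0 k0) a0 (ltW (b'0 o)) (mT o) (hb o)).
have pos a (y : R) o : 0 < a -> 0 < y -> 0 < y * (m k0 / a) `^ beta o.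
  by move=> a0 y0; rewrite mulr_gt0// powR_gt0// divr_gt0.
pose uE o := if o is Some j then if j == j0 then expR (- s) * b' (Some j) else b' (Some j) else B None.
pose uF o := if o is Some j then B (Some j) else b' None.
have uE0 o : 0 < uE o.
  by rewrite /uE; case: o => [j|]//; case: ifP => _ //; rewrite mulr_gt0 ?expR_gt0.
have uF0 o : 0 < uF o by rewrite /uF; case: o.
have hE : 1 <= \prod_o (uE o * (m k0 / e) `^ beta o).
  apply: (mean_le_prod_ge1 b0 bs mE Ee e0 mD D0 D1) => o; first exact: pos.
  rewrite /uE; case: o => [j|]; last exact: hBs.
  have := hbs E e (Some j) mE EQ Ee e0; case: ifP => jj; last first.
    rewrite (_ : dual_tuple (tilt s) _ = dual_tuple W (Some j))//; apply/funext => x.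
    by rewrite dual_tilt jj mulr1.
  rewrite -mulrA; apply: (mean_le_scale (b0 _) mE (expR_gt0 _) _ (mT _) (mD _) (T0 _) (D0 _)).
    by rewrite ltW// pos.
  move=> x Ex; rewrite dual_tilt jj indicE mem_set// mulr1 mulrCA -expRD addNr expR0 mulr1.
  exact: lexx.
have hF : 1 <= \prod_o (uF o * (m k0 / e') `^ beta o).
  apply: (mean_le_prod_ge1 b0 bs mF Fe e'0 mD D0 D1) => o; first exact: pos.
  have FQ : Q k0 `\` E `<=` Q k0 by exact: subDsetl.
  rewrite /uF; case: o => [j|]; first exact: hBs.
  rewrite -[b' None]mul1r -mulrA.
  have := hbs _ _ None mF FQ Fe e'0.
  apply: (mean_le_scale (b0 _) mF ltr01 _ (mT _) (mD _) (T0 _) (D0 _)).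
    by rewrite ltW// pos.
  move=> x [_ nEx]; rewrite dual_tilt indicE memNset// mulr0 expR0 mulr1 mul1r.
  exact: lexx.
have : 1 <= \prod_o (uE o * (m k0 / e) `^ beta o) * \prod_o (uF o * (m k0 / e') `^ beta o).
  by rewrite -[leLHS]mulr1; apply: ler_pM; rewrite ?ler01.
rewrite !big_split/= -!powR_sum ?divr_gt0//.
have -> : \prod_o uE o * (m k0 / e) `^ (\sum_o beta o) *
    (\prod_o uF o * (m k0 / e') `^ (\sum_o beta o)) = rho * (\prod_o uE o * \prod_o uF o).
  by rewrite /rho -/b; ring.
have -> : \prod_o uE o * \prod_o uF o = expR (- s) * (\prod_o B o * \prod_o b' o).
  rewrite !big_option/=.
  have -> : \prod_j (if j == j0 then expR (- s) * b' (Some j) else b' (Some j)) =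
      expR (- s) * \prod_j b' (Some j).
    rewrite (bigD1 j0)//= [in RHS](bigD1 j0)//= eqxx mulrA; congr (_ * _).
    by apply: eq_bigr => j /negbTE ->.
  by ring.
have P0 (u : option J -> R) : (forall o, 0 < u o) -> 0 < \prod_o u o by move=> h; exact: prodr_gt0.
move=> h1; have h2 : K ^+ 2 * rho <= rho * (\prod_o B o * \prod_o b' o).
  rewrite -es -[leLHS]mulr1 -ler_pdivlMl ?expR_gt0// -expRN mulrCA.
  exact: h1.
have K0 : 0 < K by exact: lt_le_trans K1.
have h3 : K ^+ 2 <= K * f s.
  rewrite -(ler_pM2l rho0) mulrC; apply: le_trans h2 _.
  by rewrite ler_pM2l//; apply: ler_pM => //; exact: ltW (P0 _ _).
by rewrite -(ler_pM2l K0) -expr2.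
Qed.

Lemma tilt_exact : exists W' : J -> X -> R, [/\ forall j, measurable_fun setT (W' j),
  forall j x, 0 < W' j x, forall j x, expR (- tilt_range) * W j x <= W' j x <= W j x &
  class_const W' = K%:E].
Proof.
have [s0 Ks] := tilt_large; set s := tilt_range in s0 Ks *; clearbody s.
have K0 : 0 < K.
  by rewrite -lte_fin; apply: lt_le_trans (le_trans (class_const_ge1 mW W0) WK).
have fp u : 0 < f u by exact: lt_le_trans (tilt_ge1 u).
have [||t] := @IVT _ (fun s => ln (f s)) 0 s (ln K) s0.
- exact/continuous_subspaceT/continuous_ln_tilt.
- rewrite /= ge_min le_max; apply/andP; split; apply/orP; [left|right].
    have f0K : f 0 <= K by rewrite -lee_fin -class_const_tilt tilt0.
    by rewrite ler_ln; [exact: f0K|rewrite posrE; exact: fp|rewrite posrE; exact: K0].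
  by rewrite ler_ln; [exact: Ks|rewrite posrE; exact: K0|rewrite posrE; exact: fp].
rewrite in_itv/= => /andP[t0 ts] ft.
exists (tilt t); split.
- exact: measurable_tilt.
- exact: tilt_gt0.
- move=> j x; rewrite /tilt.
  have i01 : 0 <= (\1_E x : R) <= 1 by rewrite indicE; case: (_ \in _); rewrite /= ?lexx ?ler01.
  have [i0 i1] := andP i01.
  have es1 : expR (- s) <= 1 by rewrite -[leRHS]expR0 ler_expR oppr_le0.
  case: ifP => _; last by rewrite lexx andbT ler_piMl// ltW.
  have Wx := W0 j x; rewrite mulrC ler_pM2l//; apply/andP; split.
    by rewrite ler_expR mulNr lerN2; apply: le_trans ts; rewrite ler_piMr.
  rewrite ler_piMr ?(ltW Wx)//.
  by rewrite -[leRHS]expR0 ler_expR mulNr oppr_le0 mulr_ge0.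
- by rewrite class_const_tilt; congr EFin; apply: ln_inj ft; rewrite posrE; [exact: fp|exact: K0].
Qed.

End Tilt.

(** Since [K1] and [c] precede [W], the function [C] will be evaluated at a single point and the
    loss is uniform in the weights. The upper bound by [W] serves the estimates of the [f_i], the
    lower one that of [g]. *)
Theorem tuning (j0 : J) (K : R) : exists K1 c : R, 0 < c /\ forall W : J -> X -> R,
  (forall j, measurable_fun setT (W j)) -> (forall j x, 0 < W j x) ->
  class_le mu Q beta W K ->
  exists W' : J -> X -> R, [/\ forall j, measurable_fun setT (W' j),
    forall j x, 0 < W' j x, forall j x, c * W j x <= W' j x <= W j x &
    class_const W' = K1%:E].
Proof.
have [atom|] := pselect (forall k E, measurable E -> E `<=` Q k ->
    mu E = 0%E \/ mu (Q k `\` E) = 0%E).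
  exists 1, 1; split => // W mW W0 _; exists W; split => // [j x|].
    by rewrite mul1r lexx.
  exact: class_const_atoms.
move=> /existsNP[k /existsNP[E /not_implyP[mE /not_implyP[EQ /not_orP[E0 F0]]]]].
have fin A : measurable A -> A `<=` Q k -> mu A <> 0%E -> exists2 a, mu A = a%:E & 0 < a.
  move=> mA AQ A0; have : (mu A <= (m k)%:E)%E by rewrite -Qm le_measure ?inE.
  have : (0 < mu A)%E by rewrite lt0e measure_ge0 andbT; exact/eqP.
  by case: (mu A) => // a a0 _; exists a.
have [e Ee e0] := fin _ mE EQ E0.
have [e' Fe e'0] := fin _ (measurableD (mQ k) mE) (@subDsetl _ _ _) F0.
exists K, (expR (- tilt_range k e e' K)); split; first exact: expR_gt0.
move=> W mW W0 /(class_leP mW W0) WK.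
exact: (tilt_exact j0 mE EQ Ee e0 Fe e'0 mW W0 WK).
Qed.

End ClassConstant.

(** * The new weights and the norm of [g] *)

Section NormEstimates.
Context {disp : measure_display} {R : realType} {X : measurableType disp}.
Variable mu : {measure set X -> \bar R}.

Definition lower_const (at_ bt L : R) : R :=
  if bt <= at_ then 1 else 2 * (2 * L) `^ ((1 - at_ / bt) / (at_ / bt)).

Lemma lower_const_gt0 at_ bt L : 0 < L -> 0 < lower_const at_ bt L.
Proof.
by move=> L0; rewrite /lower_const; case: ifP => // _; rewrite mulr_gt0// powR_gt0// mulr_gt0.
Qed.

(** Here [y] is the normalised [g v], and the last integrand belongs to [g] with the new weight. If
    [bt <= at_], the hypothesis [yH] gives a pointwise domination of [y^(1/bt)]. If [at_ < bt],
    Young's inequality bounds it by a multiple of the last integrand plus [H / (2 * L)], whose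
    integral is at most one half. *)
Lemma lower_estimate (at_ bt L B : R) (y H : X -> R) :
  0 < at_ -> 0 < bt -> 0 < L -> measurable_fun setT y -> (forall x, 0 <= y x) ->
  measurable_fun setT H -> (forall x, 0 < H x) -> (forall x, y x `^ bt^-1 <= H x) ->
  (\int[mu]_x (H x)%:E <= L%:E)%E -> (\int[mu]_x (y x `^ bt^-1)%:E = 1)%E ->
  (\int[mu]_x ((y x * H x `^ (at_ - bt)) `^ at_^-1)%:E <= B%:E)%E ->
  1 <= lower_const at_ bt L * B.
Proof.
move=> at0 bt0 L0 my y0 mH H0 yH HL y1 hB.
have mA : measurable_fun setT (fun x => (y x * H x `^ (at_ - bt)) `^ at_^-1).
  by apply: measurable_powR_comp; apply: measurable_funM => //; exact: measurable_powR_comp.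
have myb : measurable_fun setT (fun x => (y x `^ bt^-1)%:E).
  by apply/measurable_EFinP; exact: measurable_powR_comp.
rewrite /lower_const; case: ifPn => [ba|].
  rewrite mul1r -lee_fin -y1; apply: le_trans hB; apply: ge0_le_integral => //.
  - by move=> x _; rewrite lee_fin powR_ge0.
  - exact/measurable_EFinP.
  move=> x _; rewrite lee_fin.
  have [->|yx] := eqVneq (y x) 0; first by rewrite mul0r !powR0 ?invr_neq0 ?gt_eqF.
  have {}yx : 0 < y x by rewrite lt_neqAle eq_sym yx y0.
  rewrite powRM ?powR_ge0// -(powRrM (H x)).
  have -> : bt^-1 = at_^-1 + bt^-1 * ((at_ - bt) * at_^-1) by field; rewrite !gt_eqF.
  rewrite powRD_gt0// (powRrM (y x)) ler_pM2l ?powR_gt0//.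
  by apply: ge0_ler_powR; rewrite ?nnegrE ?powR_ge0 ?(ltW (H0 _))// mulr_ge0 ?subr_ge0// invr_ge0 ltW.
rewrite -ltNge => ab.
set t := at_ / bt.
have t0 : 0 < t by rewrite divr_gt0.
have t1 : t < 1 by rewrite ltr_pdivrMr// mul1r.
pose c := (2 * L) `^ ((1 - t) / t).
have c0 : 0 < c by rewrite powR_gt0// mulr_gt0.
have e0 : 0 < (2 * L)^-1 by rewrite invr_gt0 mulr_gt0.
have pw x : y x `^ bt^-1 <= c * (y x * H x `^ (at_ - bt)) `^ at_^-1 + (2 * L)^-1 * H x.
  have t01 : 0 <= t <= 1 by rewrite !ltW.
  apply: le_trans (powR_mul_le_add t01 _ _); last 2 first.
  - by rewrite mulr_ge0 ?powR_ge0 ?(ltW c0).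
  - by rewrite mulr_ge0 ?(ltW (H0 _)) ?(ltW e0).
  rewrite powRM ?powR_ge0 ?(ltW c0)// (powRM _ (ltW e0) (ltW (H0 x))).
  rewrite -(powRrM (2 * L)) -(powRrM (_ * _)).
  have -> : (1 - t) / t * t = 1 - t by rewrite divfK ?gt_eqF.
  have -> : at_^-1 * t = bt^-1 by rewrite /t; field; rewrite !gt_eqF.
  rewrite (powRM _ (y0 x) (powR_ge0 _ _)) -(powRrM (H x)).
  have -> : (at_ - bt) / bt = - (1 - t) by rewrite /t; field; rewrite gt_eqF.
  rewrite powRN powRV ?mulr_ge0 ?(ltW L0)//.
  rewrite le_eqVlt; apply/orP; left; apply/eqP.
  have := powR_gt0 (1 - t) (H0 x); set u := _ `^ (1 - t) => u0.
  have : 0 < (2 * L) `^ (1 - t) by rewrite powR_gt0// mulr_gt0.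
  set w := _ `^ (1 - t) => w0; clearbody u w.
  by field; rewrite !gt_eqF.
have B0 : 0 <= B.
  by rewrite -lee_fin; apply: le_trans hB; apply: integral_ge0 => x _; rewrite lee_fin powR_ge0.
have : (1%:E <= (c * B)%:E + (2^-1)%:E)%E.
  rewrite -y1; apply: le_trans (_ : (_ <= \int[mu]_x (c%:E * ((y x * H x `^ (at_ - bt)) `^ at_^-1)%:E
       + (2 * L)^-1%:E * (H x)%:E))%E) _.
    apply: ge0_le_integral => //.
    - by move=> x _; rewrite lee_fin powR_ge0.
    - by apply: emeasurable_funD; apply: measurable_funeM; exact/measurable_EFinP.
    - by move=> x _; rewrite -!EFinM -EFinD lee_fin.
  rewrite ge0_integralD//; last 4 first.
  - by move=> x _; rewrite -EFinM lee_fin mulr_ge0 ?powR_ge0 ?(ltW c0).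
  - by apply: measurable_funeM; exact/measurable_EFinP.
  - by move=> x _; rewrite -EFinM lee_fin mulr_ge0 ?(ltW (H0 _)) ?(ltW e0).
  - by apply: measurable_funeM; exact/measurable_EFinP.
  rewrite !ge0_integralZl_EFin ?(ltW c0) ?(ltW e0)//; last 4 first.
  - by move=> x _; rewrite lee_fin ltW.
  - exact/measurable_EFinP.
  - by move=> x _; rewrite lee_fin powR_ge0.
  - exact/measurable_EFinP.
  apply: leeD; first by rewrite EFinM; apply: lee_wpmul2l => //; rewrite lee_fin ltW.
  apply: le_trans (_ : (_ <= (2 * L)^-1%:E * L%:E)%E) _.
    by apply: lee_wpmul2l => //; rewrite lee_fin ltW.
  by rewrite -EFinM lee_fin invfM divfK ?gt_eqF.
rewrite -EFinD lee_fin => h; rewrite -/c -mulrA mulrC -ler_pdivrMr// mul1r.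
by lra.
Qed.

Definition unit_norm (b : R) (y : X -> R) : Prop :=
  if b == 0 then {ae mu, forall x, y x <= 1} else (\int[mu]_x (y x `^ b^-1)%:E <= 1)%E.


Section Core.
Variables (Q : nat -> set X) (mQ : forall k, measurable (Q k)).
Variables (m : nat -> R) (Qm : forall k, mu (Q k) = (m k)%:E) (m0 : forall k, 0 < m k).
Variables (N : R) (N0 : 0 < N) (cov : covering_bound mu Q N).
Variables (h0 : X -> R) (mh0 : measurable_fun setT h0) (h00 : forall x, 0 < h0 x).
Hypothesis h01 : (\int[mu]_x (h0 x)%:E <= 1)%E.
Variables (J : finType) (j0 : J) (alpha beta : option J -> R).
Hypotheses (a0 : forall o, 0 < alpha o) (b0 : forall o, 0 <= beta o).
Hypothesis ab : \sum_o alpha o = \sum_o beta o.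
Variables (a b : J -> R) (at_ bt : R).
Hypotheses (bp : forall j, 0 <= b j) (at0 : 0 < at_) (bt0 : 0 < bt).
Hypothesis gap_Some : forall j, gap alpha beta (Some j) = a j - b j.
Hypothesis gap_None : gap alpha beta None = bt - at_.

(** The iteration starts from [#|J| + 2] functions of integral at most 1: one for each [f_j], one
    for [g], and [h0]. The majorant at most doubles the integral. *)
Definition mass_bound : R := 2 * (#|J|%:R + 2).

Lemma mass_bound_gt0 : 0 < mass_bound.
Proof. by rewrite mulr_gt0// ltr_wpDl. Qed.

Lemma dual_weights (v : J -> X -> R) (K : R) :
  (forall j, measurable_fun setT (v j)) -> (forall j x, 0 < v j x) ->
  class_le mu Q alpha v K ->
  exists (sg : option J -> X -> R) (S : option J -> nat -> R),
  [/\ forall o, measurable_fun setT (sg o), forall o x, 0 < sg o x,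
      forall o x, sg o x `^ alpha o = dual_tuple v o x,
      forall o k, (\int[mu]_(x in Q k) (sg o x)%:E = (S o k)%:E)%E &
      forall k, \prod_o (S o k / m k) `^ alpha o <= K].
Proof.
move=> mv v0 vK; have mD := measurable_dual_tuple mv v0; have D0 := dual_tuple_gt0 v0.
pose sg o x := dual_tuple v o x `^ (alpha o)^-1.
have msg o : measurable_fun setT (sg o) by exact: measurable_powR_comp.
have sg0 o x : 0 < sg o x by exact: powR_gt0.
have sgint o k (B : R) : mean_le mu (alpha o) (Q k) (dual_tuple v o) B ->
    (\int[mu]_(x in Q k) (sg o x)%:E <= (B `^ (alpha o)^-1 * m k)%:E)%E.
  by rewrite /mean_le gt_eqF// Qm.
have fin o k : (\int[mu]_(x in Q k) (sg o x)%:E)%E \is a fin_num.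
  have [B [_ _ hB]] := vK k.
  rewrite ge0_fin_numE; first exact: le_lt_trans (sgint _ _ _ (hB o)) (ltry _).
  by apply: integral_ge0 => x _; rewrite lee_fin ltW.
exists sg, (fun o k => fine (\int[mu]_(x in Q k) (sg o x)%:E)%E); split => //.
- by move=> o x; rewrite -(powRrM (dual_tuple v o x)) mulVf ?gt_eqF// powRr1// ltW.
- by move=> o k; rewrite fineK.
- move=> k; have [B [B0 BK hB]] := vK k; apply: le_trans BK.
  apply: ler_prod => o _; rewrite powR_ge0/=.
  have h : fine (\int[mu]_(x in Q k) (sg o x)%:E)%E <= B o `^ (alpha o)^-1 * m k.
    by rewrite -lee_fin fineK// sgint.
  have I0 : 0 <= fine (\int[mu]_(x in Q k) (sg o x)%:E)%E.
    by rewrite fine_ge0//; apply: integral_ge0 => x _; rewrite lee_fin ltW.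
  apply: (@le_trans _ _ ((B o `^ (alpha o)^-1) `^ alpha o)).
    apply: ge0_ler_powR; rewrite ?nnegrE ?powR_ge0 ?(ltW (a0 _))//.
      by rewrite divr_ge0// ltW.
    by rewrite ler_pdivrMr.
  by rewrite -(powRrM (B o)) mulVf ?gt_eqF// powRr1// ltW.
Qed.

(** Here [y j] and [y0] stand for the normalised [f_j v_j] and [g v]. All the [W n] have the same
    constant [K1], so that the hypothesis will give a bound [B] independent of [n]; the last clause
    removes the truncation and yields an inequality from which the norm of [g v] can be read off. *)
Theorem off_diagonal_weights (K : R) : 1 <= K ->
  exists K1 c : R, 0 < c /\ forall v : J -> X -> R,
  (forall j, measurable_fun setT (v j)) -> (forall j x, 0 < v j x) ->
  class_le mu Q alpha v K ->
  forall (y : J -> X -> R) (y0 : X -> R),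
  (forall j, measurable_fun setT (y j)) -> (forall j x, 0 <= y j x) ->
  (forall j, unit_norm (b j) (y j)) ->
  measurable_fun setT y0 -> (forall x, 0 <= y0 x) ->
  (\int[mu]_x (y0 x `^ bt^-1)%:E = 1)%E ->
  exists (W : nat -> J -> X -> R) (H : X -> R),
  [/\ forall n j, measurable_fun setT (W n j) /\ forall x, 0 < W n j x,
      forall n, class_const mu Q beta (W n) = K1%:E,
      forall n j e, 0 < e -> exists M, forall x, e <= h0 x -> W n j x <= M * (1 + v j x),
      [/\ measurable_fun setT H, forall x, 0 < H x, (\int[mu]_x (H x)%:E <= mass_bound%:E)%E &
          forall n j, {ae mu, forall x, y j x * (W n j x / v j x) <= H x `^ a j}] &
      forall B : R, (forall n, \int[mu]_x ((y0 x * \prod_j (W n j x / v j x)) `^ at_^-1)%:E <= B%:E)%E ->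
        1 <= c * B].
Proof.
move=> K1.
pose th := gap_exp alpha beta; have th01 := gap_exp01 beta a0.
pose C := rdf_const N alpha K th.
have C1 : 1 <= C := rdf_const_ge1 N0 K a0 th01.
pose Kb := K * C `^ (\sum_o `|gap alpha beta o|).
have bs : 0 < \sum_o beta o.
  rewrite -ab big_option/=; apply: ltr_pwDl => //.
  by apply: sumr_ge0 => j _; exact: ltW.
have [K2 [c1 [c10 tune]]] := tuning mQ Qm m0 b0 bs j0 Kb.
(* The second factor makes up for the lower bounds [c1 * V <= W] of the tuning, one for each index,
   in an integrand of power [1 / at_]. *)
exists K2, (lower_const at_ bt mass_bound * (c1 ^+ #|J|) `^ (- at_^-1)); split.
  by rewrite mulr_gt0 ?lower_const_gt0 ?mass_bound_gt0 ?powR_gt0 ?exprn_gt0.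
move=> v mv v0 vK y y0 my yp yn my0 y0p y01.
have [sg [S [msg sg0 sgE Sint SK]]] := dual_weights mv v0 vK.
have sg1 x : \prod_o sg o x `^ alpha o = 1.
  by under eq_bigr do rewrite sgE; exact: dual_tuple_prod.
have vE j x : sg (Some j) x `^ (- alpha (Some j)) = v j x.
  by rewrite powRN sgE /= invrK.
(* For [b j = 0] the function [y j] is at most [1 = H^0] almost everywhere and takes no share in
   [h]. *)
pose yb j x := if b j == 0 then 0 else y j x `^ (b j)^-1.
have yb0 j x : 0 <= yb j x by rewrite /yb; case: ifP => // _; exact: powR_ge0.
have myb j : measurable_fun setT (yb j).
  by rewrite /yb; case: (b j == 0); [exact: measurable_cst|exact: measurable_powR_comp].
have ybint j : (\int[mu]_x (yb j x)%:E <= 1)%E.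
  have := yn j; rewrite /unit_norm /yb; case: ifP => // _ _.
  by rewrite integral0 lee01.
pose h x := (h0 x + y0 x `^ bt^-1) + \sum_j yb j x.
have y0b0 x : 0 <= y0 x `^ bt^-1 by exact: powR_ge0.
have mh1 : measurable_fun setT (fun x => h0 x + y0 x `^ bt^-1).
  by apply: measurable_funD => //; exact: measurable_powR_comp.
have mys : measurable_fun setT (fun x => \sum_j yb j x) by exact: measurable_sum.
have mh : measurable_fun setT h by exact: measurable_funD.
have sy0 x : 0 <= \sum_j yb j x by apply: sumr_ge0 => j _.
have hp x : 0 < h x by rewrite /h -addrA ltr_pwDl// addr_ge0.
have hint : (\int[mu]_x (h x)%:E <= (#|J|%:R + 2)%:E)%E.
  under eq_integral do rewrite /h !EFinD -sumEFin.
  rewrite ge0_integralD//; last 4 first.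
  - by move=> x _; rewrite -EFinD lee_fin addr_ge0// ltW.
  - exact/measurable_EFinP.
  - by move=> x _; rewrite sumEFin lee_fin.
  - by under eq_fun do rewrite sumEFin; exact/measurable_EFinP.
  rewrite ge0_integralD//; last 4 first.
  - by move=> x _; rewrite lee_fin ltW.
  - exact/measurable_EFinP.
  - by move=> x _; rewrite lee_fin.
  - by apply/measurable_EFinP; exact: measurable_powR_comp.
  rewrite y01 addrC EFinD; apply: leeD; last by rewrite (natrD _ 1 1) EFinD; exact: leeD.
  rewrite ge0_integral_sum//; last 2 first.
  - by move=> j; exact/measurable_EFinP.
  - by move=> j x _; rewrite lee_fin.
  apply: le_trans (_ : (_ <= \sum_(j : J) 1)%E) _; first exact: lee_sum.
  by rewrite sumEFin sumr_const.
have hoo : (\int[mu]_x (h x)%:E < +oo)%E by exact: le_lt_trans hint (ltry _).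
have [H [mH hH HI rdf]] := rdf_density mQ Qm m0 N0 cov a0 K1 msg sg0 sg1 Sint SK th01 mh hp None hoo.
have H0 x : 0 < H x by exact: lt_le_trans (hH x).
have HL : (\int[mu]_x (H x)%:E <= mass_bound%:E)%E.
  by apply: le_trans HI _; rewrite /mass_bound EFinM; apply: lee_wpmul2l.
have S0 o k := weight_mass_gt0 mQ Qm m0 msg sg0 Sint o k.
pose V n := truncated_weight alpha beta sg H n.+1%:R.
have n0 n : 0 < n.+1%:R :> R by rewrite ltr0n.
have V0 n j x : 0 < V n j x := truncated_weight_gt0 alpha beta sg0 H0 j x (n0 n).
have mV n j : measurable_fun setT (V n j) := measurable_truncated_weight alpha beta msg mH _ j.
have VK n : class_le mu Q beta (V n) Kb.
  exact: (truncated_weight_class mQ Qm m0 a0 b0 ab msg sg0 sg1 Sint S0 SK mH H0 C1 rdf (n0 n)).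
have /choice[W hW] : forall n, exists W' : J -> X -> R, [/\ forall j, measurable_fun setT (W' j),
    forall j x, 0 < W' j x, forall j x, c1 * V n j x <= W' j x <= V n j x &
    class_const mu Q beta W' = K2%:E].
  by move=> n; exact: tune.
exists W, H.
pose T n j x := truncated alpha beta sg H n.+1%:R j x `^ gap alpha beta (Some j).
have Vv n j x : V n j x / v j x = T n j x.
  by rewrite /V /truncated_weight vE mulrAC divff ?mul1r// gt_eqF.
have t0 n j x : 0 < truncated alpha beta sg H n.+1%:R j x.
  exact: (truncated_gt0 alpha beta sg0 H0).
have T0 n j x : 0 < T n j x by exact: powR_gt0.
have TH n j x : T n j x <= H x `^ gap alpha beta (Some j).
  rewrite /T /truncated; case: ifP => // g0.
  apply: ge0_ler_powR; rewrite ?nnegrE ?(ltW g0) ?(ltW (H0 _))//; last by rewrite ge_min lexx.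
  by rewrite le_min ?(ltW (H0 _))//= mulr_ge0 ?(ltW (sg0 _ _)).
split => //.
- by move=> n j; have [mW W0 _ _] := hW n; split.
- by move=> n; have [] := hW n.
- move=> n j e e0; have [_ _ WV _] := hW n.
  have [g0|g0] := ltP 0 (gap alpha beta (Some j)).
    exists (n.+1%:R `^ gap alpha beta (Some j)) => x _.
    have /andP[_ WVx] := WV j x; apply: le_trans WVx _.
    rewrite /V /truncated_weight vE /truncated g0.
    apply: (@le_trans _ _ (v j x * (n.+1%:R * sg (Some j) x) `^ gap alpha beta (Some j))).
      apply: ler_wpM2l; first exact: ltW.
      apply: ge0_ler_powR; rewrite ?nnegrE ?(ltW g0)//; last by rewrite ge_min lexx orbT.
        by rewrite le_min ?(ltW (H0 _))//= mulr_ge0 ?(ltW (sg0 _ _)).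
      by rewrite mulr_ge0 ?(ltW (sg0 _ _)).
    rewrite powRM ?(ltW (sg0 _ _))// mulrCA ler_pM2l ?powR_gt0//.
    (* As [beta] is nonnegative this quotient is at most 1, whence [v^(1 - t) <= 1 + v]. *)
    pose t := gap alpha beta (Some j) / alpha (Some j).
    have -> : sg (Some j) x `^ gap alpha beta (Some j) = v j x `^ (- t).
      rewrite -vE -(powRrM (sg (Some j) x)); congr (_ `^ _).
      by rewrite /t; field; rewrite gt_eqF.
    rewrite -{1}(powRr1 (ltW (v0 j x))) -powRD_gt0//.
    have := powR_mul_le_add (_ : 0 <= t <= 1) ler01 (ltW (v0 j x)).
    rewrite powR1 mul1r; apply; rewrite divr_ge0 ?(ltW g0) ?(ltW (a0 _))//=.
    by rewrite ler_pdivrMr// mul1r /gap gerBl.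
  (* A power of [H] with exponent at most 0 is bounded where [e <= h0], because [h0 <= H]. *)
  exists (e `^ gap alpha beta (Some j)) => x ex.
  have /andP[_ WVx] := WV j x; apply: le_trans WVx _.
  rewrite /V /truncated_weight vE /truncated ltNge g0/= mulrC.
  apply: ler_pM; rewrite ?powR_ge0 ?(ltW (v0 _ _))//; last by rewrite lerDr.
  rewrite -[gap _ _ _]opprK; apply: ler_powR_N => //; first by rewrite oppr_ge0.
  apply: le_trans ex (le_trans _ (hH x)); rewrite /h -addrA lerDl addr_ge0//.
- split=> // n j; have [_ _ WV _] := hW n.
  have yH : {ae mu, forall x, y j x <= H x `^ b j}.
    have := yn j; rewrite /unit_norm; case: eqVneq => [->|bn].
      by apply: filterS => x; rewrite powRr0.
    move=> _; apply: nearW => x.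
    have b_0 : 0 < b j by rewrite lt_neqAle eq_sym bn bp.
    have hx : y j x `^ (b j)^-1 <= H x.
      apply: le_trans (hH x); rewrite /h (bigD1 j)//= addrCA {1}/yb (negbTE bn) lerDl.
      by rewrite addr_ge0 ?sumr_ge0// addr_ge0// ltW.
    have := ge0_ler_powR (ltW b_0) _ _ hx; rewrite !nnegrE powR_ge0 (ltW (H0 _)) => /(_ isT isT).
    by rewrite -(powRrM (y j x)) mulVf// powRr1.
  apply: filterS yH => x yH.
  have -> : a j = b j + gap alpha beta (Some j) by rewrite gap_Some addrC subrK.
  rewrite powRD_gt0//; apply: ler_pM => //.
    by have [_ W0 _ _] := hW n; rewrite divr_ge0 ?(ltW (W0 _ _)) ?(ltW (v0 _ _)).
  apply: le_trans (TH n j x); rewrite -Vv ler_pM2r ?invr_gt0//.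
  by have /andP[] := WV j x.
- move=> B hB.
  pose U n x := (y0 x * \prod_j T n j x) `^ at_^-1.
  have at'0 : 0 <= at_^-1 by rewrite invr_ge0 ltW.
  have prodT0 n x : 0 < \prod_j T n j x by exact: prodr_gt0.
  have mT n : measurable_fun setT (fun x => \prod_j T n j x).
    apply: measurable_prod => j _.
    have -> : T n j = fun x => V n j x * v j x `^ (-1).
      by apply/funext => x; rewrite powR_inv1 ?Vv// ltW.
    by apply: measurable_funM => //; exact: measurable_powR_comp.
  have mU n : measurable_fun setT (U n).
    by apply: measurable_powR_comp; exact: measurable_funM.
  have cJ : 0 < c1 ^+ #|J| by exact: exprn_gt0.
  have UW n x : U n x <= (c1 ^+ #|J|) `^ (- at_^-1) * (y0 x * \prod_j (W n j x / v j x)) `^ at_^-1.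
    have [_ W0 WV _] := hW n.
    have PW : c1 ^+ #|J| * \prod_j T n j x <= \prod_j (W n j x / v j x).
      rewrite -prodr_const -big_split/=; apply: ler_prod => j _.
      rewrite mulr_ge0 ?(ltW c10) ?(ltW (T0 _ _ _))//= -Vv mulrA ler_pM2r ?invr_gt0//.
      by have /andP[] := WV j x.
    have PW0 : 0 <= \prod_j (W n j x / v j x).
      by apply: prodr_ge0 => j _; rewrite divr_ge0 ?(ltW (W0 _ _)) ?(ltW (v0 _ _)).
    rewrite powRN mulrC ler_pdivlMr ?powR_gt0// mulrC -powRM ?(ltW cJ) ?mulr_ge0 ?(ltW (prodT0 _ _))//.
    apply: ge0_ler_powR; rewrite ?nnegrE ?mulr_ge0 ?(ltW cJ) ?(ltW (prodT0 _ _))//.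
    by rewrite mulrCA ler_wpM2l.
  have mWv n : measurable_fun setT (fun x => (y0 x * \prod_j (W n j x / v j x)) `^ at_^-1).
    have [mW _ _ _] := hW n; apply: measurable_powR_comp; apply: measurable_funM => //.
    apply: measurable_prod => j _.
    rewrite (_ : (fun x => _) = fun x => W n j x * v j x `^ (-1)).
      by apply: measurable_funM => //; exact: measurable_powR_comp.
    by apply/funext => x; rewrite powR_inv1// ltW.
  have UB n : (\int[mu]_x (U n x)%:E <= ((c1 ^+ #|J|) `^ (- at_^-1) * B)%:E)%E.
    rewrite EFinM; apply: le_trans (lee_wpmul2l _ (hB n)); last by rewrite lee_fin powR_ge0.
    rewrite -ge0_integralZl_EFin ?powR_ge0//; last 2 first.
    - by move=> x _; rewrite lee_fin powR_ge0.
    - exact/measurable_EFinP.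
    apply: ge0_le_integral => //.
    - by move=> x _; rewrite lee_fin powR_ge0.
    - exact/measurable_EFinP.
    - by apply: measurable_funeM; exact/measurable_EFinP.
    - by move=> x _; rewrite -EFinM lee_fin.
  have ndU x : nondecreasing_seq (fun n => (U n x)%:E).
    apply/nondecreasing_seqP => n; rewrite lee_fin.
    apply: ge0_ler_powR; rewrite ?nnegrE ?mulr_ge0 ?(ltW (prodT0 _ _))//.
    apply: ler_wpM2l => //; apply: ler_prod => j _; rewrite ltW//=.
    rewrite /T /truncated; case: ifP => // g0.
    have p k : 0 <= Num.min (H x) (k.+1%:R * sg (Some j) x).
      by rewrite le_min ?(ltW (H0 _))//= mulr_ge0 ?(ltW (sg0 _ _)).
    apply: ge0_ler_powR; rewrite ?nnegrE ?(ltW g0)//.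
    rewrite le_min ge_min lexx/= ge_min; apply/orP; right.
    by rewrite ler_pM2r// ler_nat.
  (* For fixed [x] and large [n] none of the finitely many truncations is active, so the untruncated
     value is among those of the sequence. *)
  have Uge x : (((y0 x * H x `^ (at_ - bt)) `^ at_^-1)%:E <= ereal_sup (range (fun n => (U n x)%:E)))%E.
    have [n hn] : exists n : nat, forall j, H x <= n.+1%:R * sg (Some j) x.
      pose M := \sum_j H x / sg (Some j) x.
      exists (Num.truncn M) => j; rewrite -ler_pdivrMr//.
      apply: le_trans (ltW (truncnS_gt M)).
      rewrite /M (bigD1 j)//= lerDl; apply: sumr_ge0 => i _.
      by rewrite divr_ge0// ltW.
    apply: ereal_sup_ubound; exists n => //; congr EFin; congr (_ `^ _); congr (_ * _).
    have -> : at_ - bt = \sum_j gap alpha beta (Some j).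
      have := sum_gap ab; rewrite big_option/= gap_None => /eqP.
      by rewrite addrC addr_eq0 opprB => /eqP ->.
    rewrite powR_sum//; apply: eq_bigr => j _; rewrite /T /truncated; case: ifP => // _.
    by rewrite min_l.
  rewrite -mulrA.
  apply: (@lower_estimate at_ bt mass_bound _ y0 H at0 bt0 mass_bound_gt0 my0 y0p mH H0 _ HL y01).
    move=> x; apply: le_trans (hH x); rewrite /h -addrA addrCA lerDl.
    by rewrite addr_ge0// ltW.
  apply: le_trans (integral_nd_sup_le (g := fun n x => (U n x)%:E) _ _ ndU UB); last 2 first.
  - by move=> n; exact/measurable_EFinP.
  - by move=> n x; rewrite lee_fin powR_ge0.
  apply: ge0_le_integral => //.
  - by move=> x _; rewrite lee_fin powR_ge0.
  - apply/measurable_EFinP/measurable_powR_comp/measurable_funM => //.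
    exact: measurable_powR_comp.
  - apply: measurable_ereal_sup => [n|n x]; first exact/measurable_EFinP.
    by rewrite lee_fin powR_ge0.
Qed.

End Core.

End NormEstimates.

(** * Norms in terms of reciprocal exponents *)

Section LnormTools.
Context {disp : measure_display} {R : realType} {X : measurableType disp}.
Variable mu : {measure set X -> \bar R}.
Local Open Scope ereal_scope.

Lemma measurable_poweR_abse (f : X -> \bar R) (t : R) :
  measurable_fun setT f -> measurable_fun setT (fun x => `|f x| `^ t).
Proof.
move=> mf; apply: (measurableT_comp (measurable_poweR _)).
exact: measurableT_comp.
Qed.

Lemma average_ae_eq (t : \bar R) (B : set X) (f g : X -> \bar R) :
  measurable B -> measurable_fun setT f -> measurable_fun setT g ->
  {ae mu, forall x, f x = g x} -> average mu t B f = average mu t B g.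
Proof.
move=> mB mf mg fg; rewrite /average; case: t => [t||].
- congr ((_ * _) `^ _); apply: ae_eq_integral => //.
  + exact/measurable_funTS/measurable_poweR_abse.
  + exact/measurable_funTS/measurable_poweR_abse.
  + by apply: filterS fg => x ->.
- by apply: eq_ess_sup; apply: filterS fg => x h; rewrite !patchE h.
- by apply: eq_ess_sup; apply: filterS fg => x h; rewrite !patchE h.
Qed.

Lemma Lnorm_ae_eq (p : \bar R) (f g : X -> \bar R) :
  measurable_fun setT f -> measurable_fun setT g ->
  {ae mu, forall x, f x = g x} -> 'N[mu]_p[f] = 'N[mu]_p[g].
Proof.
move=> mf mg fg; rewrite unlock /Lnorm; case: p => [t||].
- congr (_ `^ _); apply: ae_eq_integral => //; try exact: measurable_poweR_abse.
  by apply: filterS fg => x ->.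
- by rewrite (@eq_ess_sup _ _ _ _ (abse \o f) (abse \o g))//; apply: filterS fg => x /= ->.
- rewrite !ess_infEN; rewrite (@eq_ess_sup _ _ _ _ (\- (abse \o f)) (\- (abse \o g)))//.
  by apply: filterS fg => x /= ->.
Qed.

Lemma Lnorm_recip (b : R) (F : X -> \bar R) : (0 < b)%R ->
  'N[mu]_(b%:E^-1)[F] = (\int[mu]_x (`|F x| `^ b^-1)) `^ b.
Proof. by move=> b0; rewrite inver gt_eqF// unlock /= invrK. Qed.

Lemma Lnorm_recip0 (F : X -> \bar R) : 0 < mu setT ->
  'N[mu]_(0%:E^-1)[F] = ess_sup mu (abse \o F).
Proof. by move=> m0; rewrite inve0 unlock /= m0. Qed.

Lemma Lnorm_recip_leP (b B : R) (F : X -> \bar R) : (0 < b)%R -> (0 <= B)%R ->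
  ('N[mu]_(b%:E^-1)[F] <= B%:E) = (\int[mu]_x (`|F x| `^ b^-1) <= (B `^ b^-1)%:E).
Proof.
move=> b0 B0; rewrite Lnorm_recip//.
have I0 : 0 <= \int[mu]_x (`|F x| `^ b^-1) by apply: integral_ge0 => x _; exact: poweR_ge0.
apply/idP/idP => h.
  have := le_poweR (_ : (0 <= b^-1)%R) (poweR_ge0 _ _) h; rewrite invr_ge0 ltW// => /(_ isT).
  by rewrite -poweRrM mulfV ?gt_eqF// poweRe1// poweR_EFin.
have := le_poweR (ltW b0) I0 h.
by rewrite poweR_EFin -powRrM mulVf ?gt_eqF// powRr1.
Qed.

(** The norms of all the [f_i] for the exponents [p] are estimated in this way: once a function is
    dominated by a multiple of [H^a], the integral of [H] controls its norm of order [1 / a]. *)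
Lemma Lnorm_le_density (a c L : R) (F : X -> \bar R) (H : X -> R) :
  (0 <= a)%R -> (0 <= c)%R -> (0 <= L)%R -> 0 < mu setT ->
  measurable_fun setT F -> measurable_fun setT H -> (forall x, 0 < H x)%R ->
  \int[mu]_x (H x)%:E <= L%:E -> {ae mu, forall x, `|F x| <= (c * H x `^ a)%:E} ->
  'N[mu]_(a%:E^-1)[F] <= (c * L `^ a)%:E.
Proof.
move=> a0 c0 L0 m0 mF mH H0 HL FH; move: a0; rewrite le_eqVlt => /predU1P[a0|a0].
  rewrite -a0 in FH *; rewrite Lnorm_recip0//; apply/ess_supP.
  by apply: filterS FH => x; rewrite !powRr0.
have a'0 : (0 <= a^-1)%R by rewrite invr_ge0 ltW.
rewrite Lnorm_recip_leP ?mulr_ge0 ?powR_ge0//.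
rewrite powRM ?powR_ge0// -powRrM mulfV ?gt_eqF// powRr1// EFinM.
apply: le_trans (lee_wpmul2l _ HL); last by rewrite lee_fin powR_ge0.
rewrite -ge0_integralZl_EFin ?powR_ge0//; last 2 first.
- by move=> x _; rewrite lee_fin ltW.
- exact/measurable_EFinP.
apply: ae_ge0_le_integral => //.
- by move=> x _; exact: poweR_ge0.
- exact: measurable_poweR_abse.
- by move=> x _; rewrite -EFinM lee_fin mulr_ge0 ?powR_ge0// ltW.
- by apply: measurable_funeM; exact/measurable_EFinP.
apply: filterS FH => x h _; have := le_poweR a'0 (abse_ge0 _) h.
by rewrite poweR_EFin powRM ?powR_ge0// -powRrM mulfV ?gt_eqF// powRr1 ?(ltW (H0 x)).
Qed.

Lemma Lnorm_normalized (b c : R) (F : X -> \bar R) :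
  (0 <= b)%R -> (0 < c)%R -> 0 < mu setT -> measurable_fun setT F -> (forall x, 0 <= F x) ->
  'N[mu]_(b%:E^-1)[F] = c%:E ->
  {ae mu, forall x, F x \is a fin_num} /\ unit_norm mu b (fun x => fine (F x) / c)%R.
Proof.
move=> b0 c0 m0 mF F0; move: b0; rewrite le_eqVlt => /predU1P[<-|b0].
  rewrite Lnorm_recip0// => Fc.
  have {Fc} Fc : {ae mu, forall x, F x <= c%:E}.
    have := ess_sup_ge mu (abse \o F); rewrite Fc.
    by apply: filterS => x /=; rewrite gee0_abs.
  have fin : {ae mu, forall x, F x \is a fin_num}.
    by apply: filterS Fc => x h; rewrite ge0_fin_numE// (le_lt_trans h)// ltry.
  split=> //; rewrite /unit_norm eqxx; apply: filterS2 fin Fc => x fx h.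
  by rewrite ler_pdivrMr// mul1r -lee_fin fineK.
move=> Fc; have b'0 : (0 < b^-1)%R by rewrite invr_gt0.
have I : \int[mu]_x (`|F x| `^ b^-1) = (c `^ b^-1)%:E.
  have := congr1 (fun u => poweR u (b^-1)%R) Fc; rewrite Lnorm_recip// -poweRrM mulfV ?gt_eqF//.
  rewrite poweR_EFin poweRe1//.
  by apply: integral_ge0 => x _; exact: poweR_ge0.
split.
  have : mu.-integrable setT (fun x => `|F x| `^ b^-1).
    apply/integrableP; split; first exact: measurable_poweR_abse.
    under eq_integral do rewrite gee0_abs ?poweR_ge0//.
    by rewrite I ltry.
  move=> /(integrable_ae measurableT); apply: filterS => x /(_ Logic.I).
  rewrite ge0_fin_numE ?poweR_ge0// ge0_fin_numE// => /lty_poweRy.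
  by rewrite gee0_abs//; apply; rewrite gt_eqF.
rewrite /unit_norm gt_eqF//.
apply: le_trans (_ : _ <= \int[mu]_x ((c `^ - b^-1)%:E * `|F x| `^ b^-1)) _.
  apply: ge0_le_integral => //.
  - by move=> x _; rewrite lee_fin powR_ge0.
  - apply/measurable_EFinP/measurable_powR_comp/measurable_funM => //.
    exact: measurableT_comp.
  - by apply: measurable_funeM; exact: measurable_poweR_abse.
  move=> x _; rewrite gee0_abs//; have := F0 x; case: (F x) => [y||]//.
    rewrite lee_fin => y0; rewrite poweR_EFin -EFinM lee_fin /=.
    by rewrite powRM ?invr_ge0 ?(ltW c0)// powRV ?(ltW c0)// -powRN mulrC.
  (* At an infinite value [fine] returns 0, and the left-hand side vanishes. *)
  move=> _; rewrite /= mul0r powR0 ?gt_eqF// mule_ge0 ?poweR_ge0//.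
  by rewrite lee_fin powR_ge0.
rewrite ge0_integralZl_EFin ?powR_ge0//; last 2 first.
- by move=> x _; exact: poweR_ge0.
- exact: measurable_poweR_abse.
by rewrite I -EFinM lee_fin powRN mulVf ?gt_eqF ?powR_gt0.
Qed.

End LnormTools.

(** * Bounded truncations of [g] *)

Section BoundedPart.
Context {disp : measure_display} {R : realType} {X : measurableType disp}.
Variables (B : nat -> set X) (v : X -> R) (g : X -> \bar R).
Hypotheses (mB : forall n, measurable (B n)) (mv : measurable_fun setT v).
Hypotheses (mg : measurable_fun setT g) (g0 : forall x, (0 <= g x)%E).
Hypothesis B_nd : forall n, B n `<=` B n.+1.
Hypothesis B_cover : forall x, exists n, B n x.
Hypothesis v0 : forall x, 0 < v x.

Let A n := B n `&` [set x | v x <= n%:R].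

(** The norm of [g v] may be infinite, whereas it has to be finite for normalising. Cutting off at
    height [n], on the part of [B n] where [v <= n], makes the product with [v] bounded by [n^2] and
    exhausts [g] as [n] grows. *)
Definition bounded_part (n : nat) (x : X) : R :=
  fine (mine (g x) n%:R%:E) * \1_(A n) x.

Let measurable_A n : measurable (A n).
Proof.
apply: measurableI => //.
have -> : [set x | v x <= n%:R] = v @^-1` `]-oo, n%:R].
  by apply/seteqP; split=> x /=; rewrite in_itv.
by rewrite -[X in measurable X]setTI; exact: mv.
Qed.

Lemma mine_natE n x : (mine (g x) n%:R%:E = (fine (mine (g x) n%:R%:E))%:E)%E.
Proof.
rewrite fineK// ge0_fin_numE; first by rewrite gt_min ltry orbT.
by rewrite le_min g0 lee_fin ler0n.
Qed.

Lemma bounded_part_ge0 n x : 0 <= bounded_part n x.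
Proof.
apply: mulr_ge0; last by rewrite indicE.
by rewrite -lee_fin -mine_natE le_min g0 lee_fin ler0n.
Qed.

Lemma measurable_bounded_part n : measurable_fun setT (bounded_part n).
Proof.
apply: measurable_funM; last exact: measurable_indic.
apply: measurableT_comp => //; apply: measurable_mine => //; exact: measurable_cst.
Qed.

Lemma bounded_part_le n x : ((bounded_part n x)%:E <= g x)%E.
Proof.
rewrite /bounded_part indicE; case: (_ \in _); last by rewrite mulr0.
by rewrite mulr1 -mine_natE ge_min lexx.
Qed.

Lemma bounded_part_nd x : nondecreasing_seq (bounded_part ^~ x).
Proof.
apply/nondecreasing_seqP => n; rewrite /bounded_part; apply: ler_pM.
- by rewrite -lee_fin -mine_natE le_min g0 lee_fin ler0n.
- by rewrite indicE.
- rewrite -lee_fin -!mine_natE le_min ge_min lexx/= ge_min; apply/orP; right.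
  by rewrite lee_fin ler_nat.
- rewrite !indicE; case: (boolP (x \in A n)) => // /set_mem[Bx vx].
  rewrite mem_set//; split; first exact: B_nd.
  by apply: le_trans vx _; rewrite ler_nat.
Qed.

Lemma bounded_part_prod_le n x : bounded_part n x * v x <= n%:R ^+ 2 * \1_(B n) x.
Proof.
rewrite /bounded_part !indicE; case: (boolP (x \in A n)) => [/set_mem[Bx vx]|_].
  rewrite !mulr1 mem_set// mulr1 expr2; apply: ler_pM => //.
  - by rewrite -lee_fin -mine_natE le_min g0 lee_fin ler0n.
  - exact: ltW.
  - by rewrite -lee_fin -mine_natE ge_min lexx orbT.
by rewrite mulr0 mul0r mulr_ge0// exprn_ge0.
Qed.

Lemma bounded_part_sup (t : R) x : 0 < t ->
  ((g x * (v x)%:E) `^ t <= ereal_sup (range (fun n => ((bounded_part n x * v x) `^ t)%:E)))%E.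
Proof.
move=> t0.
have [n0 hn0] : exists n, forall k, (n <= k)%N -> x \in A k.
  have [n1 Bx] := B_cover x.
  exists (maxn n1 (Num.truncn (v x)).+1) => k; rewrite geq_max => /andP[n1k vk].
  rewrite mem_set//; split; last by apply: le_trans (ltW (truncnS_gt _)) _; rewrite ler_nat.
  elim: k n1k {vk} => [|k ih]; first by rewrite leqn0 => /eqP <-.
  by rewrite leq_eqVlt => /predU1P[<-//|]; rewrite ltnS => /ih; exact: B_nd.
have bE k : (n0 <= k)%N -> ((bounded_part k x)%:E = mine (g x) k%:R%:E)%E.
  by move=> nk; rewrite /bounded_part indicE hn0// mulr1 -mine_natE.
have := g0 x; case gx : (g x) => [y||]// y0.
  pose k := maxn n0 (Num.truncn y).+1.
  have bk : bounded_part k x = y.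
    have := bE k (leq_maxl _ _); rewrite gx min_l; first by case.
    by rewrite lee_fin; apply: le_trans (ltW (truncnS_gt _)) _; rewrite ler_nat leq_maxr.
  apply: ereal_sup_ubound; exists k => //.
  by rewrite -EFinM poweR_EFin bk.
rewrite gt0_mulye ?lte_fin// poweRyr ?gt_eqF//; rewrite leye_eq.
apply/eqP; apply/eqyP => M _.
(* Where [g] is infinite the truncation equals [k]; this choice makes [(k * v x)^t] at least [M]. *)
pose k := maxn n0 (Num.truncn (`|M| `^ t^-1 / v x)).+1.
apply: le_trans (_ : (((bounded_part k x * v x) `^ t)%:E <= _)%E); last first.
  by apply: ereal_sup_ubound; exists k.
have -> : bounded_part k x = k%:R.
  by have := bE k (leq_maxl _ _); rewrite gx min_r ?leey//; case.
rewrite lee_fin; apply: le_trans (ler_norm M) _.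
have -> : `|M| = (`|M| `^ t^-1) `^ t.
  by rewrite -(powRrM `|M|) mulVf ?gt_eqF// powRr1.
apply: ge0_ler_powR; rewrite ?nnegrE ?powR_ge0 ?(ltW t0)//.
  by rewrite mulr_ge0// ltW.
rewrite -ler_pdivrMr//; apply: le_trans (ltW (truncnS_gt _)) _.
by rewrite ler_nat leq_maxr.
Qed.

End BoundedPart.

(** * Exponents and their reciprocals *)

Section ReciprocalExponents.
Context {R : realType}.
Variables (m : nat) (eta : R) (r : 'I_m -> R) (s : \bar R) (sv : R).
Hypotheses (r1 : forall i, 1 <= r i) (sE : s = (sv%:E^-1)%E) (sv0 : 0 <= sv).

(* Exponents are handled through their reciprocals, [+oo] being the inverse of [0]. *)
Definition reciprocals (p : 'I_m -> \bar R) (a : 'I_m -> R) (at_ : R) : Prop :=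
  [/\ p = (fun i => (a i)%:E^-1)%E, forall i, 0 <= a i, 0 < at_,
      at_ = \sum_i a i - eta & tilde eta p = (at_%:E^-1)%E].

Lemma reciprocalsP (p : 'I_m -> \bar R) :
  (forall i, (r i)%:E <= p i)%E -> (0 < inv_tilde eta p)%E ->
  exists a at_, reciprocals p a at_.
Proof.
move=> rp p0.
(* The bound [1 <= r i] keeps [p i] away from 0, whose inverse is [+oo]. *)
have pE i : p i = (((fine (p i)^-1)%:E)^-1)%E.
  rewrite fineK ?inveK//; have := rp i; case: (p i) => [x|//|//].
  by rewrite lee_fin inver => rx; case: eqVneq rx => // ->; rewrite leNgt (lt_le_trans _ (r1 i)).
have pi0 i : 0 <= fine (p i)^-1.
  by apply: fine_ge0; rewrite inve_ge0; apply: le_trans (rp i); rewrite lee_fin (le_trans _ (r1 i)).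
have pf i : ((p i)^-1 = (fine (p i)^-1)%:E)%E by rewrite {1}pE inveK.
have iE : inv_tilde eta p = (\sum_i fine (p i)^-1%E - eta)%:E.
  by rewrite /inv_tilde EFinB -sumEFin; congr (_ - _)%E; apply: eq_bigr => i _; rewrite pf.
exists (fun i => fine (p i)^-1%E), (\sum_i fine (p i)^-1%E - eta); split => //.
- exact/funext.
- by rewrite -lte_fin -iE.
- by rewrite /tilde iE.
Qed.

(** Reciprocals of the orders of the averages in [A_const]: the families [alpha] and [beta] of the
    weight constructions. *)
Definition slack (a : 'I_m -> R) (at_ : R) (o : option 'I_m) : R :=
  if o is Some i then (r i)^-1 - a i else at_ - sv.

(** That the value is the same for all exponents is the balance condition [ab] of the weight
    constructions. *)
Lemma sum_slack p a at_ : reciprocals p a at_ ->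
  \sum_o slack a at_ o = \sum_i (r i)^-1 - eta - sv.
Proof. by move=> [_ _ _ -> _]; rewrite big_option/= sumrB; ring. Qed.

Let rV i : ((r i)%:E^-1 = ((r i)^-1)%:E)%E.
Proof. by rewrite inver gt_eqF// (lt_le_trans _ (r1 i)). Qed.

Let r0 i : (0 <= (r i)%:E)%E.
Proof. by rewrite lee_fin (le_trans _ (r1 i)). Qed.

Lemma slack_ge0 p a at_ : reciprocals p a at_ -> exp_le r s p (tilde eta p) ->
  forall o, 0 <= slack a at_ o.
Proof.
move=> [pE a0 at0 _ tE] [rp ts] [i|] /=; rewrite subr_ge0 -lee_fin.
  by have := rp i; rewrite pE inve_pge ?rV ?inE// lee_fin.
by move: ts; rewrite tE sE lee_pV2// inE lee_fin// ltW.
Qed.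

Lemma slack_gt0 p a at_ : reciprocals p a at_ -> exp_lt r s p (tilde eta p) ->
  forall o, 0 < slack a at_ o.
Proof.
move=> [pE a0 at0 _ tE] [rp ts] [i|] /=; rewrite subr_gt0 -lte_fin.
  by have := rp i; rewrite pE inve_pgt ?rV ?inE// lee_fin.
by move: ts; rewrite tE sE lte_pV2// inE lee_fin// ltW.
Qed.

End ReciprocalExponents.

Lemma measurable_inve {disp : measure_display} {R : realType} {X : measurableType disp}
  (f : X -> \bar R) : measurable_fun setT f -> measurable_fun setT (fun x => (f x)^-1)%E.
Proof.
move=> mf.
(* For finite nonzero [y] the inverse is written as [y * (y^2)^(-1)], a real power of a nonnegative
   base, in order to see that it is measurable. At [+oo] the function [fine] gives 0, which is the
   value of [+oo^-1]. *)
have -> : (fun x => (f x)^-1)%E = fun x => if f x == 0%E then +oo%E else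
    if f x == -oo%E then -oo%E else (fine (f x) * (fine (f x) ^+ 2) `^ (-1))%:E.
  apply/funext => x; case: (f x) => [y||]; last 2 first.
  - by rewrite /= mul0r.
  - by [].
  rewrite inver eqe; case: ifPn => // y0; congr EFin => /=.
  by rewrite powR_inv1 ?sqr_ge0// expr2 invfM mulrA mulfV// mul1r.
apply: measurable_fun_ifT; first exact: measurable_fun_eqe.
  exact: measurable_cst.
apply: measurable_fun_ifT; first exact: measurable_fun_eqe.
  exact: measurable_cst.
apply/measurable_EFinP/measurable_funM; first exact: measurableT_comp.
by apply: measurable_powR_comp; apply: measurable_funX; exact: measurableT_comp.
Qed.

(** * Extended-real weights and their real representatives *)

Section WeightBridge.
Context {disp : measure_display} {R : realType} {X : measurableType disp}.
Variables (mu : {measure set X -> \bar R}) (d : X -> X -> R).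
Variables (m : nat) (eta : R) (r : 'I_m -> R) (s : \bar R) (sv : R).
Hypotheses (r1 : forall i, 1 <= r i) (sE : s = (sv%:E^-1)%E) (sv0 : 0 <= sv).
Variables (D : set (set X)) (Q : nat -> set X).
Hypotheses (DQ : D = range Q) (mQ : forall k, measurable (Q k)).

Lemma measurable_prod_weight (w : 'I_m -> X -> \bar R) :
  (forall i, measurable_fun setT (w i)) -> measurable_fun setT (prod_weight w).
Proof.
move=> mw; rewrite /prod_weight.
elim: (index_enum _) => [|i l ih].
  by under eq_fun do rewrite big_nil; exact: measurable_cst.
by under eq_fun do rewrite big_cons; exact: emeasurable_funM.
Qed.

Lemma prod_weight_EFin (W : 'I_m -> X -> R) x :
  prod_weight (fun i => EFin \o W i) x = (\prod_i W i x)%:E.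
Proof. by rewrite /prod_weight prodEFin. Qed.

(** Both sides are suprema over the same cubes, and changing the weights on null sets changes no
    average. *)
Lemma A_const_class p a at_ (w : 'I_m -> X -> \bar R) (W : 'I_m -> X -> R) :
  reciprocals eta p a at_ ->
  (forall i, measurable_fun setT (w i)) -> (forall i, measurable_fun setT (W i)) ->
  (forall i x, 0 < W i x) -> (forall i, {ae mu, forall x, w i x = (W i x)%:E}) ->
  A_const mu D r s p (tilde eta p) w = class_const mu Q (slack r sv a at_) W.
Proof.
move=> [pE a0 at0 atE tE] mw mW W0 wW.
have term k : ((\prod_(j < m) average mu ((r j)%:E^-1 - (p j)^-1)^-1 (Q k) (fun x => (w j x)^-1))
    * average mu ((tilde eta p)^-1 - s^-1)^-1 (Q k) (prod_weight w) =
    \prod_o average mu ((slack r sv a at_ o)%:E^-1) (Q k) (EFin \o dual_tuple W o))%E.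
  rewrite big_option/= muleC; congr (_ * _)%E.
    rewrite tE sE !inveK -EFinB; apply: average_ae_eq => //.
    - exact: measurable_prod_weight.
    - by apply/measurable_EFinP/measurable_prod => i _.
    - have : {ae mu, forall x, forall i, w i x = (W i x)%:E} by exact: filter_forall.
      apply: filterS => x h /=; rewrite /prod_weight -prodEFin.
      by apply: eq_bigr => i _.
  apply: eq_bigr => i _.
  have ri : r i == 0 = false by rewrite gt_eqF// (lt_le_trans _ (r1 i)).
  rewrite pE inveK inver ri -EFinB; apply: average_ae_eq => //.
  - exact: measurable_inve.
  - apply/measurable_EFinP; exact: (measurable_dual_tuple mW W0 (Some i)).
  - by apply: filterS (wW i) => x -> /=; rewrite inver gt_eqF.
rewrite /A_const /class_const; congr ereal_sup; apply/seteqP; split => [_ [B DB <-]|_ [k _ <-]].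
  by move: DB; rewrite DQ => -[k _ <-]; exists k => //; rewrite term.
by exists (Q k); rewrite ?term// DQ; exists k.
Qed.

Lemma weight_representative (w : X -> \bar R) : weight mu d w ->
  exists v : X -> R, [/\ measurable_fun setT v, forall x, 0 < v x &
    {ae mu, forall x, w x = (v x)%:E}].
Proof.
move=> [mw _ w0].
exists (fun x => if (0 < w x)%E && (w x < +oo)%E then fine (w x) else 1); split.
- apply: measurable_fun_ifT => //; last exact: measurableT_comp.
  by apply: measurable_and; apply: measurable_fun_lte => //; exact: measurable_cst.
- move=> x; case: ifP => // /andP[w0x wxoo].
  by rewrite fine_gt0// w0x.
- apply: filterS w0 => x h; rewrite h fineK//.
  by case/andP: h => h1 h2; rewrite ge0_fin_numE// ltW.
Qed.

Hypothesis hX : homogeneous_type d mu.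

Lemma qball_fin x e : (mu (qball d x e) < +oo)%E.
Proof.
have [e0|e0] := ltP 0 e; first exact: qball_measure_lty.
apply: le_lt_trans (qball_measure_lty hX x ltr01).
apply: le_measure; rewrite ?inE; [exact: homogeneous_ball hX _ _|exact: homogeneous_ball hX _ _|].
by move=> y; rewrite /qball /= => h; rewrite (lt_le_trans h)// (le_trans e0).
Qed.

Lemma weight_of_dominated (w : X -> \bar R) (v W : X -> R) :
  weight mu d w -> measurable_fun setT v -> (forall x, 0 < v x) ->
  {ae mu, forall x, w x = (v x)%:E} ->
  measurable_fun setT W -> (forall x, 0 < W x) ->
  (forall x e, exists M, forall y, qball d x e y -> W y <= M * (1 + v y)) ->
  weight mu d (EFin \o W).
Proof.
move=> [mw iw _] mv v0 wv mW W0 WM; split.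
- exact/measurable_EFinP.
- move=> x e; have mB : measurable (qball d x e) := homogeneous_ball hX x e.
  have [M hM] := WM x e.
  have iv : mu.-integrable (qball d x e) (EFin \o v).
    have /integrableP[_ woo] := iw x e; apply/integrableP; split.
      exact/measurable_EFinP/measurable_funTS.
    apply: le_lt_trans woo; rewrite le_eqVlt; apply/orP; left; apply/eqP.
    apply: ae_eq_integral => //.
    + exact/measurable_funTS/measurableT_comp/measurable_EFinP.
    + exact/measurable_funTS/measurableT_comp.
    + by apply: filterS wv => y ->.
  have i1 : mu.-integrable (qball d x e) (cst 1%E).
    apply/integrableP; split; first exact: measurable_cst.
    under eq_integral do rewrite /= normr1.
    by rewrite integral_cst// mul1e; exact: qball_fin.
  apply: (le_integrable mB _ _ (integrableZl mB M (integrableD mB i1 iv))).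
    exact/measurable_EFinP/measurable_funTS.
  move=> y By; change (`|W y|%:E <= `|M * (1 + v y)|%:E)%E.
  rewrite lee_fin (ger0_norm (ltW (W0 y))).
  by apply: le_trans (hM y By) _; exact: ler_norm.
- by apply: nearW => x /=; rewrite lte_fin W0 ltry.
Qed.

Lemma weight1 : weight mu d (fun=> 1%E).
Proof.
split; first exact: measurable_cst.
- move=> x e; apply/integrableP; split; first exact: measurable_cst.
  have mB : measurable (qball d x e) := homogeneous_ball hX x e.
  under eq_integral do rewrite /= normr1.
  by rewrite integral_cst// mul1e; exact: qball_fin.
- by apply: nearW => x; rewrite lte01 ltry.
Qed.

Variables (ms : nat -> R) (Qm : forall k, mu (Q k) = (ms k)%:E) (m0 : forall k, 0 < ms k).

Lemma A_class1 p a at_ : reciprocals eta p a at_ -> (forall o, 0 <= slack r sv a at_ o) ->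
  A_class mu d D r s p (tilde eta p) (fun _ _ => 1%E).
Proof.
move=> Hp b0; split; first by move=> i; exact: weight1.
pose W (i : 'I_m) (x : X) : R := 1.
have mW i : measurable_fun setT (W i) by exact: measurable_cst.
have W0 i x : 0 < W i x by exact: ltr01.
rewrite (A_const_class Hp _ mW W0); last 2 first.
- by move=> i; exact: measurable_cst.
- by move=> i; exact: nearW.
have D1 o x : dual_tuple W o x = 1.
  by case: o => [i|] /=; rewrite ?invr1// big1.
apply: le_lt_trans (ltry 1); apply/(class_leP mQ Qm m0 b0 mW W0) => k.
exists (fun=> 1); split => //; first by rewrite big1.
move=> o; rewrite /mean_le; case: eqVneq => _.
  by apply: nearW => x _; rewrite D1.
under eq_integral do rewrite D1 powR1.
by rewrite integral_cst// powR1.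
Qed.

(** A vanishing norm of some [f_i] cannot be normalised. In this case the bound for the constant
    weights 1 gives norm 0 for [g], the product on the right being 0 even if another norm is
    infinite. *)
Lemma vanishing_tuple p a at_ C (G : set (tuple_fun (R := R) (X := X) (m := m))) :
  reciprocals eta p a at_ -> (forall o, 0 <= slack r sv a at_ o) ->
  (0 < mu setT)%E ->
  nonneg_family G -> weighted_bound mu d D eta r s p C G ->
  forall g f i, G (g, f) -> {ae mu, forall x, f i x = 0%E} -> {ae mu, forall x, g x = 0%E}.
Proof.
move=> Hp b0 mu0 nG wG g f i Gf f0.
have [mg g0 mf _] := nG _ _ Gf.
have := wG _ (A_class1 Hp b0) _ _ Gf.
have [pE a0 at0 atE tE] := Hp.
have pp j : (0 < p j)%E.
  rewrite pE inver; case: eqVneq => // aj.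
  by rewrite lte_fin invr_gt0 lt_neqAle eq_sym aj a0.
have -> : (\prod_(j < m) weighted_Lnorm mu (p j) (f j) (fun=> 1%E) = 0)%E.
  rewrite (bigD1 i)//= [X in (X * _)%E](_ : _ = 0%E) ?mul0e//.
  rewrite /weighted_Lnorm -(Lnorm0 mu (p := p i)) ?gt_eqF//.
  apply: Lnorm_ae_eq; [|exact: measurable_cst|by apply: filterS f0 => x ->; rewrite mul0e].
  by apply: emeasurable_funM => //; exact: measurable_cst.
rewrite mule0 => h.
have tp : (0 < tilde eta p)%E by rewrite tE inver gt_eqF// lte_fin invr_gt0.
have : {ae mu, forall x, setT x -> g x * prod_weight (fun _ : 'I_m => fun=> 1) x = 0}%E.
  apply: (@Lnorm_eq0_eq0 _ _ _ _ _ (tilde eta p)) => //.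
    apply: emeasurable_funM => //; apply: measurable_prod_weight => j; exact: measurable_cst.
  by apply/eqP; rewrite eq_le h Lnorm_ge0.
apply: filterS => x /(_ Logic.I); rewrite /prod_weight big1// mule1.
exact.
Qed.

End WeightBridge.

(** * Scalar extrapolation *)

Section ScalarExtrapolation.
Context {disp : measure_display} {R : realType} {X : measurableType disp}.
Variables (mu : {measure set X -> \bar R}) (d : X -> X -> R).
Hypothesis hX : homogeneous_type d mu.
Variables (N : nat) (L : 'I_N -> dyadic_lattice d).
Hypothesis hL : covers_balls d (dyadic_cubes L).
Variables (m : nat) (i0 : 'I_m) (eta : R) (r : 'I_m -> R) (s : \bar R) (sv : R).
Hypotheses (r1 : forall i, 1 <= r i) (sE : s = (sv%:E^-1)%E) (sv0 : 0 <= sv).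

Let base_ball_nd n : base_ball d n `<=` base_ball d n.+1.
Proof. by move=> y; rewrite /base_ball /qball /= => h; rewrite (lt_trans h)// ltr_nat. Qed.

Let base_ball_cover (x : X) : exists n, base_ball d n x.
Proof.
have [n hn] := qball_sub_base_ball hX x 1; exists n; apply: hn.
rewrite /qball /=; have [_ /(_ x x)] := homogeneous_quasi_metric hX.
by move=> [_ ->].
Qed.

Lemma bounded_part_integral (v : X -> R) (g : X -> \bar R) (t : R) n :
  0 < t -> measurable_fun setT v -> (forall x, 0 < v x) ->
  measurable_fun setT g -> (forall x, 0 <= g x)%E ->
  (\int[mu]_x ((bounded_part (base_ball d) v g n x * v x) `^ t)%:E < +oo)%E.
Proof.
move=> t0 mv v0 mg g0.
have mB : forall n, measurable (base_ball d n) := measurable_base_ball hX.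
apply: le_lt_trans (_ : ((n%:R ^+ 2) `^ t)%:E * mu (base_ball d n) < +oo)%E; last first.
  rewrite lte_mul_pinfty ?lee_fin ?powR_ge0//; exact: (qball_fin hX).
rewrite -[X in mu X]setIT -integral_indic//.
rewrite -ge0_integralZl_EFin ?powR_ge0//; last by apply/measurable_EFinP; exact: measurable_indic.
apply: ge0_le_integral => //.
- by move=> x _; rewrite lee_fin powR_ge0.
- apply/measurable_EFinP/measurable_powR_comp/measurable_funM => //.
  exact: measurable_bounded_part.
- by apply: measurable_funeM; apply/measurable_EFinP; exact: measurable_indic.
move=> x _; rewrite -EFinM lee_fin.
have h := bounded_part_prod_le (base_ball d) g0 v0 n x.
have b0 : 0 <= bounded_part (base_ball d) v g n x * v x.
  by rewrite mulr_ge0 ?bounded_part_ge0// ltW.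
move: h; rewrite indicE; case: (x \in _) => /=; rewrite ?mulr1 ?mulr0 => h.
  by apply: ge0_ler_powR; rewrite ?nnegrE ?(ltW t0)// exprn_ge0.
have -> : bounded_part (base_ball d) v g n x * v x = 0 by apply/eqP; rewrite eq_le h b0.
by rewrite powR0// gt_eqF.
Qed.

Lemma scalar_extrapolation (p q : 'I_m -> \bar R) (C : R -> R) :
  (forall K, 0 < C K) ->
  (0 < inv_tilde eta p)%E -> exp_le r s p (tilde eta p) ->
  (0 < inv_tilde eta q)%E -> exp_lt r s q (tilde eta q) ->
  exists2 C1 : R -> R, (forall K, 0 < C1 K) &
    forall G : set (tuple_fun (R := R) (X := X) (m := m)),
      nonneg_family G ->
      weighted_bound mu d (dyadic_cubes L) eta r s p C G ->
      weighted_bound mu d (dyadic_cubes L) eta r s q C1 G.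
Proof.
move=> hC p0 pl q0 ql.
have [Q [ms [DQ mQ Qm m0 [N0 cov]]]] := dyadic_enumeration hX hL.
have [h0 [mh0 h00 h01 h0b]] := positive_integrable_fun hX.
have [a [at_ Hp]] := reciprocalsP r1 pl.1 p0.
have [b [bt Hq]] := reciprocalsP r1 (fun i => ltW (ql.1 i)) q0.
have b0 := slack_ge0 r1 sE sv0 Hp pl.
have a0 := slack_gt0 r1 sE sv0 Hq ql.
set alpha := slack r sv b bt in a0; set beta := slack r sv a at_ in b0.
have [pE ap at0 atE ptE] := Hp; have [qE bp bt0 btE qtE] := Hq.
have ab : \sum_o alpha o = \sum_o beta o by rewrite (sum_slack _ _ Hq) (sum_slack _ _ Hp).
have gapS j : gap alpha beta (Some j) = a j - b j.
  by rewrite /gap /alpha /beta /slack; ring.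
have gapN : gap alpha beta None = bt - at_.
  by rewrite /gap /alpha /beta /slack; ring.
have mu0 : (0 < mu setT)%E.
  apply: (@lt_le_trans _ _ (mu (Q 0%N))); first by rewrite Qm lte_fin.
  by apply: le_measure; rewrite ?inE.
(* For each value [K] of the weight constant a number is chosen before the family [G], which gives a
   function of [K] alone. *)
suff /choice[C1 hC1] : forall K : R, exists c : R, 0 < c /\
    forall G : set (tuple_fun (R := R) (X := X) (m := m)), nonneg_family G ->
    weighted_bound mu d (dyadic_cubes L) eta r s p C G ->
    forall w, A_class mu d (dyadic_cubes L) r s q (tilde eta q) w ->
    fine (A_const mu (dyadic_cubes L) r s q (tilde eta q) w) = K ->
    forall g f, G (g, f) ->
    (weighted_Lnorm mu (tilde eta q) g (prod_weight w) <=
     c%:E * \prod_(i < m) weighted_Lnorm mu (q i) (f i) (w i))%E.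
  exists C1; first by move=> K; have [] := hC1 K.
  move=> G nG wG w hw g f Gf.
  by have [_ h] := hC1 (fine (A_const mu (dyadic_cubes L) r s q (tilde eta q) w));
  exact: (h G nG wG w hw erefl g f Gf).
move=> K.
(* [K] ranges over all reals, whereas the construction of the weights asks for a bound at least
   1. *)
have K1 : 1 <= Num.max 1 K by rewrite le_max lexx.
have [K2 [c [c0 core]]] :=
  off_diagonal_weights mQ Qm m0 N0 cov mh0 h00 h01 i0 a0 b0 ab bp at0 bt0 gapS gapN K1.
pose Lam : R := mass_bound (R := R) 'I_m; have Lam0 : 0 < Lam by exact: mass_bound_gt0.
(* Obtained by solving [1 <= c * (B1 / M)^(1/at_)] for [M], where [B1] is the bound supplied by the
   hypothesis at the new weights. *)
pose Cst := c `^ at_ * (C K2 * \prod_i Lam `^ a i).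
have Cst0 : 0 < Cst by rewrite !mulr_gt0 ?powR_gt0// prodr_gt0// => i _; rewrite powR_gt0.
exists Cst; split => // G nG wG w [ww wA] wK g f Gf.
have [mg g0 mf f0] := nG _ _ Gf.
have /choice[v hv] : forall i, exists v : X -> R, [/\ measurable_fun setT v, forall x, 0 < v x &
    {ae mu, forall x, w i x = (v x)%:E}].
  by move=> i; exact: weight_representative.
have mw i : measurable_fun setT (w i) by have [] := ww i.
have mv i : measurable_fun setT (v i) by have [] := hv i.
have v0 i x : 0 < v i x by have [] := hv i.
have wv i : {ae mu, forall x, w i x = (v i x)%:E} by have [] := hv i.
have AE := A_const_class r1 sE DQ mQ Hq mw mv v0 wv.
have vK : class_le mu Q alpha v (Num.max 1 K).
  apply/(class_leP mQ Qm m0 (fun o => ltW (a0 o)) mv v0); rewrite -AE.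
  apply: (@le_trans _ _ K%:E); last by rewrite lee_fin le_max lexx orbT.
  rewrite -wK fineK// ge0_fin_numE//.
  have s0 : 0 < \sum_o alpha o.
    rewrite big_option/=; apply: ltr_pwDl; first exact: (a0 None).
    by apply: sumr_ge0 => j _; exact: ltW (a0 (Some j)).
  by rewrite AE (le_trans lee01)// (class_const_ge1 mQ Qm m0 (fun o => ltW (a0 o)) s0 mv v0).
pose F i x := (f i x * (v i x)%:E)%E.
have mF i : measurable_fun setT (F i) by apply: emeasurable_funM => //; exact/measurable_EFinP.
have F0 i x : (0 <= F i x)%E by rewrite mule_ge0// lee_fin ltW.
have FE i : weighted_Lnorm mu (q i) (f i) (w i) = ('N[mu]_((b i)%:E^-1)[F i])%E.
  rewrite /weighted_Lnorm qE; apply: Lnorm_ae_eq => //; first exact: emeasurable_funM.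
  by apply: filterS (wv i) => x ->.
under eq_bigr do rewrite FE.
pose V x := \prod_i v i x.
have V0 x : 0 < V x by exact: prodr_gt0.
have mV : measurable_fun setT V by exact: measurable_prod.
pose gV x := (g x * (V x)%:E)%E.
have mgV : measurable_fun setT gV by apply: emeasurable_funM => //; exact/measurable_EFinP.
have gV0 x : (0 <= gV x)%E by rewrite mule_ge0// lee_fin ltW.
have -> : weighted_Lnorm mu (tilde eta q) g (prod_weight w) = ('N[mu]_(bt%:E^-1)[gV])%E.
  rewrite /weighted_Lnorm qtE; apply: Lnorm_ae_eq => //.
    by apply: emeasurable_funM => //; exact: measurable_prod_weight.
  have : {ae mu, forall x, forall i, w i x = (v i x)%:E} by exact: filter_forall.
  apply: filterS => x h; congr (_ * _)%E; rewrite /prod_weight -prodEFin.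
  by apply: eq_bigr => i _.
have [[i Fi0]|Fn0] := pselect (exists i, 'N[mu]_((b i)%:E^-1)[F i] = 0)%E.
  have bi0 : (0 < (b i)%:E^-1)%E.
    by rewrite inver; case: eqVneq => // bi; rewrite lte_fin invr_gt0 lt_neqAle eq_sym bi bp.
  have fi0 : {ae mu, forall x, f i x = 0%E}.
    have := Lnorm_eq0_eq0 (mF i) bi0 Fi0; apply: filterS => x /(_ I) /eqP.
    by rewrite mule_eq0 eqe (gt_eqF (v0 i x)) orbF => /eqP.
  have gz := vanishing_tuple r1 sE DQ mQ hX Qm m0 Hp b0 mu0 nG wG Gf fi0.
  rewrite (@Lnorm_ae_eq _ _ _ mu _ gV (cst 0%E)) ?Lnorm0//.
  - apply: mule_ge0; first by rewrite lee_fin ltW.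
    by apply: prode_ge0 => j _; exact: Lnorm_ge0.
  - by rewrite inver (gt_eqF bt0) gt_eqF// lte_fin invr_gt0.
  - by apply: filterS gz => x; rewrite /gV => ->; rewrite mul0e.
have Fpos i : (0 < 'N[mu]_((b i)%:E^-1)[F i])%E.
  by rewrite lt0e Lnorm_ge0 andbT; apply/eqP => h; apply: Fn0; exists i.
have [Poo|Pfin] := eqVneq (\prod_(i < m) 'N[mu]_((b i)%:E^-1)[F i])%E +oo%E.
  by rewrite Poo gt0_muley ?leey// lte_fin.
have Ffin i : ('N[mu]_((b i)%:E^-1)[F i])%E \is a fin_num.
  by apply: (prode_gt0_fin Fpos); rewrite ltey.
pose nf i := fine ('N[mu]_((b i)%:E^-1)[F i])%E.
have nfE i : ('N[mu]_((b i)%:E^-1)[F i] = (nf i)%:E)%E by rewrite fineK.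
have nf0 i : 0 < nf i by rewrite -lte_fin -nfE.
under eq_bigr do rewrite nfE.
rewrite prodEFin -EFinM.
have Pnf0 : 0 < \prod_i nf i by exact: prodr_gt0.
pose y i x := fine (F i x) / nf i.
have my i : measurable_fun setT (y i) by apply: measurable_funM => //; exact: measurableT_comp.
have y0 i x : 0 <= y i x by rewrite divr_ge0 ?fine_ge0// ltW.
have yn i : unit_norm mu (b i) (y i).
  by have [] := Lnorm_normalized (bp i) (nf0 i) mu0 (mF i) (F0 i) (nfE i).
have fy i : {ae mu, forall x, f i x = (nf i * (y i x / v i x))%:E}.
  have [ff _] := Lnorm_normalized (bp i) (nf0 i) mu0 (mF i) (F0 i) (nfE i).
  apply: filterS ff => x fx; rewrite /y.
  have -> : nf i * (fine (F i x) / nf i / v i x) = fine (F i x) / v i x.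
    by field; rewrite !gt_eqF.
  by rewrite EFinM fineK// /F -muleA -EFinM divff ?mule1// gt_eqF.
have Bd0 : 0 <= Cst * \prod_i nf i by rewrite mulr_ge0// ltW.
rewrite Lnorm_recip_leP//.
have btV : 0 < bt^-1 by rewrite invr_gt0.
have atV : 0 < at_^-1 by rewrite invr_gt0.
have mB : forall n, measurable (base_ball d n) := measurable_base_ball hX.
pose gn n := bounded_part (base_ball d) V g n.
have gn0 n x : 0 <= gn n x by exact: bounded_part_ge0.
have mgn n : measurable_fun setT (gn n) by exact: measurable_bounded_part.
have gnV0 n x : 0 <= gn n x * V x by rewrite mulr_ge0 ?(ltW (V0 x)).
pose u n x := (gn n x * V x) `^ bt^-1.
have mu_ n : measurable_fun setT (fun x => (u n x)%:E).
  by apply/measurable_EFinP/measurable_powR_comp; exact: measurable_funM.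
have u0 n x : (0 <= (u n x)%:E)%E by rewrite lee_fin powR_ge0.
(* By monotone convergence it suffices to bound the norms of the truncations of [g]. *)
apply: (@le_trans _ _ (\int[mu]_x ereal_sup (range (fun n => (u n x)%:E)))%E).
  apply: ge0_le_integral => //.
  - by move=> x _; exact: poweR_ge0.
  - exact: measurable_poweR_abse.
  - exact: measurable_ereal_sup.
  by move=> x _; rewrite gee0_abs//; exact: bounded_part_sup.
apply: (integral_nd_sup_le (g := fun n x => (u n x)%:E)) => //.
  move=> x k l kl; rewrite lee_fin; apply: ge0_ler_powR; rewrite ?nnegrE ?(ltW btV)//.
  by rewrite ler_wpM2r ?(ltW (V0 x))//; exact: bounded_part_nd.
move=> n; have Ioo : (\int[mu]_x (u n x)%:E < +oo)%E by exact: bounded_part_integral.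
have I0 : (0 <= \int[mu]_x (u n x)%:E)%E by exact: integral_ge0.
case uI : (\int[mu]_x (u n x)%:E)%E Ioo I0 => [i'||]// _; rewrite !lee_fin.
rewrite le_eqVlt => /predU1P[<-|i'0]; first exact: powR_ge0.
(* The norm of the truncated [g v], now finite and positive. *)
pose M := i' `^ bt; have M0 : 0 < M by exact: powR_gt0.
pose y_0 x := gn n x * V x / M.
have my0 : measurable_fun setT y_0 by apply: measurable_funM => //; exact: measurable_funM.
have y00 x : 0 <= y_0 x by rewrite divr_ge0 ?(ltW M0).
have MV : M `^ bt^-1 = i' by rewrite -powRrM mulfV ?gt_eqF// powRr1// ltW.
have y01 : (\int[mu]_x (y_0 x `^ bt^-1)%:E = 1)%E.
  have yE x : y_0 x `^ bt^-1 = i'^-1 * u n x.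
    rewrite /y_0 (powRM _ (gnV0 n x)) ?invr_ge0 ?(ltW M0)//.
    by rewrite powRV ?(ltW M0)// MV mulrC.
  under eq_integral do rewrite yE EFinM.
  rewrite ge0_integralZl_EFin ?invr_ge0 ?(ltW i'0)//.
  by rewrite uI -EFinM mulVf// gt_eqF.
have [W [H [hW WK Wloc [mH H0 HL yW] low]]] := core v mv v0 vK y y_0 my y0 yn my0 y00 y01.
pose B1 := C K2 * \prod_i (nf i * Lam `^ a i).
have B10 : 0 < B1.
  by rewrite mulr_gt0// prodr_gt0// => i _; rewrite mulr_gt0// powR_gt0.
(* The hypothesis is applied to [g] itself, since the truncated function need not belong to a tuple
   of [G]; its left-hand side is then lowered to the truncation. *)
have bound k : (\int[mu]_x ((y_0 x * \prod_j (W k j x / v j x)) `^ at_^-1)%:E <=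
    ((B1 / M) `^ at_^-1)%:E)%E.
  have mW j : measurable_fun setT (W k j) by have [] := hW k j.
  have W0 j x : 0 < W k j x by have [] := hW k j.
  pose w' i := EFin \o W k i.
  have mw' i : measurable_fun setT (w' i) by exact/measurable_EFinP.
  have wW i : {ae mu, forall x, w' i x = (W k i x)%:E} by exact: nearW.
  have A' := A_const_class r1 sE DQ mQ Hp mw' mW W0 wW.
  have hw' : A_class mu d (dyadic_cubes L) r s p (tilde eta p) w'.
    split; last by rewrite A' WK ltry.
    move=> i; apply: (weight_of_dominated hX (ww i) (mv i) (v0 i) (wv i) (mW i) (W0 i)) => x e.
    have [e' e'0 he'] := h0b x e; have [M' hM'] := Wloc k i e' e'0.
    by exists M' => z Bz; apply: hM'; exact: he'.
  have := wG _ hw' _ _ Gf; rewrite A' WK /= => hyp.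
  have {}hyp : ('N[mu]_(at_%:E^-1)[(fun x => g x * prod_weight w' x)] <= B1%:E)%E.
    rewrite -ptE; apply: le_trans hyp _; rewrite EFinM; apply: lee_wpmul2l.
      by rewrite lee_fin ltW.
    rewrite -prodEFin; apply: lee_prod_ge0 => i; first exact: Lnorm_ge0.
    rewrite /weighted_Lnorm pE; apply: (Lnorm_le_density (H := H)) => //.
    - exact: ltW.
    - exact: ltW.
    - exact: emeasurable_funM.
    apply: filterS2 (fy i) (yW k i) => x -> h.
    rewrite -EFinM gee0_abs; last first.
      rewrite lee_fin; apply: mulr_ge0; last exact: ltW.
      by apply: mulr_ge0; [exact: ltW|apply: divr_ge0; [exact: y0|exact: ltW]].
    rewrite lee_fin -mulrA ler_pM2l//; apply: le_trans h.
    by rewrite (mulrAC (y i x)) -(mulrA (y i x)).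
  rewrite Lnorm_recip_leP ?(ltW B10)// in hyp.
  rewrite powRM ?invr_ge0 ?(ltW B10) ?(ltW M0)// mulrC EFinM.
  apply: le_trans (lee_wpmul2l _ hyp); last by rewrite lee_fin powR_ge0.
  have mgw : measurable_fun setT (fun x => g x * prod_weight w' x)%E.
    by apply: emeasurable_funM => //; exact: measurable_prod_weight.
  rewrite -ge0_integralZl_EFin ?powR_ge0//; last exact: measurable_poweR_abse.
  apply: ge0_le_integral => //.
  - by move=> x _; rewrite lee_fin powR_ge0.
  - apply/measurable_EFinP/measurable_powR_comp/measurable_funM => //.
    apply: measurable_prod => j _.
    rewrite (_ : (fun x => _) = fun x => W k j x * v j x `^ (-1)).
      by apply: measurable_funM => //; exact: measurable_powR_comp.
    by apply/funext => x; rewrite powR_inv1// ltW.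
  - by apply: measurable_funeM; exact: measurable_poweR_abse.
  move=> x _; have PW0 : 0 < \prod_i W k i x by exact: prodr_gt0.
  have -> : y_0 x * \prod_j (W k j x / v j x) = M^-1 * (gn n x * \prod_i W k i x).
    rewrite big_split/= prodfV -/(V x) /y_0; field.
    by rewrite !gt_eqF.
  have gP0 : 0 <= gn n x * \prod_i W k i x by apply: mulr_ge0; [exact: gn0|exact: ltW].
  rewrite (powRM _ _ gP0) ?invr_ge0 ?(ltW M0)// EFinM.
  apply: lee_wpmul2l; first by rewrite lee_fin powR_ge0.
  rewrite -poweR_EFin; apply: le_poweR; first exact: ltW.
    by rewrite lee_fin.
  rewrite prod_weight_EFin gee0_abs; last by rewrite mule_ge0// lee_fin ltW.
    by rewrite EFinM; apply: lee_wpmul2r; [rewrite lee_fin ltW|exact: bounded_part_le].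
  by move=> x _; exact: poweR_ge0.
have := low _ bound => {}low.
have M_le : M <= Cst * \prod_i nf i.
  have h : 1 <= (c * (B1 / M) `^ at_^-1) `^ at_.
    have e1 : 1 `^ at_ = 1 :> R by rewrite powR1.
    rewrite -[leLHS]e1; apply: ge0_ler_powR; rewrite ?nnegrE ?(ltW at0)//.
    by rewrite mulr_ge0 ?powR_ge0// ltW.
  move: h; rewrite powRM ?powR_ge0 ?(ltW c0)// -powRrM mulVf ?gt_eqF// powRr1; last first.
    by rewrite divr_ge0 ?(ltW B10) ?(ltW M0).
  rewrite mulrA ler_pdivlMr// mul1r => h; apply: le_trans h _.
  by rewrite /Cst /B1 big_split/= le_eqVlt; apply/orP; left; apply/eqP; ring.
by rewrite -MV; apply: ge0_ler_powR; rewrite ?nnegrE ?(ltW btV) ?(ltW M0).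
Qed.

End ScalarExtrapolation.

(** * Mixed norms and Hölder's inequality for series *)

Section MixedNorms.
Context {disp : measure_display} {R : realType} {X : measurableType disp}.
Variable mu : {measure set X -> \bar R}.
Local Open Scope ereal_scope.

Definition entry (J : set nat) (h : nat -> X -> \bar R) (k : nat) (x : X) : \bar R :=
  ((h ^~ x) \_ J) k.

Lemma ae_counting (P : nat -> Prop) : {ae (@counting nat R), forall k, P k} -> forall k, P k.
Proof.
move=> [A [_ A0 PA]] k; apply: contrapT => nP.
have : counting [set k] <= counting A :> \bar R.
  by apply: le_measure; rewrite ?inE// => _ ->; exact: PA.
rewrite [leRHS]A0 /counting asboolT// fset_set1 finmap.cardfs1 lee_fin.
by rewrite leNgt ltr01.
Qed.

Lemma counting_setT_gt0 : 0 < counting [set: nat] :> \bar R.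
Proof. by rewrite /counting asboolF ?ltry//; exact: infinite_nat. Qed.

Lemma lt_norm_recip (b : R) (J : set nat) (h : nat -> X -> \bar R) x : (0 < b)%R ->
  lt_norm (b%:E^-1) J h x = (\sum_(k <oo) `|entry J h k x| `^ b^-1) `^ b.
Proof.
move=> b0; rewrite /lt_norm Lnorm_recip// ge0_integral_count// => k.
exact: poweR_ge0.
Qed.

Lemma lt_norm_sup (J : set nat) (h : nat -> X -> \bar R) x :
  lt_norm (0%:E^-1) J h x = ereal_sup (range (fun k => `|entry J h k x|)).
Proof.
rewrite /lt_norm Lnorm_recip0; last exact: counting_setT_gt0.
apply/eqP; rewrite eq_le; apply/andP; split.
  by apply/ess_supP; apply: nearW => k /=; apply: ereal_sup_ubound; exists k.
apply: ge_ereal_sup => _ [k _ <-].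
by apply: (ae_counting (P := fun k => `|entry J h k x| <= _)); exact: ess_sup_ge.
Qed.

Lemma entry_in (J : set nat) (h : nat -> X -> \bar R) k : J k -> entry J h k = h k.
Proof. by move=> Jk; apply/funext => x; rewrite /entry patchE mem_set. Qed.

Lemma entry_out (J : set nat) (h : nat -> X -> \bar R) k : ~ J k -> entry J h k = cst 0.
Proof. by move=> Jk; apply/funext => x; rewrite /entry patchE memNset. Qed.

Lemma measurable_lt_norm (b : R) (J : set nat) (h : nat -> X -> \bar R) : (0 <= b)%R ->
  (forall k, measurable_fun setT (entry J h k)) -> measurable_fun setT (lt_norm (b%:E^-1) J h).
Proof.
rewrite le_eqVlt => /predU1P[<-|b0] mh.
  rewrite (_ : lt_norm _ J h = fun x => ereal_sup (range (fun k => `|entry J h k x|))).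
    by apply: measurable_ereal_sup => // k; exact: measurableT_comp.
  by apply/funext => x; exact: lt_norm_sup.
rewrite (_ : lt_norm _ J h = fun x => (\sum_(k <oo) `|entry J h k x| `^ b^-1) `^ b); last first.
  by apply/funext => x; exact: lt_norm_recip.
apply: (measurableT_comp (measurable_poweR _)).
apply: (@ge0_emeasurable_sum _ _ _ _ (fun k x => `|entry J h k x| `^ b^-1) predT).
  by move=> k x _ _; exact: poweR_ge0.
by move=> k _; exact: measurable_poweR_abse.
Qed.

(** Read as an integral against the counting measure, the identity also covers [y = +oo]. *)
Lemma nneseriesZr_ge0 (a : nat -> \bar R) (y : \bar R) : (forall k, 0 <= a k) -> 0 <= y ->
  (\sum_(k <oo) a k) * y = \sum_(k <oo) (a k * y).
Proof.
move=> a0 y0; rewrite -(ge0_integral_count a0) -[RHS]ge0_integral_count; last first.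
  by move=> k; rewrite mule_ge0.
by rewrite ge0_integralZr.
Qed.

(** With equal exponents inside and outside, summation and integration commute by monotone
    convergence. *)
Lemma Lnorm_lt_norm (b : R) (J : set nat) (h : nat -> X -> \bar R) (w : X -> \bar R) :
  (0 < b)%R -> (forall k, measurable_fun setT (entry J h k)) -> measurable_fun setT w ->
  'N[mu]_(b%:E^-1)[(fun x => lt_norm (b%:E^-1) J h x * w x)] `^ b^-1 =
  \sum_(k <oo) 'N[mu]_(b%:E^-1)[(fun x => entry J h k x * w x)] `^ b^-1.
Proof.
move=> b0 mh mw.
have NE F : 'N[mu]_(b%:E^-1)[F] `^ b^-1 = \int[mu]_x (`|F x| `^ b^-1).
  rewrite Lnorm_recip// -poweRrM mulfV ?gt_eqF// poweRe1//.
  by apply: integral_ge0 => x _; exact: poweR_ge0.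
rewrite NE; under [RHS]eq_eseriesr do rewrite NE.
rewrite -integral_nneseries//; last 2 first.
- by move=> k; apply: measurable_poweR_abse; exact: emeasurable_funM.
- by move=> k x _; exact: poweR_ge0.
apply: eq_integral => x _; rewrite lt_norm_recip// abseM.
have S0 : 0 <= \sum_(k <oo) `|entry J h k x| `^ b^-1.
  by apply: nneseries_ge0 => k _ _; exact: poweR_ge0.
rewrite poweRM// gee0_abs ?poweR_ge0// -poweRrM mulfV ?gt_eqF// poweRe1//.
rewrite nneseriesZr_ge0 ?poweR_ge0//; last by move=> k; exact: poweR_ge0.
by apply: eq_eseriesr => k _; rewrite abseM poweRM.
Qed.

Lemma Lnorm_lt_norm_sup (J : set nat) (h : nat -> X -> \bar R) (w : X -> \bar R) k :
  0 < mu setT ->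
  'N[mu]_(0%:E^-1)[(fun x => entry J h k x * w x)] <=
  'N[mu]_(0%:E^-1)[(fun x => lt_norm (0%:E^-1) J h x * w x)].
Proof.
move=> m0; rewrite !Lnorm_recip0//; apply: le_ess_sup; apply: nearW => x /=.
rewrite !abseM; apply: lee_wpmul2r => //; rewrite lt_norm_sup.
by apply: le_trans (lee_abs _); apply: ereal_sup_ubound; exists k.
Qed.

Lemma eseries_le (a : nat -> \bar R) (B : \bar R) : (forall k, 0 <= a k) ->
  (forall n, \sum_(0 <= k < n) a k <= B) -> \sum_(k <oo) a k <= B.
Proof.
move=> a0 aB; apply: lime_le; first by apply: is_cvg_nneseries => k _ _.
by apply: nearW => n; exact: aB.
Qed.

(** The reciprocal exponents [b_i] may add up to more than [bt], which is what [0 <= eta] leads to.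
    After normalisation all terms are at most 1, so the excess only makes the sum smaller. An index
    with [b_i = 0] enters through its supremum. *)
Lemma holder_series (I : finType) (b : I -> R) (bt : R)
    (A : I -> nat -> \bar R) (B : I -> \bar R) :
  (forall i, 0 <= b i)%R -> (0 < bt)%R -> (bt <= \sum_i b i)%R ->
  (forall i k, 0 <= A i k) -> (forall i, 0 <= B i) ->
  (forall i, (0 < b i)%R -> \sum_(k <oo) A i k `^ (b i)^-1 <= B i `^ (b i)^-1) ->
  (forall i k, b i = 0%R -> A i k <= B i) ->
  \sum_(k <oo) (\prod_i A i k) `^ bt^-1 <= (\prod_i B i) `^ bt^-1.
Proof.
move=> b0 bt0 bbt A0 B0 AB A0B.
have btV : (bt^-1 != 0)%R by rewrite invr_neq0 ?gt_eqF.
have AB' i k : A i k <= B i.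
  have [/A0B//|bi] := eqVneq (b i) 0%R.
  have bi0 : (0 < b i)%R by rewrite lt_neqAle eq_sym bi b0.
  have h : A i k `^ (b i)^-1 <= B i `^ (b i)^-1.
    apply: le_trans (AB i bi0); have p j : 0 <= A i j `^ (b i)^-1 by exact: poweR_ge0.
    apply: le_trans (nneseries_lim_ge k.+1 (fun j _ _ => p j)).
    by rewrite big_nat_recr//= leeDr// sume_ge0.
  have := le_poweR (ltW bi0) (poweR_ge0 _ _) h.
  by rewrite -!poweRrM mulVf// !poweRe1.
have P0 (u : I -> \bar R) : (forall i, 0 <= u i) -> 0 <= \prod_i u i.
  by move=> u0; apply: prode_ge0 => i _.
have [[i Bi]|B1] := pselect (exists i, B i = 0).
  have Ai k : A i k = 0 by apply/eqP; rewrite eq_le A0 -Bi AB'.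
  rewrite eseries0 ?poweR_ge0// => k _ _.
  by rewrite (bigD1 i)//= Ai mul0e poweR0r.
have Bp i : 0 < B i by rewrite lt0e B0 andbT; apply/eqP => h; apply: B1; exists i.
have [->|Boo] := eqVneq (\prod_i B i) +oo; first by rewrite poweRyr// leey.
have Bf i : B i \is a fin_num by apply: (prode_gt0_fin Bp); rewrite ltey.
pose c i := fine (B i); have cE i : B i = (c i)%:E by rewrite fineK.
have c0 i : (0 < c i)%R by rewrite -lte_fin -cE.
pose y i k := (fine (A i k) / c i)%R.
have Af i k : A i k \is a fin_num.
  by rewrite ge0_fin_numE// (le_lt_trans (AB' i k))// cE ltry.
have yE i k : A i k = (c i * y i k)%:E by rewrite /y mulrC divfK ?gt_eqF// fineK.
have y0 i k : (0 <= y i k)%R by apply: divr_ge0; [exact: fine_ge0|exact: ltW].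
have y1 i k : (y i k <= 1)%R.
  by have := AB' i k; rewrite yE cE lee_fin ger_pMr.
clearbody y c.
pose s := (\sum_i b i)%R; have s0 : (0 < s)%R by exact: lt_le_trans bbt.
pose z i k := if b i == 0%R then 0%R else (y i k `^ (b i)^-1)%R.
have z0 i k : (0 <= z i k)%R by rewrite /z; case: ifP => // _; exact: powR_ge0.
have zsum i n : (\sum_(0 <= k < n) z i k <= 1)%R.
  rewrite /z; case: eqVneq => [_|bi]; first by rewrite big1// ler01.
  have bi0 : (0 < b i)%R by rewrite lt_neqAle eq_sym bi b0.
  have h : \sum_(0 <= k < n) A i k `^ (b i)^-1 <= B i `^ (b i)^-1.
    apply: le_trans (AB i bi0); apply: nneseries_lim_ge => k _ _; exact: poweR_ge0.
  have : ((c i `^ (b i)^-1 * \sum_(0 <= k < n) y i k `^ (b i)^-1)%R%:E <= (c i `^ (b i)^-1)%R%:E).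
    rewrite mulr_sumr -sumEFin -poweR_EFin -cE; apply: le_trans h.
    rewrite le_eqVlt; apply/orP; left; apply/eqP; apply: eq_bigr => k _.
    by rewrite yE poweR_EFin powRM// ltW.
  by rewrite lee_fin ger_pMr// powR_gt0.
(* As [y <= 1] and [bt <= s], the power [1 / bt] is at most the power [1 / s], to which AM-GM with
   the weights [b i / s] applies. *)
have key k : (\prod_i y i k `^ bt^-1 <= \sum_i (b i / s) * z i k)%R.
  have a1 : (\sum_i b i / s = 1)%R by rewrite -mulr_suml divff// gt_eqF.
  have a0 i : (0 <= b i / s)%R by rewrite divr_ge0// ltW.
  apply: le_trans (weighted_AMGM a0 (fun i => z0 i k) a1).
  apply: ler_prod => i _; rewrite powR_ge0/= /z.
  case: eqVneq => [->|bi].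
    have e1 : (1 `^ bt^-1 = 1 :> R)%R by rewrite powR1.
    rewrite mul0r powRr0 -[leRHS]e1.
    by apply: ge0_ler_powR; rewrite ?nnegrE// invr_ge0 ltW.
  rewrite -powRrM mulrA mulVf// mul1r.
  have [->|yi] := eqVneq (y i k) 0%R; first by rewrite powR0 ?powR_ge0.
  apply: ger_powR; first by rewrite y1 andbT lt_neqAle eq_sym yi y0.
  by rewrite lef_pV2 ?posrE.
have rhsE : (\prod_i B i) `^ bt^-1 = ((\prod_i c i) `^ bt^-1)%R%:E.
  by rewrite -poweR_EFin -prodEFin; congr (_ `^ _); apply: eq_bigr => i _.
rewrite rhsE; apply: eseries_le => [k|n]; first exact: poweR_ge0.
have lhsE k : (\prod_i A i k) `^ bt^-1 = ((\prod_i c i) `^ bt^-1 * \prod_i y i k `^ bt^-1)%R%:E.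
  rewrite (eq_bigr (fun i => (c i * y i k)%:E)); last by move=> i _; exact: yE.
  rewrite prodEFin poweR_EFin big_split/= powRM ?prodr_ge0//; last first.
    by move=> i _; exact: ltW.
  by rewrite [in X in (_ * X)%R]powR_prod.
rewrite (eq_bigr _ (fun k _ => lhsE k)).
rewrite sumEFin lee_fin -mulr_sumr ger_pMr; last by rewrite powR_gt0// prodr_gt0.
apply: (@le_trans _ _ (\sum_(0 <= k < n) \sum_i (b i / s) * z i k)%R).
  by apply: ler_sum => k _; exact: key.
rewrite exchange_big/=; apply: (@le_trans _ _ (\sum_i b i / s)%R).
  apply: ler_sum => i _; rewrite -mulr_sumr ler_piMr//.
  by rewrite divr_ge0// ltW.
by rewrite -mulr_suml divff// gt_eqF.
Qed.

End MixedNorms.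

(** * The family of [l^t] sums *)

Section VectorExtrapolation.
Context {disp : measure_display} {R : realType} {X : measurableType disp}.
Variables (mu : {measure set X -> \bar R}) (d : X -> X -> R) (D : set (set X)).
Variables (m : nat) (eta : R) (r : 'I_m -> R) (s : \bar R).
Hypotheses (mu0 : (0 < mu setT)%E) (eta0 : 0 <= eta).

Definition vector_family (t : 'I_m -> \bar R) (G : set (tuple_fun (R := R) (X := X) (m := m))) :
    set (tuple_fun (R := R) (X := X) (m := m)) :=
  [set gf | exists (J : set nat) (g : nat -> X -> \bar R) (f : nat -> 'I_m -> X -> \bar R),
     (forall j, J j -> G (g j, f j)) /\
     gf = (lt_norm (tilde eta t) J g, fun i => lt_norm (t i) J (fun j => f j i))].

Variables (t : 'I_m -> \bar R) (b : 'I_m -> R) (bt : R).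
Hypothesis Ht : reciprocals eta t b bt.
Variable G : set (tuple_fun (R := R) (X := X) (m := m)).
Hypothesis nG : nonneg_family G.

Let entries J g f : (forall j, J j -> G (g j, f j)) ->
  (forall k, measurable_fun setT (entry J g k)) /\
  (forall i k, measurable_fun setT (entry J (fun j => f j i) k)).
Proof.
move=> JG; split=> [k|i k]; have [Jk|nJk] := pselect (J k);
  by [rewrite entry_in//; have [] := nG (JG _ Jk)|rewrite entry_out//; exact: measurable_cst].
Qed.

Lemma nonneg_vector_family : nonneg_family (vector_family t G).
Proof.
have [tE b0 bt0 btE ttE] := Ht.
move=> _ _ [J [g [f [JG [-> ->]]]]]; have [mg mf] := entries JG; split.
- by rewrite ttE; apply: measurable_lt_norm => //; exact: ltW.
- by move=> x; exact: Lnorm_ge0.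
- by move=> i; rewrite tE; exact: measurable_lt_norm.
- by move=> i x; exact: Lnorm_ge0.
Qed.

(** The bounds for the single tuples are raised to the power [1 / bt] and added up by
    [holder_series]. As sums and norms have the same exponents, [Lnorm_lt_norm] identifies the
    result with the bound for the sums, and the constant is preserved. *)
Lemma weighted_bound_vector_family (C : R -> R) : (forall K, 0 < C K) ->
  weighted_bound mu d D eta r s t C G ->
  weighted_bound mu d D eta r s t C (vector_family t G).
Proof.
have [tE b0 bt0 btE ttE] := Ht.
move=> C0 wG w hw _ _ [J [g [f [JG [-> ->]]]]]; have [mg mf] := entries JG.
set K := C _; have K0 : 0 < K by exact: C0.
have mw i : measurable_fun setT (w i) by have [/(_ i)[]] := hw.
have mW : measurable_fun setT (prod_weight w) by exact: measurable_prod_weight.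
pose A i k := ('N[mu]_((b i)%:E^-1)[(fun x => entry J (fun j => f j i) k x * w i x)])%E.
pose B i := ('N[mu]_((b i)%:E^-1)[(fun x => lt_norm ((b i)%:E^-1) J (fun j => f j i) x * w i x)])%E.
pose Gk k := ('N[mu]_(bt%:E^-1)[(fun x => entry J g k x * prod_weight w x)])%E.
have P0 (u : 'I_m -> \bar R) : (forall i, 0 <= u i)%E -> (0 <= \prod_i u i)%E.
  by move=> u0; apply: prode_ge0 => i _.
have KE : (0 <= K%:E)%E by rewrite lee_fin ltW.
have GA k : (Gk k <= K%:E * \prod_i A i k)%E.
  have [Jk|nJk] := pselect (J k).
    have AE i : A i k = ('N[mu]_((b i)%:E^-1)[(fun x => f k i x * w i x)])%E.
      by rewrite /A entry_in.
    have := wG _ hw _ _ (JG _ Jk); rewrite -/K /weighted_Lnorm ttE tE.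
    by rewrite /Gk entry_in// (eq_bigr _ (fun i _ => AE i)).
  apply: le_trans (_ : 0 <= _)%E; last by rewrite mule_ge0// P0// => i; exact: Lnorm_ge0.
  rewrite /Gk entry_out//; under eq_Lnorm do rewrite /= mul0e.
  rewrite Lnorm0// inver (gt_eqF bt0) gt_eqF// lte_fin invr_gt0//.
have sb : bt <= \sum_i b i by rewrite btE lerBlDr lerDl.
have hs : (\sum_(k <oo) (\prod_i A i k) `^ bt^-1 <= (\prod_i B i) `^ bt^-1)%E.
  apply: (holder_series b0 bt0 sb).
  - by move=> i k; exact: Lnorm_ge0.
  - by move=> i; exact: Lnorm_ge0.
  - by move=> i bi; rewrite /A /B Lnorm_lt_norm.
  - by move=> i k bi; rewrite /A /B bi; exact: Lnorm_lt_norm_sup.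
have btV : 0 <= bt^-1 by rewrite invr_ge0 ltW.
have h : (('N[mu]_(bt%:E^-1)[(fun x => lt_norm (bt%:E^-1) J g x * prod_weight w x)]) `^ bt^-1 <=
    (K%:E * \prod_i B i) `^ bt^-1)%E.
  rewrite Lnorm_lt_norm// poweRM ?P0//; last by move=> i; exact: Lnorm_ge0.
  apply: le_trans (lee_wpmul2l (poweR_ge0 _ _) hs); rewrite muleC.
  rewrite nneseriesZr_ge0 ?poweR_ge0//; last by move=> k; exact: poweR_ge0.
  apply: lee_nneseries => k _; first by move=> _; exact: poweR_ge0.
  rewrite -poweRM ?P0//; last by move=> i; exact: Lnorm_ge0.
  rewrite [X in (_ <= X `^ _)%E]muleC.
  exact: (le_poweR btV (Lnorm_ge0 _ _ _) (GA k)).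
rewrite /weighted_Lnorm ttE tE.
have := le_poweR (ltW bt0) (poweR_ge0 _ _) h.
by rewrite -!poweRrM mulVf ?gt_eqF// !poweRe1 ?mule_ge0 ?Lnorm_ge0 ?P0// => i; exact: Lnorm_ge0.
Qed.

End VectorExtrapolation.

Theorem theorem2p10 (disp : measure_display) (R : realType)
    (X : measurableType disp) (mu : {measure set X -> \bar R})
    (d : X -> X -> R) (hX : homogeneous_type d mu)
    (N : nat) (L : 'I_N -> dyadic_lattice d)
    (hL : covers_balls d (dyadic_cubes L))
    (m : nat) (eta : R) (heta : 0 <= eta < m%:R)
    (r : 'I_m -> R) (hr : forall i, 1 <= r i)
    (s' : R) (hs' : 1 <= s') (s : \bar R) (hs : s = hoelder_conjugate s'%:E)
    (p : 'I_m -> \bar R) (hp0 : (0 < inv_tilde eta p)%E)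
    (hp : exp_le r s p (tilde eta p))
    (C : R -> R) (hC : forall K, 0 < C K) :
  forall q : 'I_m -> \bar R,
    (0 < inv_tilde eta q)%E -> exp_lt r s q (tilde eta q) ->
    (exists2 C1 : R -> R, (forall K, 0 < C1 K) &
       forall G : set (tuple_fun (R := R) (X := X) (m := m)),
         nonneg_family G ->
         weighted_bound mu d (dyadic_cubes L) eta r s p C G ->
         weighted_bound mu d (dyadic_cubes L) eta r s q C1 G) /\
    (forall t : 'I_m -> \bar R,
       (0 < inv_tilde eta t)%E -> exp_lt r s t (tilde eta t) ->
       exists2 C2 : R -> R, (forall K, 0 < C2 K) &
         forall G : set (tuple_fun (R := R) (X := X) (m := m)),
           nonneg_family G ->
           weighted_bound mu d (dyadic_cubes L) eta r s p C G ->
           vector_weighted_bound mu d (dyadic_cubes L) eta r s q t C2 G).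
Proof.
have [eta0 etam] := andP heta.
(* By [0 <= eta < m] there is at least one weight, which can be singled out for the tilt. *)
have m0 : (0 < m)%N by rewrite -(ltr_nat R) (le_lt_trans eta0).
pose i0 : 'I_m := Ordinal m0.
have s'0 : 0 < s' by exact: lt_le_trans hs'.
(* For [s' = 1] this reads [s = 0^-1 = +oo]. *)
have sE : s = ((1 - s'^-1)%:E^-1)%E.
  have : ((s'%:E)^-1 + s^-1 = 1)%E.
    by rewrite hs hoelder_conjugate_eq1 ?ltNyr// eqe gt_eqF.
  rewrite inver gt_eqF// => h.
  have -> : (1 - s'^-1)%:E = (s^-1)%E; last by rewrite inveK.
  by case: (s^-1)%E h => [z||]//; rewrite -EFinD => -[<-]; congr EFin; ring.
have sv0 : 0 <= 1 - s'^-1 by rewrite subr_ge0 invf_le1.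
move=> q hq0 hq; split;
  first exact: (scalar_extrapolation hX hL i0 hr sE sv0 hC hp0 hp hq0 hq).
move=> t ht0 ht.
(* The function [C1] of the step from [p] to [t] becomes the given one in the step from [t] to
   [q]. *)
have [C1 C10 h1] := scalar_extrapolation hX hL i0 hr sE sv0 hC hp0 hp ht0 ht.
have htle : exp_le r s t (tilde eta t).
  by split; [move=> i; exact/ltW/ht.1|exact/ltW/ht.2].
have [C2 C20 h2] := scalar_extrapolation hX hL i0 hr sE sv0 C10 ht0 htle hq0 hq.
exists C2 => // G nG wG w hw J g f JG.
have [b [bt Ht]] := reciprocalsP hr htle.1 ht0.
have mu0 : (0 < mu setT)%E.
  apply: lt_le_trans (qball_measure_gt0 hX point ltr01) _.
  by apply: le_measure; rewrite ?inE//; exact: homogeneous_ball hX _ _.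
have wt := weighted_bound_vector_family mu0 eta0 Ht nG C10 (h1 _ nG wG).
by apply: (h2 _ (nonneg_vector_family Ht nG) wt _ hw); exists J, g, f.
Qed.
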